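(* Let $\mathcal{H}_1$ and $\mathcal{H}_2$ be weighted Hardy spaces in $d$ variables, with generating functions $G_1(t)=\sum_{n=0}^\infty a_nt^n$ and $G_2(t)=\sum_{n=0}^\infty b_nt^n$ respectively. The following are equivalent: (1) There exists a unitary weighted composition operator $W_{\lambda,\varphi}:\mathcal{H}_2\to\mathcal{H}_1$. (2) There exists a coisometric weighted composition operator $W_{\lambda,\varphi}:\mathcal{H}_2\to\mathcal{H}_1$. (3) There exists $\gamma\in(0,\infty)$ such that $a_n=b_n\gamma^n$ for all $n$.
   Context: For $d\in\mathbb{N}$ and $r\in(0,\infty]$ let $r\mathbb{B}_d=\{z\in\mathbb{C}^d:|z|<r\}$ and $\overline{r\mathbb{B}_d}=\{z\in\mathbb{C}^d:|z|\le r\}$ (both equal to $\mathbb{C}^d$ if $r=\infty$); $\langle\cdot,\cdot\rangle_d$ is the standard inner product on $\mathbb{C}^d$. A Hilbert function space (RKHS) on a set $X$ is a Hilbert space of complex functions on $X$ all of whose point evaluations are bounded. Generating function: a power series $G(t)=\sum_{n\ge0}a_nt^n$ with $a_0=1$, $a_n>0$ for all $n$, and radius of convergence in $(0,\infty]$. Weighted Hardy space in $d$ variables: a Hilbert function space of holomorphic functions on a ball $r\mathbb{B}_d$, $r\in(0,\infty]$, in which the monomials $z^\alpha$ form a complete orthogonal set of nonzero vectors with $\|z^\alpha\|^2/\alpha!=\|z^\beta\|^2/\beta!$ whenever $|\alpha|=|\beta|$, and $\|\mathbf{1}\|=1$. Equivalently its reproducing kernel is $K(z,w)=G(\langle z,w\rangle_d)$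 for a (unique) generating function $G=\sum a_nt^n$ (the generating function of the space), and then $\|z^\alpha\|^{-2}=a_{|\alpha|}\frac{|\alpha|!}{\alpha!}$. Convention: every weighted Hardy space is regarded as a space of functions on its natural maximal domain $X$: if $r^2\in(0,\infty]$ is the radius of convergence of $G$, then $X=\mathbb{C}^d$ if $r=\infty$; $X=r\mathbb{B}_d$ if $r<\infty$ and $G(r^2)=\infty$; $X=\overline{r\mathbb{B}_d}$ if $r<\infty$ and $G(r^2)<\infty$ (functions then extend continuously to the closed ball). For Hilbert function spaces $\mathcal{H}_i$ on $X_i$, a weighted composition operator $W_{\lambda,\varphi}:\mathcal{H}_2\to\mathcal{H}_1$ is a bounded operator $f\mapsto\lambda\,(f\circ\varphi)$ with $\varphi:X_1\to X_2$ and $\lambda:X_1\to\mathbb{C}$. An operator is a coisometry if its adjoint is an isometry. *)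

(* Defs.v *)
From HB Require Import structures.
From mathcomp Require Import all_boot all_order all_algebra.
From mathcomp Require Import all_classical all_reals all_analysis.
From mathcomp Require Import complex.

Set Implicit Arguments.
Unset Strict Implicit.
Unset Printing Implicit Defensive.

Import Order.TTheory GRing.Theory Num.Theory.
Import numFieldNormedType.Exports.

Local Open Scope classical_set_scope.
Local Open Scope ring_scope.
Local Open Scope complex_scope.

(* The norm topology of C = R[i], which the library only provides on [R[i]^o]. *)
Set Warnings "-redundant-canonical-projection".
HB.instance Definition _ (R : realType) := NormedModule.copy R[i] R[i]^o.
Set Warnings "redundant-canonical-projection".

Section Operators.
Variable R : realType.

Definition bounded_op (U V : normedModType R[i]) (T : U -> V) : Prop :=
  exists M : R, forall u, `|T u| <= M%:C * `|u|.

(* A Hilbert space of complex functions on X.  A vector [f] stands for the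
   function [hfs_fun f]; since [hfs_fun] is linear and injective, the carrier is
   a linear space of functions on X.  The inner product is linear in its first
   argument and conjugate-linear in the second. *)
Record hilbert_function_space (X : Type) := HilbertFunctionSpace {
  hfs_sort :> completeNormedModType R[i];
  hfs_dot : {dot hfs_sort for (@Num.conj R[i])};
  hfs_dotE : forall f, hfs_dot f f = `|f| ^+ 2;
  hfs_fun : {linear hfs_sort -> (X -> R[i])};
  hfs_fun_inj : injective hfs_fun;
  hfs_eval_bounded : forall x, bounded_op (fun f => hfs_fun f x)
}.

Definition reproducing_kernel (X : Type) (H : hilbert_function_space X)
    (K : X -> X -> R[i]) : Prop :=
  forall w, exists k : H,
    (forall z, hfs_fun H k z = K z w) /\
    (forall f : H, hfs_fun H f w = hfs_dot H f k).

Section TwoSpaces.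
Variables (X1 X2 : Type).
Variables (H1 : hilbert_function_space X1) (H2 : hilbert_function_space X2).

Definition weighted_composition (lambda : X1 -> R[i]) (phi : X1 -> X2)
    (W : {linear H2 -> H1}) : Prop :=
  bounded_op W /\
  forall (f : H2) (x : X1), hfs_fun H1 (W f) x = lambda x * hfs_fun H2 f (phi x).

Definition is_adjoint (W : H2 -> H1) (T : H1 -> H2) : Prop :=
  forall f g, hfs_dot H1 (W f) g = hfs_dot H2 f (T g).

Definition unitary_op (W : H2 -> H1) : Prop :=
  exists T, [/\ is_adjoint W T, cancel W T & cancel T W].

Definition coisometric_op (W : H2 -> H1) : Prop :=
  exists T, is_adjoint W T /\ isometry (hfs_dot H2) (hfs_dot H1) T.

End TwoSpaces.
End Operators.

Section WeightedHardy.
Variables (R : realType) (d : nat).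

(* The power series sum_n a_n t^n is represented by its coefficients. *)
Definition conv_radius (a : nat -> R) : \bar R :=
  ereal_sup [set `|t|%:E | t in [set t : R | cvgn (pseries a t)]].

Definition generating_function (a : nat -> R) : Prop :=
  [/\ a 0%N = 1, forall n, 0 < a n & (0 < conv_radius a)%E].

Definition cdot (z w : 'rV[R[i]]_d) : R[i] :=
  \sum_(i < d) z 0 i * Num.conj (w 0 i).

(* The square of the Euclidean norm (the norm which the library puts on
   matrices is the sup norm). *)
Definition sqnorm (z : 'rV[R[i]]_d) : R := complex.Re (cdot z z).

(* The open and closed balls of radius r, as functions of rho = r^2. *)
Definition open_ball2 (rho : \bar R) : set 'rV[R[i]]_d :=
  [set z | ((sqnorm z)%:E < rho)%E].
Definition closed_ball2 (rho : \bar R) : set 'rV[R[i]]_d :=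
  [set z | ((sqnorm z)%:E <= rho)%E].

Definition natural_domain (a : nat -> R) : set 'rV[R[i]]_d :=
  let rho := conv_radius a in
  if rho == +oo%E then setT
  else if `[< cvgn (pseries a (fine rho)) >] then closed_ball2 rho
  else open_ball2 rho.

Definition mdegree (al : {ffun 'I_d -> nat}) : nat := (\sum_i al i)%N.
Definition mfactorial (al : {ffun 'I_d -> nat}) : nat := (\prod_i (al i)`!)%N.
Definition monomial (al : {ffun 'I_d -> nat}) (z : 'rV[R[i]]_d) : R[i] :=
  \prod_i z 0 i ^+ al i.

(* [f] is holomorphic on the open ball and continuous on X.  As [f] is only
   defined on X, this is said of an extension F of [f]; [differentiable] is
   Frechet differentiability over the field R[i]. *)
Definition holomorphic_on_ball (rho : \bar R) (X : set 'rV[R[i]]_d)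
    (f : X -> R[i]) : Prop :=
  exists F : 'rV[R[i]]_d -> R[i],
    [/\ forall x : X, F (val x) = f x,
        forall z, open_ball2 rho z -> differentiable F z
      & {within X, continuous F}].

(* [H] is the weighted Hardy space with generating function sum_n a_n t^n,
   regarded as a space of functions on its natural maximal domain. *)
Record weighted_hardy (a : nat -> R)
    (H : hilbert_function_space R (natural_domain a)) : Prop := WeightedHardy {
  wh_generating : generating_function a;
  wh_holomorphic : forall f : H,
    holomorphic_on_ball (conv_radius a) (hfs_fun H f);
  wh_monomials : exists e : {ffun 'I_d -> nat} -> H,
    [/\ forall al (z : natural_domain a),
          hfs_fun H (e al) z = monomial al (val z),
        forall al, e al <> 0,
        forall al be, al <> be -> hfs_dot H (e al) (e be) = 0,
        forall f : H, (forall al, hfs_dot H f (e al) = 0) -> f = 0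
      & (forall al be, mdegree al = mdegree be ->
          `|e al| ^+ 2 / (mfactorial al)%:R = `|e be| ^+ 2 / (mfactorial be)%:R)
        /\ `|e [ffun=> 0%N]| = 1];
  wh_kernel : exists2 K : natural_domain a -> natural_domain a -> R[i],
    reproducing_kernel H K
    & forall z w,
        series (fun n => (a n)%:C * cdot (val z) (val w) ^+ n ) @ \oo
          --> K z w
}.

End WeightedHardy.

Arguments natural_domain {R} d a.

(* Main.v *)
Require Import Defs.
From HB Require Import structures.
From mathcomp Require Import all_boot all_order all_algebra.
From mathcomp Require Import all_classical all_reals all_analysis.
From mathcomp Require Import complex ring lra.

Set Implicit Arguments.
Unset Strict Implicit.
Unset Printing Implicit Defensive.

Import Order.TTheory GRing.Theory Num.Theory.
Import numFieldNormedType.Exports.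
Import Normc.

Local Open Scope classical_set_scope.
Local Open Scope ring_scope.
Local Open Scope complex_scope.

Local Notation "z ^*" := (conjc z) : ring_scope.

(** Write [A], [B] for the power series with coefficients [a], [b], and [k1 z],
    [k2 z] for the kernel vectors of the two spaces.

    The adjoint of a weighted composition operator sends [k1 z] to a multiple of
    [k2 (phi z)], the factor being the conjugate of [lambda z]. If the adjoint is
    isometric, then comparing inner products of kernel vectors gives
      [A <z, w> = lambda z * (lambda w)^* * B <phi z, phi w>]
    ([kernel_identity]), and the existence of a dilation between [A] and [B] is
    read off from this identity near the origin. Put [p = phi 0].

    The point [p] does not have maximal norm among the values of [phi]: otherwise
    the nowhere vanishing function [lambda], which belongs to the first space,
    would have a strict local minimum of its modulus at the origin
    ([image_of_origin_not_maximal]). So [phi] maps a neighbourhood of the origin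
    into a ball on which [B <., .>] can be differentiated term by term, even if
    the natural domain of the second space is a closed ball.

    Differentiating in [w] at the origin shows that, with [h = B' / B] taken at
    [<phi z, p>], the vector [h(z) phi(z) - h(0) p] is the image of [z] under an
    invertible matrix ([linear_coordinates]).

    If [p = 0], then [h] and [lambda] are constant and [phi] is linear near the
    origin, so [A] is a dilation of [B] ([fixed_origin]).

    If [p] is nonzero, then [phi] maps a complex line through the origin into the
    line spanned by [p], and the identity becomes an identity in one variable,
    in which [s(t) = <phi(t e), p>] satisfies an affine equation
    [s B'(s) / B(s) = th0 + ka t]. The logarithmic derivative of the identity in
    [t], together with its Hermitian symmetry, gives
      [t m(s) - s (m t)^* = q (s t) (t - s)]
    for positive [s] and [t], where [m] is the quotient of [s(t)] by its
    derivative and [q] is a multiple of [A / A']. This forces [q] to be affine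
    and [m] to be quadratic ([functional_equation_affine]). The first fact is a
    differential equation for [A]; the second one is a differential equation for
    [B] at infinitely many points, hence everywhere ([infinite_zeros]). Both say
    that [G G'' = k G'^2], with the same [k] ([log_riccati_one_variable]), and a
    solution of this equation is determined up to dilation
    ([log_riccati_dilation]).

    Conversely, if [a n = b n * g ^ n], then [phi z = sqrt g z] carries one kernel
    to the other. The composition with such a map, and with its inverse, is a
    contraction ([composition_contraction]), so that it is unitary
    ([unitary_composition]). *)

(** * Complex power series *)

Section ComplexPowerSeries.
Variable R : realType.
Local Notation C := R[i].
Implicit Types (c d : nat -> C) (z w x y : C) (r : R).

Lemma normCE z : `|z| = (normc z)%:C.
Proof. by case: z. Qed.

Lemma normc_ge0 z : 0 <= normc z.
Proof. by rewrite -ler0c -normCE normr_ge0. Qed.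

Lemma normc_gt0 z : (0 < normc z) = (z != 0).
Proof. by rewrite -ltcR -normCE normr_gt0. Qed.

Lemma normcX z n : normc (z ^+ n) = normc z ^+ n.
Proof. by elim: n => [|n IH]; rewrite ?normc1 // !exprS normcM IH. Qed.

Lemma normc_real r : normc r%:C = `|r|.
Proof. by apply: (@complexI R); rewrite -normCE normc_def /= expr0n addr0 sqrtr_sqr. Qed.

Lemma real_neq0 r : 0 < r -> r%:C != 0 :> C.
Proof. by move=> r0; apply: contraTneq r0 => /complexI ->; rewrite ltxx. Qed.

Lemma normc_i : normc ('i : C) = 1.
Proof. by rewrite /normc expr0n add0r expr1n sqrtr1. Qed.

Lemma normc_conj z : normc z^* = normc z.
Proof. by apply: (@complexI R); rewrite -!normCE normcJ. Qed.

Lemma normcB z w : normc (z - w) = normc (w - z).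
Proof. by rewrite -normcN opprB. Qed.

Lemma cvg_normcP T (F : set_system T) {FF : Filter F} (u : T -> C) (l : C) :
  u @ F --> l <-> forall e, 0 < e -> \forall t \near F, normc (l - u t) < e.
Proof.
split=> [/cvgrPdist_lt ul e e0|ul].
  have := ul e%:C; rewrite (ltcR 0 e) => /(_ e0); apply: filterS => t.
  by rewrite normCE ltcR.
apply/cvgrPdist_lt => e e0.
have er : e = (complex.Re e)%:C by rewrite RRe_real // gtr0_real.
have := ul (complex.Re e); rewrite -ltcR -er => /(_ e0); rewrite er.
by apply: filterS => t; rewrite normCE ltcR.
Qed.

Lemma cvg_le_normc T (F : set_system T) {FF : Filter F} (u : T -> C) (l : C)
    (v : T -> R) : v @ F --> 0 ->
  (\forall t \near F, normc (l - u t) <= v t) -> u @ F --> l.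
Proof.
move=> v0 lev; apply/cvg_normcP => e e0.
move/cvgrPdist_lt: v0 => /(_ e e0); apply: filterS2 lev => t le1.
by rewrite sub0r normrN; apply: le_lt_trans; apply: le_trans le1 (ler_norm _).
Qed.

Lemma cvg_normc T (F : set_system T) {FF : Filter F} (u : T -> C) (l : C) :
  u @ F --> l -> normc (u t) @[t --> F] --> normc l.
Proof.
move=> /cvg_normcP ul; apply/cvgrPdist_lt => e /ul; apply: filterS => t.
exact: (le_lt_trans (@ler_dist_dist R (Rcomplex R) l (u t))).
Qed.

Lemma cvg_normc_le T (F : set_system T) {FF : ProperFilter F} (u : T -> C) (l : C)
  (K : R) : u @ F --> l -> (\forall t \near F, normc (u t) <= K) -> normc l <= K.
Proof.
move=> /cvg_normc ul uK; rewrite -(cvg_lim _ ul) //; apply: limr_le => //.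
by apply/cvg_ex; exists (normc l).
Qed.

Lemma cvg_Re T (F : set_system T) {FF : Filter F} (u : T -> C) (l : C) :
  u @ F --> l -> complex.Re (u t) @[t --> F] --> complex.Re l.
Proof.
move=> /cvg_normcP ul; apply/cvgrPdist_lt => e /ul; apply: filterS => t.
apply: le_lt_trans; rewrite -lecR -normCE.
have -> : complex.Re l - complex.Re (u t) = complex.Re (l - u t).
  by case: (l) => ? ?; case: (u t).
by apply: normc_ge_Re.
Qed.

Lemma cvg_conj T (F : set_system T) {FF : Filter F} (u : T -> C) (l : C) :
  u @ F --> l -> (u t)^* @[t --> F] --> l^*.
Proof.
move=> /cvg_normcP ul; apply/cvg_normcP => e /ul; apply: filterS => t.
by rewrite -rmorphB normc_conj.
Qed.

(** Cauchy's estimate on the circle of radius [r]. It implies that the radius of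
    convergence is at least [r], and it is visibly preserved by sums, shifts and
    division, with explicit bounds. *)
Definition coef_bounded c r := exists M : R, forall n, normc (c n) * r ^+ n <= M.

Definition PS c z : C := limn (series (fun n => c n * z ^+ n)).

Lemma normc_sum (u : nat -> C) n m :
  normc (\sum_(n <= i < m) u i) <= \sum_(n <= i < m) normc (u i).
Proof.
elim/big_ind2 : _ => [|x a y b xa yb|//]; first by rewrite normc0.
by apply: le_trans (le_normcD _ _) _; apply: lerD.
Qed.

Lemma geometric_tail (q : R) n m : 0 <= q -> q < 1 ->
  \sum_(n <= i < m) q ^+ i <= q ^+ n / (1 - q).
Proof.
move=> q0 q1; have q2 : 0 < 1 - q by rewrite subr_gt0.
have [mn|nm] := leqP m n.
  by rewrite big_geq // divr_ge0 ?exprn_ge0 // ltW.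
rewrite ler_pdivlMr // mulrC -(subnK (ltnW nm)) addnC.
elim: (m - n)%N => [|k IH].
  by rewrite addn0 big_geq // mulr0 exprn_ge0.
have -> : (1 - q) * (\sum_(n <= i < n + k.+1) q ^+ i) = q ^+ n - q ^+ (n + k.+1).
  elim: k.+1 => [|j IHj]; first by rewrite addn0 big_geq // mulr0 subrr.
  by rewrite addnS big_nat_recr ?leq_addr //= mulrDr IHj exprS; ring.
by rewrite lerBlDr lerDl exprn_ge0.
Qed.

Lemma series_dominated_cvg (u : nat -> C) (M q : R) : 0 <= q -> q < 1 ->
  (forall n, normc (u n) <= M * q ^+ n) ->
  cvgn (series u) /\ normc (limn (series u)) <= M / (1 - q).
Proof.
move=> q0 q1 uM.
have M0 : 0 <= M by move: (uM 0%N); rewrite expr0 mulr1; apply: le_trans (normc_ge0 _).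
have cR (f : C -> R) : (forall z, `|f z| <= normc z) -> cvgn (series (f \o u)).
  move=> hf; apply: normed_cvg.
  apply: (@series_le_cvg _ _ (geometric M q)).
  - by move=> n /=.
  - by move=> n; rewrite /geometric /= mulr_ge0 ?exprn_ge0.
  - by move=> n /=; apply: le_trans (hf _) (uM n).
  by apply: is_cvg_geometric_series; rewrite ger0_norm.
have cRe := cR (@complex.Re R); have cIm := cR (@complex.Im R).
have {}cRe : cvgn (series (@complex.Re R \o u)).
  by apply: cRe => z; rewrite -lecR -normCE normc_ge_Re.
have {}cIm : cvgn (series (@complex.Im R \o u)).
  apply: cIm => -[x y]; rewrite -sqrtr_sqr /= ler_sqrt ?lerDr ?sqr_ge0 //.
  by rewrite addr_ge0 ?sqr_ge0.
pose l := limn (series (@complex.Re R \o u)) +i* limn (series (@complex.Im R \o u)).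
have sE n : series u n = series (@complex.Re R \o u) n +i* series (@complex.Im R \o u) n.
  rewrite /series /=; elim/big_ind3 : _ => // [? ? ? ? ? ? -> ->|i _]; first by [].
  by case: (u i).
have ul : series u @ \oo --> l.
  apply: (@cvg_le_normc _ _ _ _ _ (fun n =>
    `|limn (series (@complex.Re R \o u)) - series (@complex.Re R \o u) n| +
    `|limn (series (@complex.Im R \o u)) - series (@complex.Im R \o u) n|)).
    have dist0 (v : nat -> R) : cvgn v -> `|limn v - v n| @[n --> \oo] --> 0.
      move=> cv; rewrite -(normr0 R) -(subrr (limn v)); apply: cvg_norm.
      by apply: cvgB => //; apply: cvg_cst.
    by rewrite -[X in _ --> X](addr0 (0 : R)); apply: cvgD; apply: dist0.
  near=> n; rewrite sE /l.
  set a := limn _; set b := limn _; set a' := series _ n; set b' := series _ n.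
  have -> : (a +i* b) - (a' +i* b') = (a - a')%:C + 'i%C * (b - b')%:C.
    by rewrite [LHS]complexE.
  apply: le_trans (le_normcD _ _) _; rewrite normcM !normc_real.
  by rewrite /normc /= expr0n expr1n add0r sqrtr1 mul1r.
split; first by apply/cvg_ex; exists l.
have -> : limn (series u) = l by apply: cvg_lim.
apply: (cvg_normc_le ul); near=> n; apply: le_trans (normc_sum _ _ _) _.
apply: le_trans (_ : \sum_(0 <= i < n) M * q ^+ i <= _); first exact: ler_sum.
rewrite -mulr_sumr ler_wpM2l //.
by have := geometric_tail 0 n q0 q1; rewrite expr0 mul1r.
Unshelve. all: by end_near. Qed.

Section Radius.
Variable r : R.
Hypothesis r0 : 0 < r.

Lemma PS_dominated c (M : R) z : (forall n, normc (c n) * r ^+ n <= M) ->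
  normc z < r ->
  series (fun n => c n * z ^+ n) @ \oo --> PS c z /\
  normc (PS c z) <= M / (1 - normc z / r).
Proof.
move=> cM zr.
have [|||cv] := @series_dominated_cvg (fun n => c n * z ^+ n) M (normc z / r).
- by rewrite divr_ge0 ?normc_ge0 ?ltW.
- by rewrite ltr_pdivrMr // mul1r.
- move=> n; rewrite normcM normcX expr_div_n mulrA ler_pdivlMr ?exprn_gt0 //.
  by rewrite mulrAC ler_wpM2r ?exprn_ge0 ?normc_ge0.
by [].
Qed.

Lemma PS_cvg c z : coef_bounded c r -> normc z < r ->
  series (fun n => c n * z ^+ n) @ \oo --> PS c z.
Proof. by move=> [M cM] zr; have [] := PS_dominated cM zr. Qed.

Lemma PS_eq c z l : series (fun n => c n * z ^+ n) @ \oo --> l -> PS c z = l.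
Proof. by move=> h; apply: cvg_lim. Qed.

Lemma coef_boundedD c d : coef_bounded c r -> coef_bounded d r ->
  coef_bounded (c \+ d) r.
Proof.
move=> [M cM] [N dN]; exists (M + N) => n /=.
apply: le_trans (_ : (normc (c n) + normc (d n)) * r ^+ n <= _).
  by rewrite ler_wpM2r ?exprn_ge0 ?(ltW r0) // le_normcD.
by rewrite mulrDl lerD.
Qed.

Lemma coef_boundedZ c k : coef_bounded c r -> coef_bounded (fun n => k * c n) r.
Proof.
move=> [M cM]; exists (normc k * M) => n /=.
by rewrite normcM -mulrA ler_wpM2l ?normc_ge0.
Qed.

Lemma coef_boundedS c : coef_bounded c r -> coef_bounded (fun n => c n.+1) r.
Proof.
move=> [M cM]; exists (M / r) => n.
by rewrite ler_pdivlMr // -mulrA -exprSr.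
Qed.

Lemma PSD c d z : coef_bounded c r -> coef_bounded d r -> normc z < r ->
  PS (c \+ d) z = PS c z + PS d z.
Proof.
move=> hc hd zr; apply: PS_eq.
rewrite (_ : series _ = series (fun n => c n * z ^+ n) \+ series (fun n => d n * z ^+ n)).
  by apply: cvgD; apply: PS_cvg.
apply/funext => n; rewrite /series /= -big_split /=.
by apply: eq_bigr => i _; rewrite mulrDl.
Qed.

Lemma PSZ c k z : coef_bounded c r -> normc z < r ->
  PS (fun n => k * c n) z = k * PS c z.
Proof.
move=> hc zr; apply: PS_eq.
rewrite (_ : series _ = (fun n => k * series (fun n => c n * z ^+ n) n)).
  by apply: cvgM; [apply: cvg_cst | apply: PS_cvg].
by apply/funext => n; rewrite /series /= mulr_sumr; apply: eq_bigr => i _; rewrite mulrA.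
Qed.

Lemma PS_recl c z : coef_bounded c r -> normc z < r ->
  PS c z = c 0%N + z * PS (fun n => c n.+1) z.
Proof.
move=> hc zr; apply: PS_eq; rewrite -cvg_shiftS /=.
rewrite (_ : (fun _ => _) = fun n => c 0%N + z * series (fun n => c n.+1 * z ^+ n) n).
  apply: cvgD; first exact: cvg_cst.
  by apply: cvgM; [apply: cvg_cst | apply: PS_cvg => //; apply: coef_boundedS].
apply/funext => n; rewrite /series /= big_nat_recl // expr0 mulr1 mulr_sumr.
by congr (_ + _); apply: eq_bigr => i _; rewrite exprS mulrCA.
Qed.

(** The coefficients of the power series [(PS c y - PS c x) / (y - x)] in [y], as
    given by synthetic division. *)
Definition quot_coef c x n : C := PS (fun k => c (n.+1 + k)%N) x.

Lemma coef_bounded_shift c m : coef_bounded c r -> coef_bounded (fun k => c (m + k)%N) r.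
Proof.
move=> hc; elim: m => [//|m IH].
rewrite (_ : (fun _ => _) = fun k => c (m + k.+1)%N); first exact: coef_boundedS IH.
by apply/funext => k; rewrite addSnnS.
Qed.

Lemma quot_coef_rec c x n : coef_bounded c r -> normc x < r ->
  c n.+1 = quot_coef c x n - x * quot_coef c x n.+1.
Proof.
move=> hc xr; rewrite /quot_coef PS_recl //; last exact: coef_bounded_shift.
rewrite addn0 (_ : (fun k => c (n.+1 + k.+1)%N) = fun k => c (n.+2 + k)%N) ?addrK //.
by apply/funext => k; rewrite addnS.
Qed.

Lemma quot_coef_bounded c x : coef_bounded c r -> normc x < r ->
  coef_bounded (quot_coef c x) r.
Proof.
move=> [M cM] xr; exists (M / r / (1 - normc x / r)) => n.
have rn : 0 < r ^+ n by rewrite exprn_gt0.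
rewrite -ler_pdivlMr //.
have [|_] := @PS_dominated (fun k => c (n.+1 + k)%N) (M / r ^+ n.+1) x _ xr.
  move=> k; rewrite ler_pdivlMr ?exprn_gt0 // -mulrA -exprD addnC; exact: cM.
move=> h; apply: le_trans h _; rewrite le_eqVlt; apply/orP; left; apply/eqP.
rewrite exprS invfM; ring.
Qed.

(** Division by [y - x] stays within power series; continuity, derivatives and
    the removal of zeros all come from this identity. *)
Lemma PS_quot c x y : coef_bounded c r -> normc x < r -> normc y < r ->
  PS c y = PS c x + (y - x) * PS (quot_coef c x) y.
Proof.
move=> hc xr yr; have hg := quot_coef_bounded hc xr; have hgS := coef_boundedS hg.
rewrite (PS_recl hc yr) (PS_recl hc xr).
rewrite (_ : PS (fun n => c n.+1) x = quot_coef c x 0) //.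
have -> : PS (fun n => c n.+1) y =
    PS (quot_coef c x) y - x * PS (fun n => quot_coef c x n.+1) y.
  rewrite -mulNr -PSZ // -PSD //; last exact: coef_boundedZ.
  by congr PS; apply/funext => n /=; rewrite mulNr -quot_coef_rec.
have := PS_recl hg yr; move: (PS _ y) => A; move: (PS _ y) => B.
by move: (quot_coef _ _ _) => D ->; ring.
Qed.

Lemma PS_lipschitz c x : coef_bounded c r -> normc x < r ->
  exists K : R, \forall y \near x, normc (PS c x - PS c y) <= K * normc (x - y).
Proof.
move=> hc xr; have [M hM] := quot_coef_bounded hc xr.
pose s := (normc x + r) / 2.
have xs : normc x < s by rewrite /s; lra.
have sr : s < r by rewrite /s; lra.
exists (M / (1 - s / r)).
have cid : (fun y : C => y) @ x --> x by apply: cvg_id.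
move/cvg_normcP: cid => /(_ (s - normc x)); rewrite subr_gt0 => /(_ xs).
apply: filterS => y hy.
have ys : normc y < s.
  rewrite -(subrK x y); apply: le_lt_trans (le_normcD _ _) _.
  by rewrite normcB -ltrBrDr.
have yr := lt_trans ys sr.
rewrite (PS_quot hc xr yr) opprD addNKr normcN normcM mulrC normcB.
apply: ler_wpM2r; first exact: normc_ge0.
have [_ h] := PS_dominated hM yr.
apply: le_trans h _; apply: ler_wpM2l.
  by apply: le_trans (hM 0%N); rewrite expr0 mulr1 normc_ge0.
have s1 : s / r < 1 by rewrite ltr_pdivrMr // mul1r.
have y1 : normc y / r <= s / r by rewrite ler_pM2r ?invr_gt0 // ltW.
by rewrite lef_pV2 ?posrE; lra.
Qed.

Lemma PS_continuous c x : coef_bounded c r -> normc x < r ->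
  PS c y @[y --> x] --> PS c x.
Proof.
move=> hc xr; have [K hK] := PS_lipschitz hc xr.
apply: (@cvg_le_normc _ (nbhs x) _ _ _ (fun y => K * normc (x - y))) => //.
rewrite -[X in _ --> X](mulr0 K); apply: cvgM; first exact: cvg_cst.
rewrite -(normc0 R) -(subrr x); apply: cvg_normc.
by apply: cvgB; [apply: cvg_cst | apply: cvg_id].
Qed.

End Radius.
End ComplexPowerSeries.

(** * Derivatives and products of power series *)

Section Analytic.
Variable R : realType.
Local Notation C := R[i].
Implicit Types (c d : nat -> C) (z w x y : C) (r s q : R).

Lemma arith_geom_le q n : 0 <= q -> q < 1 -> n.+1%:R * q ^+ n <= 1 / (1 - q).
Proof.
move=> q0 q1; have := geometric_tail 0 n.+1 q0 q1; rewrite expr0.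
apply: le_trans; rewrite mulr_natl big_mkord -[leLHS](_ : \sum_(i < n.+1) q ^+ n = _).
  by apply: ler_sum => i _; apply: ler_wiXn2l => //; [apply: ltW | rewrite -ltnS].
by rewrite sumr_const card_ord.
Qed.

Lemma cvg_arith_geom q : 0 <= q -> q < 1 -> n%:R * q ^+ n @[n --> \oo] --> (0 : R).
Proof.
move=> q0 q1; pose p := (1 + q) / 2.
have p0 : 0 < p by rewrite /p; lra.
have p1 : p < 1 by rewrite /p; lra.
have qp : q / p < 1 by rewrite ltr_pdivrMr // mul1r /p; lra.
have q'0 : 0 <= q / p by rewrite divr_ge0 // ltW.
apply: (@squeeze_cvgr _ _ _ _ (fun=> 0) (fun n => 1 / (1 - q / p) * p ^+ n)).
- apply: nearW => n; rewrite mulr_ge0 ?exprn_ge0 //=.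
  have -> : q ^+ n = (q / p) ^+ n * p ^+ n by rewrite -exprMn divfK // gt_eqF.
  rewrite mulrA ler_wpM2r ?exprn_ge0 ?(ltW p0) //.
  apply: le_trans (arith_geom_le n q'0 qp).
  by rewrite ler_wpM2r ?exprn_ge0 // ler_nat.
- exact: cvg_cst.
- rewrite -[X in _ --> X](mulr0 (1 / (1 - q / p))); apply: cvgM; first exact: cvg_cst.
  by apply: cvg_expr; rewrite gtr0_norm.
Qed.

(** Contrary to [coef_bounded], this is stable under derivation and products for a
    fixed [r]. *)
Definition has_radius c r := forall s, 0 < s -> s < r -> coef_bounded c s.

Definition deriv_coef c n : C := n.+1%:R * c n.+1.
Definition conv_coef c d n : C := \sum_(i < n.+1) c i * d (n - i)%N.
Definition shift_coef c n : C := if n is m.+1 then c m else 0.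

Lemma between z r : normc z < r -> exists2 s, 0 < s & normc z < s /\ s < r.
Proof.
move=> zr; exists ((normc z + r) / 2); have := normc_ge0 z; first by lra.
by split; lra.
Qed.

Lemma has_radius_le c s r : has_radius c r -> s <= r -> has_radius c s.
Proof. by move=> h sr t t0 ts; apply: h => //; apply: lt_le_trans ts sr. Qed.

Lemma has_radius_deriv c r : has_radius c r -> has_radius (deriv_coef c) r.
Proof.
move=> hc s s0 sr; pose t := (s + r) / 2.
have st : s < t by rewrite /t; lra.
have t0 : 0 < t by lra.
have [|M cM] := hc t t0; first by rewrite /t; lra.
have q1 : s / t < 1 by rewrite ltr_pdivrMr // mul1r.
exists (M / t * (1 / (1 - s / t))) => n.
have -> : normc (deriv_coef c n) * s ^+ n =
  (normc (c n.+1) * t ^+ n) * (n.+1%:R * (s / t) ^+ n).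
  rewrite /deriv_coef normcM (expr_div_n s t) -[n.+1%:R](rmorph_nat (real_complex R)) normc_real.
  rewrite ger0_norm //; have : t ^+ n != 0 by rewrite expf_neq0 // gt_eqF.
  by move: (normc _) (s ^+ n) (t ^+ n) (n.+1%:R : R) => A B D E D0; field.
apply: ler_pM.
- by rewrite mulr_ge0 ?normc_ge0 ?exprn_ge0 ?(ltW t0).
- by apply: mulr_ge0; [rewrite ler0n | apply: exprn_ge0; apply: divr_ge0; apply: ltW].
- by rewrite ler_pdivlMr // -mulrA -exprSr.
- by apply: arith_geom_le q1; apply: divr_ge0; apply: ltW.
Qed.

Lemma PS_split r c z n : 0 < r -> coef_bounded c r -> normc z < r ->
  PS c z = \sum_(0 <= i < n) c i * z ^+ i + z ^+ n * PS (fun k => c (n + k)%N) z.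
Proof.
move=> r0 hc zr; elim: n => [|n IH]; first by rewrite big_geq // add0r expr0 mul1r.
rewrite IH (PS_recl r0) //; last exact: coef_bounded_shift.
rewrite big_nat_recr //= addn0 exprS.
rewrite (_ : (fun k => c (n + k.+1)%N) = fun k => c (n.+1 + k)%N); first by ring.
by apply/funext => k; rewrite addSnnS.
Qed.

Lemma PS_tail r c (M : R) z n : 0 < r -> (forall n, normc (c n) * r ^+ n <= M) ->
  normc z < r ->
  normc (PS c z - \sum_(0 <= i < n) c i * z ^+ i)
    <= M / (1 - normc z / r) * (normc z / r) ^+ n.
Proof.
move=> r0 cM zr; rewrite (@PS_split r c z n) //; last by exists M.
rewrite addrAC subrr add0r normcM normcX.
have [|_ h] := @PS_dominated _ r r0 (fun k => c (n + k)%N) (M / r ^+ n) z _ zr.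
  move=> k; rewrite ler_pdivlMr ?exprn_gt0 // -mulrA -exprD addnC; exact: cM.
apply: le_trans (_ : normc z ^+ n * (M / r ^+ n / (1 - normc z / r)) <= _).
  by rewrite ler_wpM2l ?exprn_ge0 ?normc_ge0.
rewrite le_eqVlt; apply/orP; left; apply/eqP; rewrite expr_div_n; ring.
Qed.

(** Summation by parts: with [g = quot_coef c x], the partial sums of
    [g i * x ^+ i] and of the derived series differ by [n * g n * x ^+ n], which
    tends to zero. *)
Lemma PS_quot_deriv r c x : 0 < r -> has_radius c r -> normc x < r ->
  forall s, 0 < s -> normc x < s -> s < r ->
  PS (quot_coef c x) x = PS (deriv_coef c) x.
Proof.
move=> r0 hc xr s s0 xs sr; have hs := hc s s0 sr.
have hg := quot_coef_bounded s0 hs xs.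
have [t _ [xt ts]] := between xs.
have hd := has_radius_deriv hc s0 sr.
apply: PS_eq.
pose g := quot_coef c x.
have E n : \sum_(0 <= i < n) g i * x ^+ i =
    n%:R * (g n * x ^+ n) + \sum_(0 <= i < n) deriv_coef c i * x ^+ i.
  elim: n => [|n IH]; first by rewrite !big_geq // mul0r addr0.
  rewrite !big_nat_recr //= IH.
  rewrite /deriv_coef (quot_coef_rec s0 n hs xs) -/g exprS -natr1; ring.
rewrite (_ : series _ = fun n => n%:R * (g n * x ^+ n) +
    series (fun i => deriv_coef c i * x ^+ i) n); last by apply/funext => n; exact: E.
rewrite -[X in _ --> X]add0r; apply: cvgD; last exact: (PS_cvg s0).
have [M hM] := hg.
apply: (@cvg_le_normc _ _ _ _ _ _ (fun n => M * (n%:R * (normc x / s) ^+ n))).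
  rewrite -[X in _ --> X](mulr0 M); apply: cvgM; first exact: cvg_cst.
  by apply: cvg_arith_geom; rewrite ?divr_ge0 ?normc_ge0 ?(ltW s0) // ltr_pdivrMr // mul1r.
apply: nearW => n; rewrite sub0r normcN !normcM normcX.
rewrite -[n%:R](rmorph_nat (real_complex R)) normc_real ger0_norm //.
rewrite [leRHS]mulrCA ler_wpM2l // expr_div_n mulrA.
by rewrite ler_pdivlMr ?exprn_gt0 // mulrAC ler_wpM2r ?exprn_ge0 ?normc_ge0.
Qed.

Lemma is_derive_PS r c x : has_radius c r -> normc x < r ->
  is_derive x (1 : C) (PS c) (PS (deriv_coef c) x).
Proof.
move=> hc xr; have [s s0 [xs sr]] := between xr.
have r0 : 0 < r := lt_trans s0 sr.
have hs := hc s s0 sr.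
have hg := quot_coef_bounded s0 hs xs.
have D : (fun h : C => h^-1 *: (PS c (h *: (1 : C) + x) - PS c x)) @ 0^' --> PS (deriv_coef c) x.
  rewrite -(PS_quot_deriv r0 hc xr s0 xs sr).
  have c1 : PS (quot_coef c x) (h + x) @[h --> (0 : C)^'] --> PS (quot_coef c x) x.
    have sx : (fun h : C => h + x) @ (0 : C)^' --> x.
      rewrite -[X in _ --> X](add0r x); apply: cvgD; last exact: cvg_cst.
      exact: cvg_within.
    exact: (cvg_comp _ _ sx (PS_continuous s0 hg xs)).
  apply: cvg_trans c1; apply: near_eq_cvg.
  have n0 : \forall h \near (0 : C)^', h != 0 by apply: nbhs_dnbhs_neq.
  have ns : \forall h \near (0 : C)^', normc (h + x) < s.
    have : (h + x) @[h --> (0 : C)^'] --> x.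
      rewrite -[X in _ --> X](add0r x); apply: cvgD; last exact: cvg_cst.
      exact: cvg_within.
    move=> /cvg_normcP /(_ (s - normc x)); rewrite subr_gt0 => /(_ xs).
    apply: filterS => h hh; rewrite -(subrK x (h + x)).
    by apply: le_lt_trans (le_normcD _ _) _; rewrite normcB -ltrBrDr.
  apply: filterS2 n0 ns => h h0 hs'.
  rewrite [h *: 1]mulr1 (PS_quot s0 hs xs hs') addrAC subrr add0r addrK.
  by rewrite [RHS]mulrA mulVf // mul1r.
split; first by apply/cvg_ex; eexists; exact: D.
by rewrite /derive; apply: cvg_lim.
Qed.

Lemma has_radiusD c d r : has_radius c r -> has_radius d r -> has_radius (c \+ d) r.
Proof. by move=> hc hd s s0 sr; apply: coef_boundedD => //; [exact: hc | exact: hd]. Qed.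

Lemma has_radiusZ c k r : has_radius c r -> has_radius (fun n => k * c n) r.
Proof. by move=> hc s s0 sr; apply: coef_boundedZ => //; exact: hc. Qed.

Lemma has_radius_shift c r : has_radius c r -> has_radius (shift_coef c) r.
Proof.
move=> hc s s0 sr; have [M cM] := hc s s0 sr; exists (M * s) => -[|n]; rewrite /shift_coef.
  rewrite normc0 mul0r mulr_ge0 ?(ltW s0) //.
  by apply: le_trans (cM 0%N); rewrite expr0 mulr1 normc_ge0.
by rewrite exprSr mulrA ler_wpM2r // ltW.
Qed.

Lemma PS_shift c r z : has_radius c r -> normc z < r ->
  PS (shift_coef c) z = z * PS c z.
Proof.
move=> hc zr; have [s s0 [zs sr]] := between zr.
by rewrite (PS_recl s0) ?add0r //; apply: has_radius_shift s0 sr.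
Qed.

Lemma coef_bounded_conv c d s r : 0 < s -> s < r ->
  coef_bounded c r -> coef_bounded d r -> coef_bounded (conv_coef c d) s.
Proof.
move=> s0 sr [M cM] [N dN]; have r0 : 0 < r := lt_trans s0 sr.
have q1 : s / r < 1 by rewrite ltr_pdivrMr // mul1r.
exists (M * N * (1 / (1 - s / r))) => n.
have M0 : 0 <= M by apply: le_trans (cM 0%N); rewrite expr0 mulr1 normc_ge0.
have N0 : 0 <= N by apply: le_trans (dN 0%N); rewrite expr0 mulr1 normc_ge0.
have -> : s ^+ n = r ^+ n * (s / r) ^+ n.
  by rewrite expr_div_n mulrC divfK // expf_neq0 // gt_eqF.
rewrite mulrA; apply: le_trans (_ : (M * N * n.+1%:R) * (s / r) ^+ n <= _).
  apply: ler_wpM2r; first by apply: exprn_ge0; apply: divr_ge0; apply: ltW.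
  apply: le_trans (_ : \sum_(0 <= i < n.+1) normc (c i * d (n - i)%N) * r ^+ n <= _).
    rewrite -mulr_suml ler_wpM2r ?exprn_ge0 ?(ltW r0) //.
    rewrite /conv_coef -(big_mkord xpredT (fun i => c i * d (n - i)%N)).
    exact: normc_sum.
  apply: le_trans (_ : \sum_(0 <= i < n.+1) M * N <= _); last first.
    by rewrite sumr_const_nat subn0 mulr_natr.
  rewrite !big_mkord; apply: ler_sum => i _.
  rewrite -[X in r ^+ X](subnKC (ltn_ord i : (i <= n)%N)) exprD normcM mulrACA.
  by apply: ler_pM => //; rewrite mulr_ge0 ?normc_ge0 ?exprn_ge0 ?(ltW r0).
rewrite -mulrA ler_wpM2l ?mulr_ge0 //.
by apply: arith_geom_le => //; apply: divr_ge0; apply: ltW.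
Qed.

Lemma has_radius_conv c d r : has_radius c r -> has_radius d r ->
  has_radius (conv_coef c d) r.
Proof.
move=> hc hd s s0 sr; have st : s < (s + r) / 2 by lra.
by apply: (coef_bounded_conv s0 st); [apply: hc | apply: hd]; lra.
Qed.

(** The partial sums of the Cauchy product differ from [PS c z] times those of [d]
    by a sum of tails of [c]; both factors decay geometrically, so that the sum
    is of order [n * q ^+ n] with [q < 1]. *)
Lemma PS_conv c d r z : has_radius c r -> has_radius d r -> normc z < r ->
  PS (conv_coef c d) z = PS c z * PS d z.
Proof.
move=> hc hd zr; have [s s0 [zs sr]] := between zr.
have [M cM] := hc s s0 sr; have [N dN] := hd s s0 sr.
pose q := normc z / s.
have q0 : 0 <= q by rewrite divr_ge0 ?normc_ge0 ?(ltW s0).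
have q1 : q < 1 by rewrite ltr_pdivrMr // mul1r.
have M0 : 0 <= M by apply: le_trans (cM 0%N); rewrite expr0 mulr1 normc_ge0.
have N0 : 0 <= N by apply: le_trans (dN 0%N); rewrite expr0 mulr1 normc_ge0.
pose F k := \sum_(0 <= i < k) c i * z ^+ i.
have E n : \sum_(0 <= i < n) conv_coef c d i * z ^+ i =
    \sum_(0 <= j < n) d j * z ^+ j * F (n - j)%N.
  elim: n => [|n IH]; first by rewrite !big_geq.
  rewrite big_nat_recr //= IH.
  rewrite [RHS]big_nat_recr //= subSn // subnn.
  have -> : \sum_(0 <= j < n) d j * z ^+ j * F (n.+1 - j)%N =
    \sum_(0 <= j < n) d j * z ^+ j * F (n - j)%N +
    \sum_(0 <= j < n) d j * c (n - j)%N * z ^+ n.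
    rewrite -big_split /=; apply: eq_big_nat => j /andP[_ jn].
    rewrite subSn ?(ltnW jn) // /F big_nat_recr //=.
    rewrite -[X in _ = _ + _ * _ * z ^+ X](subnKC (ltnW jn)) exprD; ring.
  rewrite -addrA; congr (_ + _).
  rewrite /F big_nat1 expr0 mulr1 /conv_coef.
  rewrite -(big_mkord xpredT (fun i => c i * d (n - i)%N)) big_nat_rev /= add0n.
  rewrite big_nat_recr //= subSS subnn subn0 mulrDl -mulr_suml; congr (_ + _); last by ring.
  congr (_ * _); apply: eq_big_nat => i /andP[_ ni].
  by rewrite subSS (subKn (ltnW ni)) mulrC.
apply: PS_eq.
have -> : series (fun n => conv_coef c d n * z ^+ n) =
  (fun n => PS c z * series (fun n => d n * z ^+ n) n -
     \sum_(0 <= j < n) d j * z ^+ j * (PS c z - F (n - j)%N)).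
  apply/funext => n; rewrite /series /= E mulr_sumr -sumrB.
  by apply: eq_bigr => j _; ring.
rewrite -[X in _ --> X]subr0; apply: cvgB.
  by apply: cvgM; [apply: cvg_cst | apply: (PS_cvg s0) => //; exists N].
pose K := N * (M / (1 - q)).
apply: (@cvg_le_normc _ _ _ _ _ _ (fun n => K * (n%:R * q ^+ n))).
  rewrite -[X in _ --> X](mulr0 K); apply: cvgM; first exact: cvg_cst.
  exact: cvg_arith_geom.
apply: nearW => n; rewrite sub0r normcN.
apply: le_trans (normc_sum _ _ _) _.
apply: le_trans (_ : \sum_(0 <= j < n) K * q ^+ n <= _); last first.
  by rewrite sumr_const_nat subn0 -[leLHS]mulr_natr -mulrA [q ^+ n * _]mulrC lexx.
rewrite !big_mkord; apply: ler_sum => j _; rewrite normcM.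
rewrite -[X in q ^+ X](subnKC (ltnW (ltn_ord j))) exprD /K.
rewrite [leRHS]mulrACA.
apply: ler_pM; rewrite ?normc_ge0 //.
  rewrite normcM normcX /q expr_div_n mulrA ler_pdivlMr ?exprn_gt0 //.
  by rewrite mulrAC ler_wpM2r ?exprn_ge0 ?normc_ge0.
exact: PS_tail.
Qed.

Lemma PS0 r c : 0 < r -> coef_bounded c r -> PS c 0 = c 0%N.
Proof. by move=> r0 hc; rewrite (PS_recl r0) ?normc0 // mul0r addr0. Qed.

Lemma PS0_radius r c : 0 < r -> has_radius c r -> PS c 0 = c 0%N.
Proof.
move=> r0 hc; have r2 : 0 < r / 2 by lra.
by apply: (PS0 r2); apply: hc => //; lra.
Qed.

Lemma PS_zeros_const r c : 0 < r -> coef_bounded c r ->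
  (forall e, 0 < e -> exists2 z, z != 0 & normc z < e /\ PS c z = 0) ->
  c 0%N = 0.
Proof.
move=> r0 hc hz; apply: contrapT => /eqP c0.
have cont : PS c y @[y --> (0 : C)] --> PS c 0.
  by apply: (PS_continuous r0) => //; rewrite normc0.
have /cvg_normcP/(_ (normc (c 0%N))) := cont; rewrite normc_gt0 => /(_ c0).
move=> /nbhs_ballP[e /= e0 he].
have e0' : 0 < complex.Re e by rewrite -(ltcR 0) RRe_real // gtr0_real.
have [z z0 [ze zc]] := hz _ e0'.
have := he z; rewrite /ball /= sub0r normrN normCE -(RRe_real (gtr0_real e0)) ltcR.
by move=> /(_ ze); rewrite zc subr0 (PS0 r0) // ltxx.
Qed.

(** A power series whose zeros accumulate at the origin is trivial: the constant
    term is a limit of values, and the other terms follow after division by [z]. *)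
Lemma PS_zeros_at_origin r c : 0 < r -> coef_bounded c r ->
  (forall e, 0 < e -> exists2 z, z != 0 & normc z < e /\ PS c z = 0) ->
  forall n, c n = 0.
Proof.
move=> r0 hc hz n; elim: n c hc hz => [|n IH] c hc hz; first exact: (PS_zeros_const r0 hc).
apply: (IH (fun n => c n.+1)); first exact: coef_boundedS.
move=> e e0; have m0 : 0 < Num.min e r by rewrite lt_min e0.
have [z z0 [ze zc]] := hz _ m0; move: ze; rewrite lt_min => /andP[ze zr].
exists z => //; split => //.
have c0 : c 0%N = 0 := PS_zeros_const r0 hc hz.
move: zc; rewrite (PS_recl r0 hc zr) c0 add0r => /eqP; rewrite mulf_eq0 (negPf z0).
by move=> /eqP.
Qed.
End Analytic.

(** * The identity theorem *)

Section IdentityTheorem.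
Variable R : realType.
Local Notation C := R[i].
Implicit Types (c d g : nat -> C) (z w x y : C) (r s q : R).

Lemma normc_sqr z : normc z ^+ 2 = complex.Re z ^+ 2 + complex.Im z ^+ 2.
Proof. by case: z => a b; rewrite sqr_sqrtr // addr_ge0 ?sqr_ge0. Qed.

Lemma ler_sqr_nneg r s : 0 <= r -> r <= s -> r ^+ 2 <= s ^+ 2.
Proof. by move=> r0 rs; rewrite lerXn2r ?nnegrE // (le_trans r0). Qed.

Lemma ler_of_sqr r s : 0 <= s -> r ^+ 2 <= s ^+ 2 -> r <= s.
Proof. by move=> s0 h; rewrite leNgt; apply/negP => sr; nra. Qed.

Lemma coef_bounded_le c s r : 0 < s -> s <= r -> coef_bounded c r -> coef_bounded c s.
Proof.
move=> s0 sr [M cM]; exists M => n; apply: le_trans (cM n).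
by rewrite ler_wpM2l ?normc_ge0 // lerXn2r ?nnegrE ?(ltW s0) ?(le_trans (ltW s0) sr).
Qed.

Lemma has_radius_quot c r x : has_radius c r -> normc x < r ->
  has_radius (quot_coef c x) r.
Proof.
move=> hc xr s s0 sr; have [t t0 [xt tr]] := between xr.
have m0 : 0 < Num.max s t by rewrite lt_max s0.
apply: (coef_bounded_le s0 (_ : s <= Num.max s t)); first by rewrite le_max lexx.
by apply: quot_coef_bounded => //; rewrite ?lt_max ?xt ?orbT //; apply: hc; rewrite // gt_max sr.
Qed.

Lemma PS_quot_radius c r x y : has_radius c r -> normc x < r -> normc y < r ->
  PS c y = PS c x + (y - x) * PS (quot_coef c x) y.
Proof.
move=> hc xr yr; have [t t0 [xt tr]] := between xr; have [s s0 [ys sr]] := between yr.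
have m0 : 0 < Num.max s t by rewrite lt_max s0.
apply: (PS_quot m0); rewrite ?lt_max ?xt ?ys ?orbT //.
by apply: hc; rewrite // gt_max sr.
Qed.

Lemma coef_recS c r x n : has_radius c r -> normc x < r ->
  c n.+1 = quot_coef c x n - x * quot_coef c x n.+1.
Proof.
move=> hc xr; have [t t0 [xt tr]] := between xr.
exact: (quot_coef_rec t0 n (hc t t0 tr) xt).
Qed.

Lemma PS_recl_radius c r z : has_radius c r -> normc z < r ->
  PS c z = c 0%N + z * PS (fun n => c n.+1) z.
Proof.
by move=> hc zr; have [t t0 [zt tr]] := between zr; apply: (PS_recl t0) => //; apply: hc.
Qed.

(** Multiplying by [(1 - x^* y) / (y - x)], which has modulus one on the unit
    circle, removes the zero [x] without increasing the Hardy space norm. On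
    partial sums of squared coefficients the invariance of the norm holds up to
    one explicit term, the last one in the equation [E] of the proof. *)
Lemma blaschke_division c r x : 1 < r -> has_radius c r -> normc x < 1 -> PS c x = 0 ->
  exists d, [/\ has_radius d r,
    forall M, (forall n, \sum_(0 <= i < n) normc (c i) ^+ 2 <= M) ->
       forall n, \sum_(0 <= i < n) normc (d i) ^+ 2 <= M,
    normc (c 0%N) = normc x * normc (d 0%N) &
    forall y, normc y < r -> y != x -> PS c y = 0 -> PS d y = 0].
Proof.
move=> r1 hc x1 cx; have xr := lt_trans x1 r1.
pose g := quot_coef c x; have hg : has_radius g r := has_radius_quot hc xr.
have hsg := has_radius_shift hg.
exists (g \+ (fun n => - x^* * shift_coef g n)); split.
- by apply: has_radiusD => //; apply: has_radiusZ.
- move=> M hM n.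
  have E k : \sum_(0 <= i < k.+1) normc (g i + - x^* * shift_coef g i) ^+ 2 =
     \sum_(0 <= i < k.+1) normc (c i) ^+ 2 + (1 - normc x ^+ 2) * normc (g k) ^+ 2.
    elim: k => [|k IH].
      rewrite !big_nat1 /= mulr0 addr0.
      have -> : c 0%N = - (x * g 0%N).
        by move: cx; rewrite (PS_recl_radius hc xr) => /eqP; rewrite addr_eq0 => /eqP.
      by rewrite normcN normcM; ring.
    rewrite big_nat_recr //= IH [in RHS]big_nat_recr //= (coef_recS k hc xr) -/g.
    rewrite !normc_sqr; case: (x) => x1' x2; case: (g k) => a1 a2; case: (g k.+1) => b1 b2 /=.
    ring.
  have [t t1 tr] : exists2 t : R, 1 < t & t < r by exists ((1 + r) / 2); lra.
  have t0 : 0 < t by lra.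
  have [B gB] := hg t t0 tr.
  have B0 : 0 <= B by apply: le_trans (gB 0%N); rewrite expr0 mulr1 normc_ge0.
  have lim : (fun k => M + B ^+ 2 * (t ^- 2) ^+ k) @ \oo --> M.
    rewrite -[X in _ --> X]addr0 -[X in _ + X](mulr0 (B ^+ 2)).
    apply: cvgD; first exact: cvg_cst.
    apply: cvgM; first exact: cvg_cst.
    apply: cvg_expr; rewrite gtr0_norm ?invr_gt0 ?exprn_gt0 //.
    by rewrite invf_lt1 ?exprn_gt0 // expr_gt1 // ltW.
  rewrite -(cvg_lim _ lim) //; apply: limr_ge; first by apply/cvg_ex; exists M.
  near=> k.
  apply: le_trans
    (_ : \sum_(0 <= i < k.+1) normc (g i + - x^* * shift_coef g i) ^+ 2 <= _).
    rewrite [leRHS](@big_cat_nat _ _ _ n) //=; last by apply: leqW; near: k; exists n.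
    by rewrite lerDl sumr_ge0 // => i _; rewrite sqr_ge0.
  rewrite E lerD //.
  apply: le_trans (_ : normc (g k) ^+ 2 <= _).
    by rewrite ler_piMl ?sqr_ge0 // lerBlDr lerDl sqr_ge0.
  have -> : B ^+ 2 * (t ^- 2) ^+ k = (B / t ^+ k) ^+ 2.
    by rewrite expr_div_n -!exprVn -!exprM mulnC.
  apply: ler_sqr_nneg; first exact: normc_ge0.
  by rewrite ler_pdivlMr ?exprn_gt0.
- rewrite /= mulr0 addr0.
  have -> : c 0%N = - (x * g 0%N).
    by move: cx; rewrite (PS_recl_radius hc xr) => /eqP; rewrite addr_eq0 => /eqP.
  by rewrite normcN normcM.
- move=> y yr yx cy; have [s s0 [ys sr]] := between yr.
  rewrite (PSD s0) //; [|exact: hg|by apply: coef_boundedZ; apply: hsg].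
  rewrite (PSZ s0) //; [|exact: hsg]; rewrite (PS_shift hg yr).
  have := PS_quot_radius hc xr yr; rewrite cx cy add0r -/g => /esym/eqP.
  by rewrite mulf_eq0 subr_eq0 (negPf yx) => /eqP ->; rewrite !mulr0 addr0.
Unshelve. all: by end_near. Qed.

(** Removing a zero [x] divides the constant term by [normc x], which is at most
    [e], while the norm, which bounds the constant term that remains, does not
    grow. *)
Lemma blaschke_zeros (xs : seq C) c r e (M : R) : 1 < r -> has_radius c r ->
  e < 1 -> (forall n, \sum_(0 <= i < n) normc (c i) ^+ 2 <= M) -> uniq xs ->
  (forall x, x \in xs -> normc x <= e /\ PS c x = 0) ->
  normc (c 0%N) ^+ 2 <= (e ^+ 2) ^+ size xs * M.
Proof.
move=> r1 hc e1; elim: xs c hc => [|x xs IH] c hc cM /=.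
  by move=> _ _; rewrite expr0 mul1r; have := cM 1%N; rewrite big_nat1.
move=> /andP[xxs uxs] hx.
have [xe cx] := hx x (mem_head _ _); have x1 := le_lt_trans xe e1.
have [d [hd dM -> dy]] := blaschke_division r1 hc x1 cx.
have h := IH d hd (dM M cM) uxs; rewrite exprMn [(e ^+ 2) ^+ _]exprS -mulrA.
have e0 : 0 <= e := le_trans (normc_ge0 _) xe.
apply: ler_pM; rewrite ?sqr_ge0 //.
  exact: ler_sqr_nneg (normc_ge0 _) xe.
apply: h => y yxs; have [ye cy] : normc y <= e /\ PS c y = 0.
  by apply: hx; rewrite inE yxs orbT.
split=> //; apply: dy => //.
  by apply: le_lt_trans ye (lt_trans e1 r1).
by apply: contraNneq xxs => <-.
Qed.

Lemma PS_rescale c z (t : R) : t != 0 ->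
  PS (fun n => c n * t%:C ^+ n) (z / t%:C) = PS c z.
Proof.
move=> t0; rewrite /PS; congr (limn (series _)); apply/funext => n.
rewrite -mulrA -exprMn [t%:C * _]mulrC divfK //.
by apply: contra_neq t0 => /complexI.
Qed.

Lemma has_radius_rescale c r (t : R) : 0 < t -> has_radius c r ->
  has_radius (fun n => c n * t%:C ^+ n) (r / t).
Proof.
move=> t0 hc s s0 sr.
have [|M cM] := hc (t * s) (mulr_gt0 t0 s0); first by rewrite mulrC -ltr_pdivlMr.
exists M => n; rewrite normcM normcX normc_real gtr0_norm // -mulrA -exprMn.
exact: cM.
Qed.

(** After rescaling, the zeros lie in a disc of radius less than one while the
    series converges beyond the unit circle, so that the bound of
    [blaschke_zeros] tends to zero with the number of zeros. *)
Lemma infinite_zeros_const c r e (z : nat -> C) : has_radius c r -> 0 < e -> e < r ->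
  injective z -> (forall i, normc (z i) <= e /\ PS c (z i) = 0) -> c 0%N = 0.
Proof.
move=> hc e0 er zi hz; pose t := (e + r) / 2; pose t' := (t + r) / 2.
have [et tt' t'r] : [/\ e < t, t < t' & t' < r] by rewrite /t' /t; split; lra.
have t0 : 0 < t by lra. have t'0 : 0 < t' by lra.
have [B cB] := hc t' t'0 t'r.
have B0 : 0 <= B by apply: le_trans (cB 0%N); rewrite expr0 mulr1 normc_ge0.
pose c' n := c n * t%:C ^+ n.
pose q := (t / t') ^+ 2.
have q0 : 0 <= q by rewrite sqr_ge0.
have q1 : q < 1.
  by rewrite expr_lt1 //; [rewrite ltr_pdivrMr // mul1r | apply: divr_ge0; apply: ltW].
pose M := B ^+ 2 / (1 - q).
have c'M n : \sum_(0 <= i < n) normc (c' i) ^+ 2 <= M.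
  apply: le_trans (_ : \sum_(0 <= i < n) B ^+ 2 * q ^+ i <= _).
    apply: ler_sum => i _; rewrite /c' normcM normcX normc_real gtr0_norm //.
    have -> : B ^+ 2 * q ^+ i = (B * (t / t') ^+ i) ^+ 2.
      by rewrite /q [RHS]exprMn -!exprM mulnC.
    apply: ler_sqr_nneg; first by rewrite mulr_ge0 ?normc_ge0 ?exprn_ge0 ?(ltW t0).
    rewrite (expr_div_n t t') mulrA ler_pdivlMr ?exprn_gt0 // mulrAC.
    by rewrite ler_wpM2r // exprn_ge0 // ltW.
  rewrite -mulr_sumr ler_wpM2l ?sqr_ge0 //.
  by have := geometric_tail 0 n q0 q1; rewrite expr0 mul1r.
have r1 : 1 < r / t by rewrite ltr_pdivlMr // mul1r; lra.
have et1 : e / t < 1 by rewrite ltr_pdivrMr // mul1r.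
have et0 : 0 <= e / t by rewrite divr_ge0 // ltW.
have bound k : normc (c' 0%N) ^+ 2 <= ((e / t) ^+ 2) ^+ k * M.
  pose xs := [seq z i / t%:C | i <- iota 0 k].
  have tC : t%:C != 0 :> C := real_neq0 t0.
  have := @blaschke_zeros xs c' (r / t) (e / t) M r1 (has_radius_rescale t0 hc) et1 c'M.
  rewrite size_map size_iota; apply.
    rewrite map_inj_uniq ?iota_uniq // => i j.
    by move/(mulIf _) => h; apply: zi; apply: h; rewrite invr_eq0.
  move=> x /mapP[i _ ->]; have [ze cz] := hz i; rewrite PS_rescale ?gt_eqF //.
  by rewrite normcM normcV normc_real gtr0_norm // ler_pM2r // invr_gt0.
have : normc (c' 0%N) ^+ 2 <= 0.
  have lim : (fun k => ((e / t) ^+ 2) ^+ k * M) @ \oo --> 0.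
    rewrite -[X in _ --> X](mul0r M); apply: cvgM; last exact: cvg_cst.
    by apply: cvg_expr; rewrite ger0_norm ?sqr_ge0 // expr_lt1.
  rewrite -(cvg_lim _ lim) //; apply: limr_ge; first by apply/cvg_ex; exists 0.
  by apply: nearW => k; apply: bound.
rewrite real_exprn_even_le0 ?num_real //= => /eqP /eq0_normc.
by rewrite /c' expr0 mulr1.
Qed.

(** Once the constant term vanishes, the series can be divided by the variable,
    and the quotient has the same zeros since these are different from the
    origin. *)
Lemma infinite_zeros c r e (z : nat -> C) : has_radius c r -> 0 < e -> e < r ->
  injective z -> (forall i, [/\ z i != 0, normc (z i) <= e & PS c (z i) = 0]) ->
  forall n, c n = 0.
Proof.
move=> hc e0 er zi hz n; elim: n c hc hz => [|n IH] c hc hz.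
  by apply: (infinite_zeros_const hc e0 er zi) => i; have [] := hz i.
have c0 : c 0%N = 0 by apply: (infinite_zeros_const hc e0 er zi) => i; have [] := hz i.
apply: (IH (fun n => c n.+1)); first by move=> s s0 sr; apply: coef_boundedS => //; apply: hc.
move=> i; have [z0 ze cz] := hz i; split => //.
move: cz; rewrite (PS_recl_radius hc (le_lt_trans ze er)) c0 add0r => /eqP.
by rewrite mulf_eq0 (negPf z0) => /eqP.
Qed.

Lemma PS_eq_near0 r c d : 0 < r -> has_radius c r -> has_radius d r ->
  (exists2 e : R, 0 < e & forall t : R, 0 < t -> t < e -> PS c t%:C = PS d t%:C) ->
  c =1 d.
Proof.
move=> r0 hc hd [e e0 E] n.
pose s := r / 2; have s0 : 0 < s by rewrite /s; lra.
have sr : s < r by rewrite /s; lra.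
have hc' := hc s s0 sr; have hd' : coef_bounded (fun n => -1 * d n) s.
  by apply: coef_boundedZ; exact: hd.
apply/eqP; rewrite -subr_eq0 -mulN1r; apply/eqP.
apply: (@PS_zeros_at_origin R s (c \+ (fun n => -1 * d n)) s0).
  exact: coef_boundedD.
move=> f f0; pose t := Num.min (Num.min f s) e / 2.
have m0 : 0 < Num.min (Num.min f s) e by rewrite !lt_min f0 s0 e0.
have tm : t < Num.min (Num.min f s) e by rewrite /t; lra.
have t0 : 0 < t by rewrite /t; lra.
move: tm; rewrite !lt_min => /andP[/andP[tf ts] te].
have tn : normc t%:C < s by rewrite normc_real gtr0_norm.
exists t%:C; first exact: real_neq0.
split; first by rewrite normc_real gtr0_norm.
by rewrite (PSD s0) // (PSZ s0) ?E // ?mulN1r ?subrr //; exact: hd.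
Qed.

End IdentityTheorem.

(** * The equation satisfied by both generating functions *)

Section Riccati.
Variable R : realType.
Local Notation C := R[i].
Implicit Types (a b c d : nat -> C) (z : C) (r s : R).

(** The equation [G G'' = k G'^2], read on the coefficients of [G]. It says that
    the logarithmic derivative [h = G' / G] solves the Riccati equation
    [h' = (k - 1) h^2]. *)
Definition log_riccati (k : C) a := forall n,
  conv_coef (deriv_coef (deriv_coef a)) a n = k * conv_coef (deriv_coef a) (deriv_coef a) n.

(** In the [n]-th equation the coefficient of index [n + 2] occurs only once, with
    the nonzero factor [(n + 2) (n + 1)]; the other ones have smaller index. *)
Lemma log_riccati_unique k a b : log_riccati k a -> log_riccati k b ->
  a 0%N = 1 -> b 0%N = 1 -> a 1%N = b 1%N -> a =1 b.
Proof.
move=> ha hb a0 b0 ab1 n; elim/ltn_ind: n => -[|[|n]] IH; rewrite ?a0 ?b0 //.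
have := ha n; rewrite /conv_coef.
have -> : \sum_(i < n.+1) deriv_coef a i * deriv_coef a (n - i)%N =
          \sum_(i < n.+1) deriv_coef b i * deriv_coef b (n - i)%N.
  apply: eq_bigr => i _; rewrite /deriv_coef !IH // ltnS //.
  by rewrite (leq_ltn_trans (leq_subr _ _)).
rewrite -hb /conv_coef !big_ord_recr /= subnn a0 b0 !mulr1.
have -> : \sum_(i < n) deriv_coef (deriv_coef a) i * a (n - i)%N =
          \sum_(i < n) deriv_coef (deriv_coef b) i * b (n - i)%N.
  apply: eq_bigr => i _; rewrite /deriv_coef !IH ?ltnS //.
  by rewrite (leq_trans (leq_subr _ _)).
move=> /addrI; rewrite /deriv_coef !mulrA; apply: mulfI.
by rewrite -natrM pnatr_eq0.
Qed.

Lemma log_riccati_scale k b (g : C) : log_riccati k b ->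
  log_riccati k (fun n => b n * g ^+ n).
Proof.
move=> hb n.
have E1 : conv_coef (deriv_coef (deriv_coef (fun n => b n * g ^+ n))) (fun n => b n * g ^+ n) n =
  g ^+ n.+2 * conv_coef (deriv_coef (deriv_coef b)) b n.
  rewrite /conv_coef mulr_sumr; apply: eq_bigr => i _; rewrite /deriv_coef.
  by rewrite -[X in _ = g ^+ X.+2 * _](subnKC (ltn_ord i : (i <= n)%N)) !exprS exprD; ring.
have E2 : conv_coef (deriv_coef (fun n => b n * g ^+ n)) (deriv_coef (fun n => b n * g ^+ n)) n =
  g ^+ n.+2 * conv_coef (deriv_coef b) (deriv_coef b) n.
  rewrite /conv_coef mulr_sumr; apply: eq_bigr => i _; rewrite /deriv_coef.
  by rewrite -[X in _ = g ^+ X.+2 * _](subnKC (ltn_ord i : (i <= n)%N)) !exprS exprD; ring.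
by rewrite E1 E2 hb mulrCA.
Qed.

Lemma log_riccati_dilation k a b : log_riccati k a -> log_riccati k b ->
  a 0%N = 1 -> b 0%N = 1 -> b 1%N != 0 -> forall n, a n = b n * (a 1%N / b 1%N) ^+ n.
Proof.
move=> ha hb a0 b0 b1.
apply: (log_riccati_unique ha (@log_riccati_scale k b (a 1%N / b 1%N) hb)) => //=.
  by rewrite expr0 mulr1.
by rewrite expr1 mulrC divfK.
Qed.

Lemma PS_affine_mul r c al be z : has_radius c r -> normc z < r ->
  PS (fun n => al * deriv_coef c n + be * (n%:R * c n)) z =
  (al + be * z) * PS (deriv_coef c) z.
Proof.
move=> hc zr; have hd := has_radius_deriv hc; have [s s0 [zs sr]] := between zr.
rewrite (_ : (fun _ => _) = (fun n => al * deriv_coef c n) \+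
    (fun n => be * shift_coef (deriv_coef c) n)); last first.
  by apply/funext => -[|n] //; rewrite mul0r.
rewrite (PSD s0) //; first last.
- by apply: coef_boundedZ; apply: (has_radius_shift hd s0 sr).
- by apply: coef_boundedZ; apply: hd.
rewrite (PSZ s0) //; last exact: hd.
rewrite (PSZ s0) //; last by apply: has_radius_shift s0 sr.
by rewrite (PS_shift hd zr); ring.
Qed.

Lemma has_radius_affine r c al be : has_radius c r ->
  has_radius (fun n => al * deriv_coef c n + be * (n%:R * c n)) r.
Proof.
move=> hc; have hd := has_radius_deriv hc.
rewrite (_ : (fun _ => _) = (fun n => al * deriv_coef c n) \+
    (fun n => be * shift_coef (deriv_coef c) n)); last first.
  by apply/funext => -[|n] //; rewrite mul0r.
apply: has_radiusD; apply: has_radiusZ => //; exact: has_radius_shift.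
Qed.

(** The derivative of [G = (al + be x) G'] is [(1 - be) G' = (al + be x) G'']; the
    factor [al + be x] is eliminated between the two equations. *)
Lemma log_riccati_of_ode r a al be : 0 < r -> has_radius a r ->
  (exists2 e : R, 0 < e & forall t : R, 0 < t -> t < e ->
     PS a t%:C = (al + be * t%:C) * PS (deriv_coef a) t%:C) ->
  log_riccati (1 - be) a.
Proof.
move=> r0 ha [e e0 ode].
have h1 := has_radius_deriv ha; have h2 := has_radius_deriv h1.
have rec n : a n = al * deriv_coef a n + be * (n%:R * a n).
  apply: (@PS_eq_near0 R r a (fun n => al * deriv_coef a n + be * (n%:R * a n))) => //.
    exact: has_radius_affine.
  exists (Num.min e r); first by rewrite lt_min e0.
  move=> t t0; rewrite lt_min => /andP[te tr].
  by rewrite (PS_affine_mul _ _ ha) ?ode // normc_real gtr0_norm.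
have rec2 n : (1 - be) * deriv_coef a n =
    al * deriv_coef (deriv_coef a) n + be * (n%:R * deriv_coef a n).
  rewrite /deriv_coef; have := rec n.+1; rewrite /deriv_coef -[n.+1%:R]natr1 => E.
  by rewrite mulrBl mul1r {1}E; ring.
have F0 z : normc z < r -> PS a z = (al + be * z) * PS (deriv_coef a) z.
  by move=> zr; rewrite -(PS_affine_mul _ _ ha) // -(funext rec).
have F1 z : normc z < r ->
    (1 - be) * PS (deriv_coef a) z = (al + be * z) * PS (deriv_coef (deriv_coef a)) z.
  move=> zr; have [s s0 [zs sr]] := between zr.
  by rewrite -(PS_affine_mul _ _ h1) // -(PSZ s0) ?(funext rec2) //; exact: h1.
apply: (@PS_eq_near0 R r); rewrite //; first exact: has_radius_conv.
  by apply: has_radiusZ; apply: has_radius_conv.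
exists r => // t t0 tr; have tn : normc t%:C < r by rewrite normc_real gtr0_norm.
have [s s0 [ts sr]] := between tn.
rewrite (PS_conv h2 ha) // (PSZ s0) //; last by apply: has_radius_conv s0 sr.
by rewrite (PS_conv h1 h1) // (F0 _ tn) mulrA [_ * (al + _)]mulrC -F1 // mulrA.
Qed.

(** The equation says that [theta = s G' / G] satisfies
    [s theta' = A + B theta - be theta^2], denominators being cleared. Both sides
    are power series in [s], so that infinitely many solutions make it an
    identity. Its terms of degree zero and one give [A = 0] and [B = 1], and then
    what is left is divisible by [s ^ 2]. *)
Lemma log_riccati_of_zeros r b e (A B be : C) (z : nat -> C) :
  has_radius b r -> 0 < e -> e < r -> b 0%N = 1 -> b 1%N != 0 -> injective z ->
  (forall i, z i != 0 /\ normc (z i) <= e) ->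
  (forall i, let s := z i in
     let G := PS b s in let G1 := PS (deriv_coef b) s in
     let G2 := PS (deriv_coef (deriv_coef b)) s in
     s * ((G1 + s * G2) * G - s * G1 ^+ 2) =
     A * G ^+ 2 + B * (s * G1) * G - be * (s * G1) ^+ 2) ->
  log_riccati (1 - be) b.
Proof.
move=> hb e0 er b0 b1 zi hz E.
have h1 := has_radius_deriv hb; have h2 := has_radius_deriv h1.
pose c00 := conv_coef b b; pose c10 := conv_coef (deriv_coef b) b.
pose c20 := conv_coef (deriv_coef (deriv_coef b)) b.
pose c11 := conv_coef (deriv_coef b) (deriv_coef b).
have k00 : has_radius c00 r by exact: has_radius_conv.
have k10 : has_radius c10 r by exact: has_radius_conv.
have k20 : has_radius c20 r by exact: has_radius_conv.
have k11 : has_radius c11 r by exact: has_radius_conv.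
pose f1 := fun n => - A * c00 n.
pose f2 := fun n => (1 - B) * shift_coef c10 n.
pose f3 := shift_coef (shift_coef (c20 \+ (fun n => (be - 1) * c11 n))).
have m1 : has_radius f1 r by exact: has_radiusZ.
have m2 : has_radius f2 r by apply: has_radiusZ; exact: has_radius_shift.
have m3' : has_radius (c20 \+ (fun n => (be - 1) * c11 n)) r.
  by apply: has_radiusD => //; exact: has_radiusZ.
have m3 : has_radius f3 r by do 2 apply: has_radius_shift.
have Z : forall n, (f1 \+ (f2 \+ f3)) n = 0.
  apply: (@infinite_zeros R _ r e z) => //.
    by apply: has_radiusD => //; apply: has_radiusD.
  move=> i; have [z0 ze] := hz i; split=> //.
  have zr := le_lt_trans ze er; have [s s0 [zs sr]] := between zr.
  rewrite (PSD s0) //; [|exact: m1|by apply: has_radiusD s0 sr].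
  rewrite (PSD s0) //; [|exact: m2|exact: m3].
  rewrite /f1 (PSZ s0) //; last exact: k00.
  rewrite /f2 (PSZ s0) //; last by apply: has_radius_shift s0 sr.
  rewrite /f3 (PS_shift (has_radius_shift m3') zr) (PS_shift m3' zr) (PS_shift k10 zr).
  rewrite (PSD s0) //; [|exact: k20|by apply: has_radiusZ s0 sr].
  rewrite (PSZ s0) //; last exact: k11.
  rewrite /c00 /c10 /c20 /c11 !(@PS_conv _ _ _ r) //.
  have /= := E i; move: (z i) (PS _ (z i)) (PS (deriv_coef b) _) (PS b _) => s' G2 G1 G E'.
  have -> : - A * (G * G) + ((1 - B) * (s' * (G1 * G)) +
     s' * (s' * (G2 * G + (be - 1) * (G1 * G1)))) =
     s' * ((G1 + s' * G2) * G - s' * G1 ^+ 2) -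
     (A * G ^+ 2 + B * (s' * G1) * G - be * (s' * G1) ^+ 2) by ring.
  by rewrite E' subrr.
have A0 : A = 0.
  have := Z 0%N; rewrite /= /f1 /f2 /f3 /= /c00 /conv_coef big_ord1 subn0 b0 mulr0 !addr0.
  by rewrite !mulr1 => /eqP; rewrite oppr_eq0 => /eqP.
have B1 : 1 - B = 0.
  have := Z 1%N; rewrite /= /f1 /f2 /f3 /= A0 oppr0 mul0r add0r addr0.
  rewrite /c10 /conv_coef big_ord1 /deriv_coef subn0 b0 mulr1 mul1r => /eqP.
  by rewrite mulf_eq0 (negPf b1) orbF => /eqP.
move=> n; have := Z n.+2; rewrite /= /f1 /f2 /f3 /= A0 B1 oppr0 !mul0r !add0r.
by rewrite -/c20 -/c11 => /eqP; rewrite addr_eq0 => /eqP ->; rewrite -mulNr opprB.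
Qed.
End Riccati.

(** * Complex derivatives *)

Section Derivatives.
Variable R : realType.
Local Notation C := R[i].
Implicit Types (f g : C -> C) (c : nat -> C) (x z w : C) (r : R).

Lemma conjcM z w : (z * w)^* = z^* * w^*.
Proof. exact: rmorphM. Qed.

Lemma conjcD z w : (z + w)^* = z^* + w^*.
Proof. exact: rmorphD. Qed.

Lemma conjcB z w : (z - w)^* = z^* - w^*.
Proof. exact: rmorphB. Qed.

Lemma realcD (s t : R) : (s + t)%:C = s%:C + t%:C.
Proof. exact: rmorphD. Qed.

Lemma realcM (s t : R) : (s * t)%:C = s%:C * t%:C.
Proof. exact: rmorphM. Qed.

Lemma is_derive_comp f g x df dg : is_derive x (1 : C) g dg ->
  is_derive (g x) (1 : C) f df -> is_derive x (1 : C) (f \o g) (df * dg).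
Proof.
move=> [dg1 dg2] [df1 df2].
have dg1' : differentiable g x := (derivable1_diffP g x).1 dg1.
have df1' : differentiable f (g x) := (derivable1_diffP f (g x)).1 df1.
have dfg : differentiable (f \o g) x := differentiable_comp dg1' df1'.
split; first exact: (derivable1_diffP (f \o g) x).2.
have hg := deriveE (1 : C) dg1'; have hf := deriveE (1 : C) df1'.
have hfg := deriveE (1 : C) dfg.
have E : 'd (f \o g) x (1 : C) = 'd f (g x) ('d g x (1 : C)) :=
  congr1 (fun F => F (1 : C)) (diff_comp dg1' df1').
apply: (etrans hfg); apply: (etrans E).
have Eg : 'd g x (1 : C) = dg *: (1 : C).
  by apply: (etrans (esym hg)); apply: (etrans dg2); exact: (esym (mulr1 dg)).
have Ef : 'd f (g x) (1 : C) = df := etrans (esym hf) df2.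
apply: (etrans (congr1 ('d f (g x)) Eg)).
apply: (etrans (linearZ_LR ('d f (g x)) dg (1 : C))).
by apply: (etrans (congr1 (fun u : C => dg *: u) Ef)); exact: mulrC.
Qed.

Lemma is_derive_epsP f x l : is_derive x (1 : C) f l <->
  forall e : R, 0 < e -> exists2 n : R, 0 < n & forall h, h != 0 -> normc h < n ->
    normc (l - (f (h + x) - f x) / h) < e.
Proof.
have E h : h^-1 *: (f (h *: (1 : C) + x) - f x) = (f (h + x) - f x) / h.
  by rewrite [h *: 1]mulr1 [RHS]mulrC.
split=> [[df dv] e e0|H].
  have : (fun h : C => h^-1 *: (f (h *: (1 : C) + x) - f x)) @ 0^' --> l.
    by rewrite -dv.
  move=> /cvg_normcP /(_ e e0) /nbhs_ballP[n /= n0 hn].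
  exists (complex.Re n); first by rewrite -(ltcR 0) RRe_real // gtr0_real.
  move=> h h0 hn'; rewrite -E; apply: hn => //.
  by rewrite /ball /= sub0r normrN normCE -(RRe_real (gtr0_real n0)) ltcR.
have L : (fun h : C => h^-1 *: (f (h *: (1 : C) + x) - f x)) @ 0^' --> l.
  apply/cvg_normcP => e e0; have [n n0 hn] := H e e0.
  apply/nbhs_ballP; exists n%:C => /=; first by rewrite (ltcR 0).
  move=> h; rewrite /ball /= sub0r normrN normCE ltcR => hn' h0.
  by rewrite E; apply: hn.
split; first by apply/cvg_ex; exists l.
by apply: cvg_lim.
Qed.

Lemma is_derive_conj f x l : is_derive x^* (1 : C) f l ->
  is_derive x (1 : C) (fun t => (f t^*)^*) l^*.
Proof.
move=> /is_derive_epsP H; apply/is_derive_epsP => e /H[n n0 hn].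
exists n => // h h0 hhn; have := hn h^*; rewrite conjc_eq0 normc_conj.
move=> /(_ h0 hhn); rewrite -normc_conj; congr (normc _ < e).
by rewrite rmorphB rmorphM rmorphB /= conjc_inv conjcK rmorphD.
Qed.

Lemma is_derive_near f g x l (n : R) : 0 < n ->
  (forall y, normc (y - x) < n -> f y = g y) ->
  is_derive x (1 : C) f l -> is_derive x (1 : C) g l.
Proof.
move=> n0 fg /is_derive_epsP H; apply/is_derive_epsP => e /H[n' n'0 hn].
exists (Num.min n n'); first by rewrite lt_min n0.
move=> h h0; rewrite lt_min => /andP[h1 h2].
by rewrite -!fg ?subrr ?normc0 ?addrK //; apply: hn.
Qed.

Lemma is_derive_unique f x l l' : is_derive x (1 : C) f l ->
  is_derive x (1 : C) f l' -> l = l'.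
Proof. by move=> [_ <-] [_ <-]. Qed.

Lemma is_derive_mul f g x df dg : is_derive x (1 : C) f df -> is_derive x (1 : C) g dg ->
  is_derive x (1 : C) (fun t => f t * g t) (df * g x + f x * dg).
Proof.
move=> hf hg; have h := is_deriveM hf hg; apply: is_derive_eq.
by rewrite addrC; congr (_ + _); rewrite [LHS]mulrC.
Qed.

Lemma is_derive_lin (k : C) x : is_derive x (1 : C) (fun t => k * t) k.
Proof.
have h := is_derive_mul (is_derive_cst k x 1) (is_derive_id x (1 : C)).
by apply: is_derive_eq; rewrite mul0r add0r mulr1.
Qed.

Lemma PS_conj c r z : has_radius c r -> normc z < r ->
  (forall n, (c n)^* = c n) -> PS c z^* = (PS c z)^*.
Proof.
move=> hc zr cr; have [s s0 [zs sr]] := between zr; apply: PS_eq.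
rewrite (_ : series _ = fun n => (series (fun n => c n * z ^+ n) n)^*).
  by apply: cvg_conj; apply: (PS_cvg s0) => //; apply: hc.
apply/funext => n; rewrite /series /= rmorph_sum /=; apply: eq_bigr => i _.
by rewrite rmorphM rmorphXn /= cr.
Qed.

Lemma PS_pos (c : nat -> R) r (x : R) : has_radius (fun n => (c n)%:C) r ->
  (forall n, 0 <= c n) -> 0 < c 0%N -> 0 <= x -> x < r ->
  exists2 y : R, c 0%N <= y & PS (fun n => (c n)%:C) x%:C = y%:C.
Proof.
move=> hc c0 c00 x0 xr; have xn : normc x%:C < r by rewrite normc_real ger0_norm.
have [s s0 [xs sr]] := between xn.
have cv := PS_cvg s0 (hc s s0 sr) xs.
have cj : (PS (fun n => (c n)%:C) x%:C)^* = PS (fun n => (c n)%:C) x%:C.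
  by rewrite -(PS_conj hc xn) ?conjc_real // => n; rewrite conjc_real.
have E : PS (fun n => (c n)%:C) x%:C = (complex.Re (PS (fun n => (c n)%:C) x%:C))%:C.
  by rewrite ReJ_add cj; field.
exists (complex.Re (PS (fun n => (c n)%:C) x%:C)) => //.
have cR := @cvg_Re R _ _ eventually_filter _ _ cv.
rewrite -(cvg_lim _ cR) //; apply: limr_ge; first by apply/cvg_ex; eexists; exact: cR.
exists 1%N => // n /= n1; rewrite /series /=.
have -> : complex.Re (\sum_(0 <= i < n) (c i)%:C * x%:C ^+ i) = \sum_(0 <= i < n) c i * x ^+ i.
  rewrite -[RHS]/(complex.Re (\sum_(0 <= i < n) c i * x ^+ i)%:C) rmorph_sum /=.
  by congr complex.Re; apply: eq_bigr => i _; rewrite rmorphM rmorphXn.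
case: n n1 => // n _; rewrite big_nat_recl // expr0 mulr1 lerDl.
by apply: sumr_ge0 => i _; rewrite mulr_ge0 ?exprn_ge0.
Qed.

End Derivatives.

(** * The functional equation *)

Section FunctionalEquation.
Variable R : realType.
Local Notation C := R[i].

(** Taking [s = t] shows that [m] is real. The three equations for the pairs drawn
    from [y], [s], [t] then eliminate [m] and relate the difference quotients
    [r] of [q] at [y * s], [y * t] and [s * t]; as [y] tends to zero the first
    two tend to [r0], so that [r] is constant. *)
Lemma functional_equation_affine (m q : R -> C) (q0 r0 : C) (e : R) : 0 < e ->
  (forall s t, 0 < s -> s < e -> 0 < t -> t < e ->
     t%:C * m s - s%:C * (m t)^* = q (s * t) * (t%:C - s%:C)) ->
  (forall u, 0 < u -> exists2 n, 0 < n & forall t : R, 0 < t -> t < n ->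
     normc (r0 - (q t - q0) / t%:C) < u) ->
  exists2 n, 0 < n & exists k : C, forall t, 0 < t -> t < n ->
     q t = q0 + r0 * t%:C /\ m t = q0 + k * t%:C - r0 * t%:C ^+ 2.
Proof.
move=> e0 H Q.
have pC t : 0 < t -> t%:C != 0 :> C := @real_neq0 R t.
have mr t : 0 < t -> t < e -> (m t)^* = m t.
  move=> t0 te; have := H t t t0 te t0 te; rewrite subrr mulr0 -mulrBr => /eqP.
  by rewrite mulf_eq0 (negPf (pC t t0)) subr_eq0 => /eqP.
have H' s t : 0 < s -> s < e -> 0 < t -> t < e ->
     t%:C * m s - s%:C * m t = q (s * t) * (t%:C - s%:C).
  by move=> s0 se t0 te; rewrite -[X in _ - _ * X](mr t) // H.
pose r t := (q t - q0) / t%:C.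
have qE t : 0 < t -> q t = q0 + t%:C * r t.
  by move=> t0; rewrite /r mulrC divfK ?pC // addrC subrK.
have rE s t : 0 < s -> s < e -> 0 < t -> t < e -> s != t -> r (s * t) = r0.
  move=> s0 se t0 te st; apply/eqP; rewrite eq_sym -subr_eq0; apply/negPn/negP => ne.
  pose K := `|t - s| * normc (r0 - r (s * t)).
  have K0 : 0 < K by rewrite mulr_gt0 ?normc_gt0 // normr_gt0 subr_eq0 eq_sym.
  have u0 : 0 < K / (4 * e) by rewrite divr_gt0 // mulr_gt0.
  have [n n0 hn] := Q _ u0.
  pose y := Num.min (Num.min (n / e) s) t / 2.
  have m0 : 0 < Num.min (Num.min (n / e) s) t by rewrite !lt_min s0 t0 divr_gt0.
  have y0 : 0 < y by rewrite /y; lra.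
  have : y < Num.min (Num.min (n / e) s) t by rewrite /y; lra.
  rewrite !lt_min => /andP[/andP[yn ys] yt].
  have yse : y * s < n.
    apply: (@le_lt_trans _ _ (y * e)); first by rewrite ler_wpM2l ?(ltW y0) ?(ltW se).
    by rewrite -ltr_pdivlMr.
  have yte : y * t < n.
    apply: (@le_lt_trans _ _ (y * e)); first by rewrite ler_wpM2l ?(ltW y0) ?(ltW te).
    by rewrite -ltr_pdivlMr.
  clearbody y.
  have h1 := hn (y * s) (mulr_gt0 y0 s0) yse.
  have h2 := hn (y * t) (mulr_gt0 y0 t0) yte.
  (* the elimination of m y, m s and m t *)
  have E : (t - s)%:C * (r0 - r (s * t)) =
      (t - y)%:C * (r0 - r (y * t)) - (s - y)%:C * (r0 - r (y * s)).
    have e1 := H' y s y0 (lt_trans ys se) s0 se.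
    have e2 := H' y t y0 (lt_trans ys se) t0 te.
    have e3 := H' s t s0 se t0 te.
    move: e1 e2 e3; rewrite !qE ?mulr_gt0 // !rmorphB !rmorphM /=.
    move: (r (y * s)) (r (y * t)) (r (s * t)) (m y) (m s) (m t) => r1 r2 r3 A B D.
    have := pC _ y0; have := pC _ s0; have := pC _ t0.
    move: (y%:C) (s%:C) (t%:C) => Y S T T0 S0 Y0 e1 e2 e3.
    have key : S * ((q0 + Y * T * r2) * (T - Y)) - T * ((q0 + Y * S * r1) * (S - Y)) =
       Y * ((q0 + S * T * r3) * (T - S)) by rewrite -e1 -e2 -e3; ring.
    apply: (mulfI (mulf_neq0 (mulf_neq0 Y0 S0) T0)).
    have -> : Y * S * T * ((T - S) * (r0 - r3)) = Y * S * T * (T - S) * r0 + Y * (q0 * (T - S))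
        - Y * ((q0 + S * T * r3) * (T - S)) by ring.
    rewrite -key; ring.
  have : K < K / 2.
    rewrite {1}/K -normc_real -normcM E.
    apply: le_lt_trans (le_normcD _ _) _; rewrite normcN !normcM !normc_real.
    have ty : `|t - y| <= e by rewrite ger0_norm ?subr_ge0 ?(ltW yt) //; lra.
    have sy : `|s - y| <= e by rewrite ger0_norm ?subr_ge0 ?(ltW ys) //; lra.
    have -> : K / 2 = e * (K / (4 * e)) + e * (K / (4 * e)) by field; rewrite gt_eqF.
    have e4 w A : `|w| <= e -> A < K / (4 * e) -> 0 <= A -> `|w| * A < e * (K / (4 * e)).
      move=> h3 h4 h5; apply: (@le_lt_trans _ _ (e * A)); first by rewrite ler_wpM2r.
      by rewrite ltr_pM2l.
    by apply: ltrD; apply: e4 => //; rewrite normc_ge0.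
  by rewrite ltNge ler_pdivrMr // ler_peMr ?(ltW K0) // ler1n.
pose s := e / 2; have s0 : 0 < s by rewrite /s; lra.
have se : s < e by rewrite /s; lra.
clearbody s.
exists (Num.min s (s * s)); first by rewrite lt_min s0 mulr_gt0.
exists ((m s - q0) / s%:C + r0 * s%:C) => t t0; rewrite lt_min => /andP[ts tss].
have te := lt_trans ts se.
split.
  have ts0 : 0 < t / s by rewrite divr_gt0.
  have ts1 : t / s < s by rewrite ltr_pdivrMr.
  have ne : t / s != s by rewrite lt_eqF.
  have := rE _ _ ts0 (lt_trans ts1 se) s0 se ne; rewrite (divfK (lt0r_neq0 s0)) => rt.
  by rewrite qE // rt mulrC.
have := H' t s t0 te s0 se; rewrite qE ?mulr_gt0 // rE //; last by rewrite lt_eqF.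
rewrite rmorphM /= => E; apply: (mulfI (pC s s0)).
move/eqP: E; rewrite subr_eq => /eqP ->.
have := pC s s0; move: (s%:C) (t%:C) (m s) => S T A S0; field.
exact: S0.
Qed.

End FunctionalEquation.

(** * The identity along a complex line *)

Section OneVariable.
Variable R : realType.
Local Notation C := R[i].

Lemma is_derive_scale (k : C) (f : C -> C) x l : is_derive x (1 : C) f l ->
  is_derive x (1 : C) (fun t => k * f t) (k * l).
Proof.
move=> h; have h' := is_derive_mul (is_derive_cst k x (1 : C)) h.
by apply: is_derive_eq; rewrite mul0r add0r.
Qed.

Lemma is_derive_inv (f : C -> C) x l : f x != 0 -> is_derive x (1 : C) f l ->
  exists l', is_derive x (1 : C) (fun t => (f t)^-1) l'.
Proof.
move=> fx [df _]; exists ('D_(1 : C) (fun t => (f t)^-1) x).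
exact: (DeriveDef (derivableV fx df) erefl).
Qed.

Lemma is_derive_PS_comp c r (f : C -> C) x l : has_radius c r -> normc (f x) < r ->
  is_derive x (1 : C) f l ->
  is_derive x (1 : C) (fun t => PS c (f t)) (PS (deriv_coef c) (f x) * l).
Proof. by move=> hc fr hf; apply: is_derive_comp hf (is_derive_PS hc fr). Qed.

Lemma deriv_coef_real (a : nat -> R) n :
  deriv_coef (fun n => (a n)%:C) n = (n.+1%:R * a n.+1)%:C.
Proof. by rewrite /deriv_coef rmorphM rmorph_nat. Qed.

(** The kernel identity restricted to a line [t |-> t e] which is mapped into the
    line through [p = phi 0]: [c] and [rho] are the squared norms of [e] and [p],
    [s t] is [<phi (t e), p>] and [l t] is [lambda (t e)], so that
    [<phi (t e), phi (u e)>] is [s t * (s u)^* / rho]. *)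
Variables (a b : nat -> R) (r1 r e0 c rho th0 ka ep : R) (s l : C -> C).
Let A n := (a n)%:C.
Let B n := (b n)%:C.
Hypotheses (r1_gt0 : 0 < r1) (hA : has_radius A r1) (hB : has_radius B r).
Hypotheses (e0_gt0 : 0 < e0) (e0r : e0 < r).
Hypotheses (a0 : a 0%N = 1) (a_gt0 : forall n, 0 < a n).
Hypotheses (b0 : b 0%N = 1) (b_gt0 : forall n, 0 < b n).
Hypotheses (c_gt0 : 0 < c) (rho_gt0 : 0 < rho) (th0_gt0 : 0 < th0) (ka_gt0 : 0 < ka).
Hypothesis ep_gt0 : 0 < ep.
Hypothesis ds_ex : forall t, normc t < ep -> exists d : C, is_derive t (1 : C) s d.
Hypothesis dl_ex : forall t, normc t < ep -> exists d : C, is_derive t (1 : C) l d.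
Hypothesis s_le : forall t, normc t < ep -> normc (s t) <= e0.
Hypothesis S_lt : forall t u, normc t < ep -> normc u < ep ->
  normc ((s u)^* / rho%:C * s t) < r.
Hypothesis x_lt : forall t u, normc t < ep -> normc u < ep ->
  normc (c%:C * u^* * t) < r1.
Hypothesis A_neq0 : forall t u, normc t < ep -> normc u < ep ->
  PS A (c%:C * u^* * t) != 0.
Hypothesis s0 : s 0 = rho%:C.
Hypothesis kernelE : forall t u, normc t < ep -> normc u < ep ->
  PS A (c%:C * u^* * t) = l t * ((l u)^* * PS B ((s u)^* / rho%:C * s t)).
Hypothesis thetaE : forall t, normc t < ep ->
  s t * PS (deriv_coef B) (s t) = (th0%:C + ka%:C * t) * PS B (s t).

Let normc00 : normc (0 : C) < ep. Proof. by rewrite normc0. Qed.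
Let sr t : normc t < ep -> normc (s t) < r.
Proof. by move=> /s_le /le_lt_trans; apply. Qed.
Let hA' := has_radius_deriv hA.
Let hB' := has_radius_deriv hB.
Let ds t : C := 'D_(1 : C) s t.
Let dsP t : normc t < ep -> is_derive t (1 : C) s (ds t).
Proof. by move=> /ds_ex[d [h _]]; exact: (DeriveDef h erefl). Qed.
Let dl t : C := 'D_(1 : C) l t.
Let dlP t : normc t < ep -> is_derive t (1 : C) l (dl t).
Proof. by move=> /dl_ex[d [h _]]; exact: (DeriveDef h erefl). Qed.

Let near_eq t (f g : C -> C) (d : C) : normc t < ep -> (forall u, normc u < ep -> f u = g u) ->
  is_derive t (1 : C) f d -> is_derive t (1 : C) g d.
Proof.
move=> te fg; have n0 : 0 < ep - normc t by rewrite subr_gt0.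
apply: (is_derive_near n0) => y hy; apply: fg.
by rewrite -(subrK t y); apply: le_lt_trans (le_normcD _ _) _; rewrite -ltrBrDr.
Qed.

Let A0 : PS A 0 = 1.
Proof. by rewrite (PS0_radius r1_gt0 hA) /A a0. Qed.

Let kernel0 t : normc t < ep -> l t * ((l 0)^* * PS B (s t)) = 1.
Proof.
move=> te; have := kernelE te normc00.
rewrite rmorph0 mulr0 mul0r A0 s0 conjc_real divff ?mul1r //; exact: real_neq0.
Qed.

Let B_neq0 t : normc t < ep -> PS B (s t) != 0.
Proof.
move=> te; apply/eqP => E; have /eqP := kernel0 te; rewrite E !mulr0.
by rewrite eq_sym oner_eq0.
Qed.

Let dkernel0 t : normc t < ep ->
  dl t * PS B (s t) + l t * (PS (deriv_coef B) (s t) * ds t) = 0.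
Proof.
move=> te; have h1 := is_derive_PS_comp hB (sr te) (dsP te).
have h2 := is_derive_mul (dlP te) (is_derive_scale (l 0)^* h1).
have h3 := is_derive_unique (near_eq te kernel0 h2) (is_derive_cst (1 : C) t (1 : C)).
have l0 : (l 0)^* != 0.
  by apply/eqP => E; have /eqP := kernel0 te; rewrite E mul0r mulr0 eq_sym oner_eq0.
apply: (mulfI l0); rewrite mulr0 -[RHS]h3; ring.
Qed.

(** The derivative of [thetaE], from which [PS (deriv_coef B) (s t)] is eliminated
    by means of [thetaE] itself. *)
Let dtheta t : normc t < ep ->
  ds t * ((PS (deriv_coef B) (s t) + s t * PS (deriv_coef (deriv_coef B)) (s t)) * PS B (s t)
          - s t * PS (deriv_coef B) (s t) ^+ 2) = ka%:C * PS B (s t) ^+ 2.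
Proof.
move=> te; have h1 := is_derive_PS_comp hB' (sr te) (dsP te).
have h2 := is_derive_mul (dsP te) h1.
have h3 := is_derive_PS_comp hB (sr te) (dsP te).
have h4 : is_derive t (1 : C) (fun u : C => th0%:C + ka%:C * u) ka%:C.
  have h := is_deriveD (is_derive_cst th0%:C t (1 : C)) (is_derive_lin ka%:C t).
  by apply: is_derive_eq; rewrite add0r.
have h5 := is_derive_mul h4 h3.
have h6 := is_derive_unique (near_eq te thetaE h2) h5.
have E := thetaE te; move: h6 E.
set G := PS B _; set G1 := PS (deriv_coef B) _; set G2 := PS _ _.
move: (ds t) (s t) (th0%:C + _) => D S Th h6 E.
have -> : D * ((G1 + S * G2) * G - S * G1 ^+ 2) =
  (D * G1 + S * (G2 * D)) * G - S * G1 * (G1 * D) by ring.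
by rewrite h6 E; ring.
Qed.

Let ds_neq0 t : normc t < ep -> ds t != 0.
Proof.
move=> te; apply/eqP => E; have /esym/eqP := dtheta te; rewrite E mul0r.
by rewrite mulf_eq0 expf_eq0 /= (negPf (B_neq0 te)) orbF (negPf (real_neq0 ka_gt0)).
Qed.

(** The logarithmic derivative of [kernelE] in [t]. The unknown [dl t / l t] also
    occurs in the logarithmic derivative for [u = 0], where the left-hand side is
    constant, and is eliminated between the two. *)
Let kernel_log_derivative t u : normc t < ep -> normc u < ep ->
  let S := (s u)^* / rho%:C * s t in
  PS (deriv_coef A) (c%:C * u^* * t) * (c%:C * u^*) * (s t / ds t) =
  PS A (c%:C * u^* * t) * (S * PS (deriv_coef B) S / PS B S - (th0%:C + ka%:C * t)).
Proof.
move=> te ue S.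
have h1 := @is_derive_PS_comp _ r1 (fun v => c%:C * u^* * v) _ _ hA (x_lt te ue)
  (is_derive_lin (c%:C * u^*) t).
have h2 := @is_derive_PS_comp _ r (fun v => (s u)^* / rho%:C * s v) _ _ hB (S_lt te ue)
  (is_derive_scale ((s u)^* / rho%:C) (dsP te)).
have h3 := is_derive_mul (dlP te) (is_derive_scale (l u)^* h2).
have K v : normc v < ep -> PS A (c%:C * u^* * v) =
    l v * ((l u)^* * PS B ((s u)^* / rho%:C * s v)) by move=> /kernelE; apply.
have E := is_derive_unique (near_eq te K h1) h3.
have BS0 : PS B S != 0.
  by apply/eqP => E0; have := A_neq0 te ue; rewrite kernelE // -/S E0 !mulr0 eqxx.
have D0 := dkernel0 te; have T := thetaE te; have G0 := B_neq0 te; have d0 := ds_neq0 te.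
rewrite E kernelE // -/S; apply: (mulIf d0); apply: (mulIf G0).
have SE : (s u)^* / rho%:C * ds t * s t = S * ds t by rewrite /S; ring.
have D1 : dl t * PS B (s t) = - (l t * (PS (deriv_coef B) (s t) * ds t)).
  by apply/eqP; rewrite -addr_eq0 D0.
clearbody S; move: SE D1 T d0 BS0 {D0 E h3 h2 h1}; set K' := _ / _.
move: (ds t) (s t) (dl t) (l t) (l u)^* (th0%:C + _) => D s1 dl1 l1 lu Th.
move: (PS (deriv_coef B) s1) (PS B s1) (PS (deriv_coef B) S) (PS B S) => G1 G H1 H SE D1 T d0 H0.
have -> : (dl1 * (lu * H) + l1 * (lu * (H1 * (K' * D)))) * (s1 / D) * D * G =
  lu * (dl1 * G * H * s1 + l1 * G * H1 * (K' * D * s1)) by field.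
rewrite D1 SE.
have -> : - (l1 * (G1 * D)) * H * s1 = - l1 * D * H * (s1 * G1) by ring.
by rewrite T; field.
Qed.

Let q (t : R) : C := ka%:C * PS A (c * t)%:C / (c%:C * PS (deriv_coef A) (c * t)%:C).
Let m (t : R) : C := s t%:C / ds t%:C.

Let dA_neq0 (t : R) : 0 <= t -> t < r1 -> PS (deriv_coef A) t%:C != 0.
Proof.
move=> t0 tr; rewrite (funext (deriv_coef_real a)).
have [||//|||y ay ->] := @PS_pos R (fun n => n.+1%:R * a n.+1) r1 t.
- by move: hA'; rewrite /A (funext (deriv_coef_real a)).
- by move=> n; rewrite mulr_ge0 // ltW.
- by rewrite mulr_gt0.
- by [].
- by [].
by apply: real_neq0; apply: lt_le_trans ay; rewrite mulr_gt0.
Qed.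

Let real_conj_PS (d : nat -> R) r' z : has_radius (fun n => (d n)%:C) r' -> normc z < r' ->
  PS (fun n => (d n)%:C) z^* = (PS (fun n => (d n)%:C) z)^*.
Proof. by move=> hd zr; apply: (PS_conj hd zr) => n; rewrite conjc_real. Qed.

(** The term of [kernel_log_derivative] that depends on [B] is conjugated when
    [t] and [u] are exchanged; it disappears from the difference of the equation
    for [(u, w)] and the conjugate of the one for [(w, u)]. *)
Let functional_eq (u w : R) : 0 < u -> u < ep -> 0 < w -> w < ep ->
  w%:C * m u - u%:C * (m w)^* = q (u * w) * (w%:C - u%:C).
Proof.
move=> u0 ue w0 we.
have un : normc u%:C < ep by rewrite normc_real gtr0_norm.
have wn : normc w%:C < ep by rewrite normc_real gtr0_norm.
have E1 := kernel_log_derivative un wn; have E2 := kernel_log_derivative wn un.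
have x1 : c%:C * w%:C^* * u%:C = (c * (u * w))%:C by rewrite conjc_real !rmorphM /=; ring.
have x2 : c%:C * u%:C^* * w%:C = (c * (u * w))%:C by rewrite conjc_real !rmorphM /=; ring.
have xr : c * (u * w) < r1.
  by have := x_lt un wn; rewrite x1 normc_real gtr0_norm // !mulr_gt0.
have x0 : 0 <= c * (u * w) by rewrite !mulr_ge0 // ltW.
have xn : normc (c * (u * w))%:C < r1 by rewrite normc_real ger0_norm.
move: E1 E2; cbv zeta; rewrite x1 x2 !conjc_real.
have Sn := S_lt wn un.
set S := (s w%:C)^* / _ * _; set S' := (s u%:C)^* / _ * _.
have SE : S = S'^*.
  by rewrite /S /S' !conjcM conjcK conjc_inv conjc_real; ring.
have {}Sn : normc S' < r by exact: Sn.
clearbody S S'; move=> E1 /(congr1 (@conjc R)).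
have cA : (PS A (c * (u * w))%:C)^* = PS A (c * (u * w))%:C.
  by rewrite -(real_conj_PS hA xn) conjc_real.
have cA' : (PS (deriv_coef A) (c * (u * w))%:C)^* = PS (deriv_coef A) (c * (u * w))%:C.
  move: hA'; rewrite /A (funext (deriv_coef_real a)) => hA''.
  by rewrite -(real_conj_PS hA'' xn) conjc_real.
have cB : (PS B S')^* = PS B S by rewrite SE (real_conj_PS hB Sn).
have cB' : (PS (deriv_coef B) S')^* = PS (deriv_coef B) S.
  move: hB'; rewrite /B (funext (deriv_coef_real b)) => hB''.
  by rewrite SE (real_conj_PS hB'' Sn).
rewrite [LHS]conjcM [X in X * _ = _]conjcM cA' [(c%:C * _)^*]conjcM !conjc_real.
rewrite [RHS]conjcM cA conjcB conjcD [(ka%:C * _)^*]conjcM !conjc_real.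
rewrite [X in _ = _ * (X - _)]conjcM [(S' * _)^*]conjcM conjc_inv cB cB' -SE.
have dA0 := dA_neq0 x0 xr; have c0 := real_neq0 c_gt0.
rewrite -/(m w) => E2.
have E1' : PS (deriv_coef A) (c * (u * w))%:C * (c%:C * w%:C) * m u =
  PS A (c * (u * w))%:C * (S * PS (deriv_coef B) S / PS B S - (th0%:C + ka%:C * u%:C)) := E1.
have E : c%:C * PS (deriv_coef A) (c * (u * w))%:C * (w%:C * m u - u%:C * (m w)^*) =
  ka%:C * PS A (c * (u * w))%:C * (w%:C - u%:C).
  have -> : c%:C * PS (deriv_coef A) (c * (u * w))%:C * (w%:C * m u - u%:C * (m w)^*) =
    PS (deriv_coef A) (c * (u * w))%:C * (c%:C * w%:C) * m u -
    PS (deriv_coef A) (c * (u * w))%:C * (c%:C * u%:C) * (m w)^* by ring.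
  rewrite E1' E2; move: (PS A _) (_ / PS B S) => X Y; ring.
apply: (mulfI (mulf_neq0 c0 dA0)); rewrite E /q.
move: (PS A _) (PS (deriv_coef A) _) dA0 => X Y Y0; field.
by rewrite c0 Y0.
Qed.

Let dq0 : exists r0 : C, forall e : R, 0 < e -> exists2 n, 0 < n &
  forall t : R, 0 < t -> t < n -> normc (r0 - (q t - q 0) / t%:C) < e.
Proof.
have c0 := real_neq0 c_gt0.
have n0 : normc (c%:C * (0 : C)) < r1 by rewrite mulr0 normc0.
have dA0 : PS (deriv_coef A) (c%:C * 0) != 0 by rewrite mulr0; exact: dA_neq0.
have h1 := @is_derive_PS_comp _ r1 (fun v => c%:C * v) _ _ hA n0 (is_derive_lin c%:C 0).
have h2 := @is_derive_PS_comp _ r1 (fun v => c%:C * v) _ _ hA' n0 (is_derive_lin c%:C 0).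
have [l' h3] := @is_derive_inv (fun t => PS (deriv_coef A) (c%:C * t)) 0 _ dA0 h2.
have h4 := is_derive_scale (ka%:C / c%:C) (is_derive_mul h1 h3).
eexists => e e_gt0; have [n n_gt0 hn] := (is_derive_epsP _ _ _).1 h4 e e_gt0.
exists n => // t t0 tn; have := hn t%:C (real_neq0 t0).
rewrite normc_real gtr0_norm // addr0 => /(_ tn).
have -> : q t - q 0 = ka%:C / c%:C * (PS A (c%:C * t%:C) / PS (deriv_coef A) (c%:C * t%:C)) -
    ka%:C / c%:C * (PS A (c%:C * 0) / PS (deriv_coef A) (c%:C * 0)); last by move=> h; exact: h.
have qE x : q x = ka%:C / c%:C * (PS A (c%:C * x%:C) / PS (deriv_coef A) (c%:C * x%:C)).
  rewrite /q rmorphM /= invfM; move: (PS A _) (PS _ _)^-1 (c%:C)^-1 => X Y Z; ring.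
by rewrite !qE.
Qed.

Lemma log_riccati_one_variable : exists k, log_riccati k A /\ log_riccati k B.
Proof.
have [r0 hr0] := dq0; have c0 := real_neq0 c_gt0; have k0 := real_neq0 ka_gt0.
have [n n0 [k qm]] := functional_equation_affine ep_gt0 functional_eq hr0.
exists (1 - r0 / ka%:C); split.
  apply: (@log_riccati_of_ode R r1 A (c%:C * q 0 / ka%:C)) => //.
  exists (Num.min (c * n) r1); first by rewrite lt_min r1_gt0 mulr_gt0.
  move=> x x0; rewrite lt_min => /andP[xn xr].
  have t0 : 0 < x / c by rewrite divr_gt0.
  have tn : x / c < n by rewrite ltr_pdivrMr // mulrC.
  have cx : c * (x / c) = x by rewrite mulrC divfK // gt_eqF.
  have [Q _] := qm _ t0 tn; move: Q; rewrite {1}/q cx.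
  have dA0 := dA_neq0 (ltW x0) xr.
  rewrite rmorphM /= fmorphV /=.
  move: (PS A _) (PS (deriv_coef A) _) (q 0) dA0 => X Y q0 Y0 E.
  apply: (mulfI (mulf_neq0 k0 (invr_neq0 (mulf_neq0 c0 Y0)))).
  rewrite mulrAC E; field.
  by rewrite k0 c0 Y0.
(* Any sequence of distinct positive parameters would do. By thetaE, distinct
   parameters give distinct values of s. *)
pose m0 := Num.min n ep; have m00 : 0 < m0 by rewrite lt_min n0.
pose t i : R := m0 / i.+2%:R.
have ti i : 0 < t i by rewrite divr_gt0.
have tm i : t i < m0 by rewrite ltr_pdivrMr // ltr_pMr // ltr1n.
have [tn te] : (forall i, t i < n) /\ (forall i, normc (t i)%:C < ep).
  split=> i; have := tm i; rewrite lt_min => /andP[] //.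
  by rewrite normc_real gtr0_norm.
have th_gt0 i : 0 < th0 + ka * t i by rewrite addr_gt0 // mulr_gt0.
apply: (@log_riccati_of_zeros R r B e0 (ka%:C * q 0 - k * th0%:C - r0 / ka%:C * th0%:C ^+ 2)
   (k + 2 * r0 * th0%:C / ka%:C) (r0 / ka%:C) (fun i => s (t i)%:C)) => //.
- by rewrite /B b0.
- exact: real_neq0.
- move=> i j /= E; have Ti := thetaE (te i); have Tj := thetaE (te j).
  move: Ti; rewrite E Tj => /(mulIf (B_neq0 (te j))) /addrI /(mulfI k0) /complexI.
  move/(mulfI (lt0r_neq0 m00))/invr_inj/eqP; rewrite eqr_nat => /eqP [] ->.
  by [].
- move=> i; split; last exact: s_le.
  apply/eqP => E; have := thetaE (te i); have := B_neq0 (te i).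
  rewrite E mul0r => B0 /esym/eqP; rewrite mulf_eq0 (negPf B0) orbF.
  by rewrite -rmorphM -rmorphD (negPf (real_neq0 (th_gt0 i))).
move=> i S G G1 G2; have D := dtheta (te i); have d0 := ds_neq0 (te i).
have [_ M] := qm _ (ti i) (tn i); have T := thetaE (te i).
apply: (mulfI d0); rewrite mulrCA D.
have -> : S * (ka%:C * G ^+ 2) = ds (t i)%:C * (ka%:C * m (t i) * G ^+ 2).
  by rewrite /m -/S; field.
rewrite M; congr (_ * _); rewrite -/S -/G1 -/G in T *; rewrite T; field.
exact: k0.
Qed.

End OneVariable.

(** * The kernel identity in several variables *)

Section HermitianSpace.
Variables (R : realType) (d : nat).
Local Notation C := R[i].
Local Notation V := 'rV[C]_d.
Implicit Types (z w p u v : V) (k : C).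

Lemma cdot_sumE z w : cdot z w = \sum_(i < d) z 0 i * (w 0 i)^*.
Proof. by []. Qed.

Lemma cdotDl z w u : cdot (z + w) u = cdot z u + cdot w u.
Proof.
by rewrite !cdot_sumE -big_split; apply: eq_bigr => i _; rewrite mxE mulrDl.
Qed.

Lemma cdotZl k z w : cdot (k *: z) w = k * cdot z w.
Proof. by rewrite !cdot_sumE mulr_sumr; apply: eq_bigr => i _; rewrite mxE mulrA. Qed.

Lemma cdotBl z w u : cdot (z - w) u = cdot z u - cdot w u.
Proof. by rewrite cdotDl -scaleN1r cdotZl mulN1r. Qed.

Lemma cdot_conj z w : (cdot z w)^* = cdot w z.
Proof.
rewrite !cdot_sumE rmorph_sum; apply: eq_bigr => i _ /=.
by rewrite conjcM conjcK mulrC.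
Qed.

Lemma cdotZr k z w : cdot z (k *: w) = k^* * cdot z w.
Proof. by rewrite -cdot_conj cdotZl conjcM cdot_conj. Qed.

Lemma cdotBr z w u : cdot z (w - u) = cdot z w - cdot z u.
Proof. by rewrite -cdot_conj cdotBl conjcB !cdot_conj. Qed.

Lemma cdot0l z : cdot 0 z = 0.
Proof. by rewrite -(scale0r 0) cdotZl mul0r. Qed.

Lemma cdot0r z : cdot z 0 = 0.
Proof. by rewrite -cdot_conj cdot0l rmorph0. Qed.

Lemma mulc_conj k : k * k^* = (normc k ^+ 2)%:C.
Proof. by rewrite -sqr_normc normCE -rmorphXn. Qed.

Lemma cdot_sqnorm z : cdot z z = (sqnorm z)%:C.
Proof.
rewrite /sqnorm; suff -> : cdot z z = (\sum_(i < d) normc (z 0 i) ^+ 2)%:C by [].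
by rewrite cdot_sumE rmorph_sum; apply: eq_bigr => i _; rewrite mulc_conj.
Qed.

Lemma sqnorm_sumE z : sqnorm z = \sum_(i < d) normc (z 0 i) ^+ 2.
Proof.
apply: (@complexI R); rewrite -cdot_sqnorm cdot_sumE rmorph_sum.
by apply: eq_bigr => i _; rewrite mulc_conj.
Qed.

Lemma sqnorm_ge0 z : 0 <= sqnorm z.
Proof. by rewrite sqnorm_sumE sumr_ge0 // => i _; rewrite sqr_ge0. Qed.

Lemma sqnorm0 : sqnorm (0 : V) = 0.
Proof. by apply: (@complexI R); rewrite -cdot_sqnorm cdot0l. Qed.

Lemma sqnorm_eq0 z : (sqnorm z == 0) = (z == 0).
Proof.
apply/idP/idP => [|/eqP ->]; last by rewrite sqnorm0.
rewrite sqnorm_sumE psumr_eq0 => [/allP h|i _]; last by rewrite sqr_ge0.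
apply/eqP/rowP => i; rewrite mxE; apply: eq0_normc; apply/eqP.
by have := h i (mem_index_enum i); rewrite sqrf_eq0.
Qed.

Lemma sqnorm_gt0 z : (0 < sqnorm z) = (z != 0).
Proof. by rewrite lt_def sqnorm_eq0 sqnorm_ge0 andbT. Qed.

Lemma sqnormZ k z : sqnorm (k *: z) = normc k ^+ 2 * sqnorm z.
Proof.
by apply: (@complexI R); rewrite -cdot_sqnorm cdotZl cdotZr mulrA mulc_conj
  cdot_sqnorm [RHS]rmorphM.
Qed.

Lemma cdot_CauchySchwarz z w : normc (cdot z w) ^+ 2 <= sqnorm z * sqnorm w.
Proof.
have [->|w0] := eqVneq w 0; first by rewrite cdot0r normc0 sqnorm0 expr0n mulr0.
have s0 : 0 < sqnorm w by rewrite sqnorm_gt0.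
have := sqnorm_ge0 ((sqnorm w)%:C *: z - cdot z w *: w).
have -> : sqnorm ((sqnorm w)%:C *: z - cdot z w *: w) =
    sqnorm w * (sqnorm z * sqnorm w - normc (cdot z w) ^+ 2).
  apply: (@complexI R); rewrite -[LHS]cdot_sqnorm !cdotBl !cdotBr !cdotZl !cdotZr.
  have -> : (sqnorm w * (sqnorm z * sqnorm w - normc (cdot z w) ^+ 2))%:C =
    (sqnorm w)%:C * ((sqnorm z)%:C * (sqnorm w)%:C - (normc (cdot z w) ^+ 2)%:C).
    by rewrite rmorphM rmorphB rmorphM.
  rewrite -mulc_conj cdot_conj conjc_real !cdot_sqnorm; ring.
by rewrite pmulr_rge0 // subr_ge0.
Qed.

Lemma normc_cdot_le z w (e : R) : 0 <= e -> sqnorm z <= e -> sqnorm w <= e ->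
  normc (cdot z w) <= e.
Proof.
move=> e0 ze we; rewrite -(@ler_pXn2r _ 2) ?nnegrE ?normc_ge0 //.
apply: le_trans (cdot_CauchySchwarz z w) _; rewrite expr2.
by apply: ler_pM => //; apply: sqnorm_ge0.
Qed.

Lemma cdot_delta z i (t : C) : cdot z (t^* *: delta_mx 0 i) = z 0 i * t.
Proof.
rewrite cdotZr conjcK cdot_sumE (bigD1 i) //= mxE !eqxx rmorph1 mulr1 big1 => [|j ji].
  by rewrite addr0 mulrC.
by rewrite mxE (negPf ji) andbF rmorph0 mulr0.
Qed.

Lemma sqnorm_delta i : sqnorm (delta_mx 0 i : V) = 1.
Proof.
apply: (@complexI R); rewrite -cdot_sqnorm.
by have := cdot_delta (delta_mx 0 i) i 1; rewrite rmorph1 scale1r mxE !eqxx mulr1.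
Qed.

End HermitianSpace.

Section SeveralVariables.
Variables (R : realType) (d : nat).
Local Notation C := R[i].
Local Notation V := 'rV[C]_d.
Implicit Types (z w u v : V).
(** The kernel identity near the origin. The constant [e0], smaller than the
    radius [r], bounds the squared norm of [ph] near the origin, so that [B] and
    its derivatives can be evaluated at inner products of values of [ph]. *)
Variables (a b : nat -> R) (r1 r e0 del : R) (la : V -> C) (ph : V -> V).
Let A n := (a n)%:C.
Let B n := (b n)%:C.
Hypotheses (d_gt0 : (0 < d)%N) (r1_gt0 : 0 < r1) (hA : has_radius A r1) (hB : has_radius B r).
Hypotheses (e0_gt0 : 0 < e0) (e0r : e0 < r).
Hypotheses (a0 : a 0%N = 1) (a_gt0 : forall n, 0 < a n).
Hypotheses (b0 : b 0%N = 1) (b_gt0 : forall n, 0 < b n).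
Hypotheses (del_gt0 : 0 < del) (del_r1 : del <= r1).
Hypothesis A_neq0 : forall x, normc x < del -> PS A x != 0.
Hypothesis ph_le : forall z, sqnorm z < del -> sqnorm (ph z) <= e0.
Hypothesis kernelE : forall z w, sqnorm z < del -> sqnorm w < del ->
  PS A (cdot z w) = la z * (la w)^* * PS B (cdot (ph z) (ph w)).
Hypothesis dla : forall (v : V) (t : C), sqnorm (t *: v) < del ->
  exists l : C, is_derive t (1 : C) (fun t : C => la (t *: v)) l.
Hypothesis dph : forall (v : V) k (t : C), sqnorm (t *: v) < del ->
  exists l : C, is_derive t (1 : C) (fun t : C => ph (t *: v) 0 k) l.

Let p := ph 0.
Let s z := cdot (ph z) p.
Let h z := PS (deriv_coef B) (s z) / PS B (s z).
Let y z : V := h z *: ph z - h 0 *: p.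
Let hB' := has_radius_deriv hB.

Let small0 : sqnorm (0 : V) < del. Proof. by rewrite sqnorm0. Qed.

Let normc_cdot_lt z w : sqnorm z < del -> sqnorm w < del -> normc (cdot z w) < del.
Proof.
move=> zd wd; apply: (@le_lt_trans _ _ (Num.max (sqnorm z) (sqnorm w))).
  by apply: normc_cdot_le; rewrite ?le_max ?lexx ?orbT // sqnorm_ge0.
by rewrite gt_max zd.
Qed.

Let normc_cdot_ph z w : sqnorm z < del -> sqnorm w < del -> normc (cdot (ph z) (ph w)) < r.
Proof.
by move=> zd wd; apply: le_lt_trans e0r; apply: normc_cdot_le (ltW e0_gt0) _ _; apply: ph_le.
Qed.

Let PSA0 : PS A 0 = 1.
Proof. by rewrite (PS0_radius r1_gt0 hA) /A a0. Qed.

Let PSdA0 : PS (deriv_coef A) 0 = (a 1%N)%:C.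
Proof. by rewrite (PS0_radius r1_gt0 (has_radius_deriv hA)) /deriv_coef mul1r. Qed.

Let kernel0 z : sqnorm z < del -> la z * (la 0)^* * PS B (s z) = 1.
Proof. by move=> zd; rewrite -(kernelE zd small0) cdot0r PSA0. Qed.

Let B_neq0 z : sqnorm z < del -> PS B (s z) != 0.
Proof.
by move=> zd; apply/eqP => E; have /eqP := kernel0 zd; rewrite E mulr0 eq_sym oner_eq0.
Qed.

Let la0_neq0 : (la 0)^* != 0.
Proof. by apply/eqP => E; have /eqP := kernel0 small0; rewrite E mulr0 mul0r eq_sym oner_eq0. Qed.

(** Restrict [w] to the multiples [t^* e_i]: then [<z, w>] is [z_i t], and the
    kernel identity can be differentiated in [t] at the origin. Division by
    [kernel0], and subtraction of the same equation at [z = 0], remove [la] and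
    its derivative. *)
Let gradient i : exists L : V, forall z, sqnorm z < del ->
  (a 1%N)%:C * z 0 i = cdot (y z) L.
Proof.
pose e : V := delta_mx 0 i.
have de0 : sqnorm ((0 : C) *: e) < del by rewrite scale0r.
have [ll hll] := dla de0.
pose lk k : C := 'D_(1 : C) (fun t : C => ph (t *: e) 0 k) (0 : C).
have hlk k : is_derive (0 : C) (1 : C) (fun t : C => ph (t *: e) 0 k) (lk k).
  by have [l [hl _]] := dph k de0; exact: (DeriveDef hl erefl).
pose L : V := \row_k lk k.
have c0 : (0 : C)^* = 0 by rewrite rmorph0.
have hll' : is_derive (0 : C) (1 : C) (fun t : C => (la (t^* *: e))^*) ll^*.
  by apply: (@is_derive_conj _ (fun t : C => la (t *: e))); rewrite c0.
have hlk' k : is_derive (0 : C) (1 : C) (fun t : C => (ph (t^* *: e) 0 k)^*) (lk k)^*.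
  by apply: (@is_derive_conj _ (fun t : C => ph (t *: e) 0 k)); rewrite c0.
have hS z : is_derive (0 : C) (1 : C) (fun t : C => cdot (ph z) (ph (t^* *: e))) (cdot (ph z) L).
  have hs := @is_derive_sum C C C d (fun k t => ph z 0 k * (ph (t^* *: e) 0 k)^*) 0 1
    (fun k => ph z 0 k * (lk k)^*) (fun k => is_derive_scale (ph z 0 k) (hlk' k)).
  have -> : (fun t : C => cdot (ph z) (ph (t^* *: e))) =
     \sum_(k < d) (fun t : C => ph z 0 k * (ph (t^* *: e) 0 k)^*).
    by apply/funext => t; rewrite fct_sumE.
  have -> : cdot (ph z) L = \sum_(k < d) ph z 0 k * (lk k)^* by apply: eq_bigr => k _; rewrite mxE.
  exact: hs.
have key z : sqnorm z < del -> (a 1%N)%:C * z 0 i =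
    la z * (ll^* * PS B (s z) + (la 0)^* * (PS (deriv_coef B) (s z) * cdot (ph z) L)).
  move=> zd.
  have n0 : normc (cdot (ph z) (ph ((0 : C)^* *: e))) < r.
    by rewrite c0 scale0r; apply: normc_cdot_ph.
  have h1 := @is_derive_PS_comp _ _ r (fun t : C => cdot (ph z) (ph (t^* *: e))) _ _ hB n0 (hS z).
  have h2 := is_derive_scale (la z) (is_derive_mul hll' h1).
  have zn0 : normc (z 0 i * (0 : C)) < r1 by rewrite mulr0 normc0.
  have h3 := @is_derive_PS_comp _ _ r1 (fun t : C => z 0 i * t) _ _ hA zn0
    (is_derive_lin (z 0 i) 0).
  have m0 : 0 < Num.min 1 del by rewrite lt_min ltr01.
  have eqn (t : C) : normc (t - 0) < Num.min 1 del ->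
     PS A (z 0 i * t) = la z * ((la (t^* *: e))^* * PS B (cdot (ph z) (ph (t^* *: e)))).
    rewrite subr0 lt_min => /andP[t1 td].
    have td' : sqnorm (t^* *: e) < del.
      rewrite sqnormZ sqnorm_delta mulr1 normc_conj; apply: le_lt_trans td.
      by rewrite expr2 ler_piMl ?normc_ge0 // ltW.
    by rewrite -(cdot_delta z i t) kernelE // mulrA.
  have E := is_derive_unique (is_derive_near m0 eqn h3) h2.
  by move: E; rewrite mulr0 PSdA0 c0 scale0r.
have la_ne z : sqnorm z < del -> la z != 0.
  by move=> zd; apply/eqP => E; have /eqP := kernel0 zd; rewrite E !mul0r eq_sym oner_eq0.
have key2 z : sqnorm z < del ->
    (a 1%N)%:C * z 0 i = ll^* / (la 0)^* + h z * cdot (ph z) L.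
  move=> zd; rewrite key // /h; have := kernel0 zd; have := B_neq0 zd.
  have := la0_neq0; have := la_ne z zd.
  move: (la z) (la 0)^* (PS B (s z)) (PS (deriv_coef B) (s z)) (cdot _ _) ll^*.
  move=> l l0 G G1 X Y l_n l0_n G0 E.
  have -> : l * (Y * G + l0 * (G1 * X)) = (l * l0 * G) * (Y / l0 + G1 / G * X).
    by field; rewrite G0 l0_n.
  by rewrite E mul1r.
exists L => z zd; rewrite key2 // /y cdotBl !cdotZl.
have := key2 0 small0; rewrite mxE mulr0 => /esym/eqP; rewrite addr_eq0 => /eqP ->.
by rewrite addrC.
Qed.

(** The gradients are the columns of [M], up to conjugation. It is invertible
    since its row space contains small multiples of the basis vectors. *)
Let linear_coordinates : exists2 M : 'M[C]_d, M \in unitmx &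
  forall z, sqnorm z < del -> y z *m M = (a 1%N)%:C *: z.
Proof.
pose L i := projT1 (cid (gradient i)).
have hL i z : sqnorm z < del -> (a 1%N)%:C * z 0 i = cdot (y z) (L i).
  by move=> zd; exact: (projT2 (cid (gradient i)) z zd).
pose M : 'M[C]_d := \matrix_(k, i) (L i 0 k)^*.
have yM z : sqnorm z < del -> y z *m M = (a 1%N)%:C *: z.
  move=> zd; apply/rowP => i; rewrite [RHS]mxE hL // cdot_sumE [LHS]mxE.
  by apply: eq_bigr => k _; rewrite [M _ _]mxE.
exists M => //.
pose e : R := Num.min 1 del / 2.
have m0 : 0 < Num.min 1 del by rewrite lt_min ltr01.
have e_gt0 : 0 < e by rewrite /e; lra.
have : e < Num.min 1 del by rewrite /e; lra.
rewrite lt_min => /andP[e1 ed].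
have small i : sqnorm (e%:C *: delta_mx 0 i : V) < del.
  rewrite sqnormZ sqnorm_delta mulr1 normc_real gtr0_norm //.
  by apply: le_lt_trans ed; rewrite expr2 ler_piMl // ltW.
pose Y : 'M[C]_d := \matrix_i y (e%:C *: delta_mx 0 i).
have YM : Y *m M = ((a 1%N)%:C * e%:C)%:M.
  apply/row_matrixP => i; rewrite row_mul rowK yM // scalerA.
  by apply/rowP => j; rewrite !mxE eqxx /= [i == j]eq_sym mulr_natr.
have ae0 : (a 1%N)%:C * e%:C != 0 :> C by rewrite mulf_neq0 // real_neq0.
have : (((a 1%N)%:C * e%:C)^-1 *: Y) *m M = 1%:M.
  by rewrite -scalemxAl YM scale_scalar_mx mulVf.
by move/mulmx1_unit => [].
Qed.

Let dilation k : log_riccati k A -> log_riccati k B ->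
  exists g, 0 < g /\ forall n, a n = b n * g ^+ n.
Proof.
move=> kA kB; exists (a 1%N / b 1%N); split; first by rewrite divr_gt0.
have b1 : B 1%N != 0 by exact: real_neq0.
have a0' : A 0%N = 1 by rewrite /A a0. have b0' : B 0%N = 1 by rewrite /B b0.
move=> n; apply: (@complexI R).
by have := log_riccati_dilation kA kB a0' b0' b1 n; rewrite /A /B rmorphM rmorphXn rmorphM fmorphV.
Qed.

Let solve (M : 'M[C]_d) z u : M \in unitmx -> sqnorm z < del ->
  (forall z, sqnorm z < del -> y z *m M = (a 1%N)%:C *: z) ->
  u *m M = (a 1%N)%:C *: z -> y z = u.
Proof. by move=> uM zd yM uE; rewrite -(mulmxK uM (y z)) yM // -uE mulmxK. Qed.

(** Here [s] vanishes, so that [h] is constant; thus [ph] is linear and [la]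
    constant, and the identity on the diagonal of a line compares two
    dilations. *)
Let fixed_origin : p = 0 -> exists g, 0 < g /\ forall n, a n = b n * g ^+ n.
Proof.
move=> p0; have [M uM yM] := linear_coordinates.
have s0 z : s z = 0 by rewrite /s p0 cdot0r.
have r_gt0 : 0 < r := lt_trans e0_gt0 e0r.
have B0 : PS B 0 = 1 by rewrite (PS0_radius r_gt0 hB) /B b0.
have hz z : h z = (b 1%N)%:C.
  by rewrite /h s0 B0 divr1 (PS0_radius r_gt0 hB') /deriv_coef mul1r.
have b1C : (b 1%N)%:C != 0 :> C by exact: real_neq0.
pose u : V := delta_mx 0 (Ordinal d_gt0).
pose v := u *m M.
have v0 : v != 0.
  apply: contraNneq (oner_neq0 R) => v0; rewrite -(sqnorm_delta R (Ordinal d_gt0)).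
  by rewrite -/u -(mulmxK uM u) -/v v0 mul0mx sqnorm0.
have sv : 0 < sqnorm v by rewrite sqnorm_gt0.
have ph_lin (x : C) : sqnorm (x *: v) < del -> ph (x *: v) = ((a 1%N)%:C / (b 1%N)%:C * x) *: u.
  move=> xd; have yE : y (x *: v) = (b 1%N)%:C *: ph (x *: v).
    by rewrite /y hz p0 scaler0 subr0.
  have := @solve M (x *: v) (((a 1%N)%:C * x) *: u) uM xd yM.
  rewrite -scalemxAl -/v scalerA => /(_ erefl); rewrite yE => E.
  apply: (scalerI b1C); rewrite E scalerA; congr (_ *: _).
  by move: b1C; move: (_%:C) (_%:C) => X Y Y0; field.
have la1 z : sqnorm z < del -> la z = la 0.
  move=> zd; have := kernel0 zd; rewrite -(kernel0 small0) !s0 B0 !mulr1.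
  by move/(mulIf la0_neq0).
have k1 : la 0 * (la 0)^* = 1 by have := kernel0 small0; rewrite s0 B0 mulr1.
pose W := sqnorm v; pose U := (a 1%N / b 1%N) ^+ 2.
have U0 : 0 < U by rewrite exprn_gt0 // divr_gt0.
have main x : 0 < x -> x * W < del -> PS A (x * W)%:C = PS B (x * U)%:C.
  move=> x0 xd; have sd : sqnorm ((Num.sqrt x)%:C *: v) < del.
    by rewrite sqnormZ normc_real ger0_norm ?sqrtr_ge0 // sqr_sqrtr // ltW.
  have sq : normc (Num.sqrt x)%:C ^+ 2 = x.
    by rewrite normc_real ger0_norm ?sqrtr_ge0 // sqr_sqrtr // ltW.
  have := kernelE sd sd; rewrite (la1 _ sd) k1 mul1r !cdot_sqnorm (ph_lin _ sd) !sqnormZ sq.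
  have nU : normc ((a 1%N)%:C / (b 1%N)%:C) ^+ 2 = U.
    by rewrite normcM normcV !normc_real !gtr0_norm.
  by rewrite sqnorm_delta mulr1 normcM exprMn sq nU [U * x]mulrC.
have E : (fun n => A n * W%:C ^+ n) =1 (fun n => B n * U%:C ^+ n).
  pose r' := Num.min (r1 / W) (r / U).
  have r'0 : 0 < r' by rewrite lt_min !divr_gt0 // (lt_trans e0_gt0).
  apply: (@PS_eq_near0 R r') => //.
  - by apply: has_radius_le (has_radius_rescale sv hA) _; rewrite ge_min lexx.
  - by apply: has_radius_le (has_radius_rescale U0 hB) _; rewrite ge_min lexx orbT.
  exists (del / W); first by rewrite divr_gt0.
  move=> x x0 xW.
  have ratio (k : R) : 0 < k -> (x * k)%:C / k%:C = x%:C.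
    by move=> k_gt0; rewrite rmorphM mulfK // real_neq0.
  have EA := @PS_rescale R A (x * W)%:C W (lt0r_neq0 sv).
  have EB := @PS_rescale R B (x * U)%:C U (lt0r_neq0 U0).
  rewrite (ratio _ sv) in EA; rewrite (ratio _ U0) in EB.
  have xW' : x * W < del by rewrite -ltr_pdivlMr.
  exact: (etrans EA (etrans (main x x0 xW') (esym EB))).
exists (U / W); split; first by rewrite divr_gt0.
move=> n; apply: (@complexI R); have := E n; rewrite /A /B => En.
have Wn : W%:C ^+ n != 0 by rewrite expf_neq0 // real_neq0.
have quot : ((U / W) ^+ n)%:C = U%:C ^+ n / W%:C ^+ n.
  by rewrite expr_div_n rmorphM fmorphV !rmorphXn.
by apply: (mulIf Wn); rewrite En [(b n * _)%:C]realcM quot mulrA divfK.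
Qed.

(** The equation for [y] at [z = t *: (p *m M)] reads
    [h z *: ph z = (h 0 + a 1 * t) *: p], so that this line is mapped into the
    line through [p]; taking inner products with [p] gives the affine equation
    for [s * h]. *)
Let moved_origin : p != 0 -> exists g, 0 < g /\ forall n, a n = b n * g ^+ n.
Proof.
move=> p0; have [M uM yM] := linear_coordinates.
pose rho := sqnorm p.
have rho0 : 0 < rho by rewrite sqnorm_gt0.
have rho_r : rho < r by apply: le_lt_trans e0r; apply: ph_le.
pose e := p *m M.
have e_neq0 : e != 0.
  by apply: contraNneq p0 => e0'; rewrite -(mulmxK uM p) -/e e0' mul0mx.
pose c := sqnorm e; have c0 : 0 < c by rewrite sqnorm_gt0.
have [y0 y0_ge y0E] := PS_pos hB (fun n => ltW (b_gt0 n)) (b_gt0 0%N) (ltW rho0) rho_r.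
have y0_gt0 : 0 < y0 := lt_le_trans (b_gt0 0%N) y0_ge.
have hBr : has_radius (fun n => (n.+1%:R * b n.+1)%:C) r.
  by move: hB'; rewrite /B (funext (deriv_coef_real b)).
have db_gt0 n : 0 < n.+1%:R * b n.+1 by rewrite mulr_gt0.
have [y1 y1_ge y1E] := PS_pos hBr (fun n => ltW (db_gt0 n)) (db_gt0 0%N) (ltW rho0) rho_r.
have y1_gt0 : 0 < y1 := lt_le_trans (db_gt0 0%N) y1_ge.
pose h0 := y1 / y0; have h0_gt0 : 0 < h0 by rewrite divr_gt0.
have h0E : h 0 = h0%:C.
  by rewrite /h /s -/p cdot_sqnorm -/rho y0E /B (funext (deriv_coef_real b)) y1E rmorphM fmorphV.
pose ep := Num.min (Num.min 1 (del / c)) (h0 / a 1%N).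
have ep0 : 0 < ep by rewrite !lt_min ltr01 !divr_gt0.
have te t : normc t < ep -> sqnorm (t *: e) < del /\ h0%:C + (a 1%N)%:C * t != 0.
  rewrite !lt_min => /andP[/andP[t1 tc] th]; split.
    rewrite sqnormZ -ltr_pdivlMr //; apply: le_lt_trans tc.
    by rewrite expr2 ler_piMl ?normc_ge0 // ltW.
  apply/eqP => /eqP; rewrite addrC addr_eq0 => /eqP /(congr1 (@normc R)).
  rewrite normcN normcM !normc_real !gtr0_norm // => E.
  by move: th; rewrite ltr_pdivlMr // mulrC E ltxx.
pose s1 (t : C) : C := s (t *: e).
have phE t : normc t < ep -> ph (t *: e) = (s1 t / rho%:C) *: p /\
    h (t *: e) * s1 t = (h0%:C + (a 1%N)%:C * t) * rho%:C.
  move=> tn; have [td tne] := te t tn.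
  have := @solve M (t *: e) (((a 1%N)%:C * t) *: p) uM td yM.
  rewrite -scalemxAl -/e scalerA => /(_ erefl); rewrite /y h0E => /eqP.
  rewrite subr_eq -scalerDl [_ * t + _]addrC => /eqP E.
  have hs : h (t *: e) * s1 t = (h0%:C + (a 1%N)%:C * t) * rho%:C.
    by rewrite /s1 /s -cdotZl E cdotZl cdot_sqnorm.
  split => //.
  have h_ne : h (t *: e) != 0.
    apply/eqP => hz; move: E; rewrite hz scale0r => /esym/eqP.
    by rewrite scaler_eq0 (negPf tne) (negPf p0).
  apply: (scalerI h_ne); rewrite E scalerA; congr (_ *: _).
  by rewrite mulrA hs mulfK // real_neq0.
have ssE (t u : C) : normc t < ep -> normc u < ep ->
    cdot (ph (t *: e)) (ph (u *: e)) = (s1 u)^* / rho%:C * s1 t.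
  move=> tn un; have [-> _] := phE t tn; have [-> _] := phE u un.
  rewrite cdotZl cdotZr cdot_sqnorm -/rho conjcM conjc_inv conjc_real.
  have := real_neq0 rho0; move: (rho%:C) (s1 t) (s1 u)^* => X Y Z X0; field.
  exact: X0.
have zzE (t u : C) : cdot (t *: e) (u *: e) = c%:C * u^* * t.
  by rewrite cdotZl cdotZr cdot_sqnorm -/c; ring.
have ds1 t : normc t < ep -> exists d : C, is_derive t (1 : C) s1 d.
  move=> tn; have [td _] := te t tn.
  pose lk k : C := 'D_(1 : C) (fun t : C => ph (t *: e) 0 k) t.
  have hlk k : is_derive t (1 : C) (fun t : C => ph (t *: e) 0 k) (lk k).
    by have [l [hl _]] := dph k td; exact: (DeriveDef hl erefl).
  have hs := @is_derive_sum C C C d (fun k t => (p 0 k)^* * ph (t *: e) 0 k) t 1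
    (fun k => (p 0 k)^* * lk k) (fun k => is_derive_scale (p 0 k)^* (hlk k)).
  exists (\sum_(k < d) (p 0 k)^* * lk k).
  have -> : s1 = \sum_(k < d) (fun t : C => (p 0 k)^* * ph (t *: e) 0 k).
    apply/funext => x; rewrite fct_sumE /s1 /s cdot_sumE.
    by apply: eq_bigr => k _; rewrite mulrC.
  exact: hs.
have [k [kA kB]] : exists k, log_riccati k A /\ log_riccati k B.
  apply: (@log_riccati_one_variable R a b r1 r e0 c rho (h0 * rho) (a 1%N * rho) ep
    s1 (fun t => la (t *: e))) => //.
  - by rewrite mulr_gt0.
  - by rewrite mulr_gt0.
  - by move=> t tn; have [td _] := te t tn; apply: dla.
  - move=> t tn; have [td _] := te t tn; rewrite /s1 /s.
    by apply: normc_cdot_le (ltW e0_gt0) _ _; apply: ph_le.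
  - move=> t u tn un; have [td _] := te t tn; have [ud _] := te u un.
    by rewrite -(ssE t u tn un); apply: normc_cdot_ph.
  - move=> t u tn un; have [td _] := te t tn; have [ud _] := te u un.
    by rewrite -(zzE t u); apply: lt_le_trans del_r1; apply: normc_cdot_lt.
  - move=> t u tn un; have [td _] := te t tn; have [ud _] := te u un.
    by rewrite -(zzE t u); apply: A_neq0; apply: normc_cdot_lt.
  - by rewrite /s1 scale0r /s cdot_sqnorm.
  - move=> t u tn un; have [td _] := te t tn; have [ud _] := te u un.
    by rewrite -(zzE t u) -(ssE t u tn un) (kernelE td ud) mulrA.
  move=> t tn; have [td _] := te t tn; have [_ hs] := phE t tn.
  have Bn := B_neq0 td; move: hs; rewrite /h -/(s1 t) => hs.
  have -> : s1 t * PS (deriv_coef B) (s1 t) =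
     (PS (deriv_coef B) (s1 t) / PS B (s1 t) * s1 t) * PS B (s1 t).
    by move: Bn; rewrite -/(s1 t) => Bn; rewrite mulrAC divfK // mulrC.
  by rewrite hs !rmorphM /=; congr (_ * _); ring.
exact: dilation kA kB.
Qed.

Lemma dilation_of_local_kernel_identity : exists g, 0 < g /\ forall n, a n = b n * g ^+ n.
Proof. by have [/fixed_origin|/moved_origin] := eqVneq p 0. Qed.

End SeveralVariables.

(** * Inner products *)

Section Dot.
Variables (R : realType) (X : Type) (H : hilbert_function_space R X).
Local Notation C := R[i].
Local Notation dot := (hfs_dot H).
Implicit Types (f g h : H) (k : C).

Lemma dotDl f g h : dot (f + g) h = dot f h + dot g h.
Proof. exact: linearDl. Qed.

Lemma dotZl k f g : dot (k *: f) g = k * dot f g.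
Proof. exact: linearZl_LR. Qed.

Lemma dot_conj f g : (dot f g)^* = dot g f.
Proof. by rewrite (hermC dot g f) expr0 mul1r. Qed.

Lemma dotBl f g h : dot (f - g) h = dot f h - dot g h.
Proof. by rewrite dotDl -scaleN1r dotZl mulN1r. Qed.

Lemma dotDr f g h : dot h (f + g) = dot h f + dot h g.
Proof. by rewrite -dot_conj dotDl conjcD !dot_conj. Qed.

Lemma dotZr k f g : dot f (k *: g) = k^* * dot f g.
Proof. by rewrite -dot_conj dotZl conjcM dot_conj. Qed.

Lemma dotBr f g h : dot h (f - g) = dot h f - dot h g.
Proof. by rewrite -dot_conj dotBl conjcB !dot_conj. Qed.

Lemma dot0l f : dot 0 f = 0.
Proof. by rewrite -(scale0r (0 : H)) dotZl mul0r. Qed.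

Lemma dot0r f : dot f 0 = 0.
Proof. by rewrite -dot_conj dot0l rmorph0. Qed.

Definition hnorm f : R := complex.Re `|f|.

Lemma hnormE f : `|f| = (hnorm f)%:C.
Proof. by rewrite RRe_real // ger0_real. Qed.

Lemma hnorm_ge0 f : 0 <= hnorm f.
Proof. by rewrite -ler0c -hnormE. Qed.

Lemma dot_hnorm f : dot f f = (hnorm f ^+ 2)%:C.
Proof. by rewrite hfs_dotE hnormE -rmorphXn. Qed.

Lemma hnorm_eq0 f : hnorm f = 0 -> f = 0.
Proof. by move=> h; apply/eqP; rewrite -normr_eq0 hnormE h. Qed.

Lemma hnormD_le f g : hnorm (f + g) <= hnorm f + hnorm g.
Proof. by rewrite -lecR -hnormE rmorphD /= -!hnormE ler_normD. Qed.

Lemma dot_CauchySchwarz f g : normc (dot f g) ^+ 2 <= hnorm f ^+ 2 * hnorm g ^+ 2.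
Proof.
have [->|g0] := eqVneq g 0.
  by rewrite dot0r normc0 expr0n /= mulr_ge0 ?sqr_ge0.
have s0 : 0 < hnorm g ^+ 2.
  rewrite exprn_gt0 // lt_def hnorm_ge0 andbT; apply/eqP => /hnorm_eq0/eqP.
  by rewrite (negPf g0).
have := sqr_ge0 (hnorm ((hnorm g ^+ 2)%:C *: f - dot f g *: g)).
have -> : hnorm ((hnorm g ^+ 2)%:C *: f - dot f g *: g) ^+ 2 =
    hnorm g ^+ 2 * (hnorm f ^+ 2 * hnorm g ^+ 2 - normc (dot f g) ^+ 2).
  apply: (@complexI R); rewrite -[LHS]dot_hnorm !dotBl !dotBr !dotZl !dotZr.
  have -> : (hnorm g ^+ 2 * (hnorm f ^+ 2 * hnorm g ^+ 2 - normc (dot f g) ^+ 2))%:C =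
    (hnorm g ^+ 2)%:C * ((hnorm f ^+ 2)%:C * (hnorm g ^+ 2)%:C - (normc (dot f g) ^+ 2)%:C).
    by rewrite [LHS]realcM rmorphB; congr (_ * (_ - _)); exact: realcM.
  rewrite -mulc_conj dot_conj conjc_real !dot_hnorm; ring.
by rewrite pmulr_rge0 // subr_ge0.
Qed.

Lemma dot_CauchySchwarz_norm f g : normc (dot f g) <= hnorm f * hnorm g.
Proof.
rewrite -(@ler_pXn2r _ 2) ?nnegrE ?normc_ge0 ?mulr_ge0 ?hnorm_ge0 // exprMn.
exact: dot_CauchySchwarz.
Qed.

End Dot.

(** * Minimum modulus by averaging over four points *)

Section FourPoints.
Variable R : realType.
Local Notation C := R[i].
Implicit Types (mu : C -> C) (t : C).

Lemma derivative_at_minimum mu l (n : R) : is_derive (0 : C) (1 : C) mu l -> mu 0 = 1 ->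
  0 < n -> (forall t, normc t < n -> 1 <= normc (mu t)) -> l = 0.
Proof.
move=> hmu m0 n0 ge1; apply/eqP/negPn/negP => l0.
have nl : 0 < normc l by rewrite normc_gt0.
have e0 : 0 < normc l / 2 by rewrite divr_gt0.
have [n' n'0 hn] := (is_derive_epsP _ _ _).1 hmu _ e0.
pose m := Num.min (Num.min n n') (normc l)^-1; have mm : 0 < m by rewrite !lt_min n0 n'0 invr_gt0.
have : m / 2 < m by lra.
have : 0 < m / 2 by lra.
move: (m / 2) => x x0; rewrite /m !lt_min => /andP[/andP[xn xn'] xl].
(* the direction of steepest descent of the modulus *)
pose t : C := - (x%:C * l^* / (normc l)%:C).
have tn : normc t = x.
  rewrite normcN normcM normcM normc_conj normcV !normc_real (gtr0_norm x0) gtr0_norm //.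
  by rewrite mulfK // gt_eqF.
have t0 : t != 0 by rewrite -normc_gt0 tn.
have tl : t * l = - (x * normc l)%:C.
  rewrite /t mulNr; congr (- _); rewrite realcM.
  have -> : x%:C * l^* / (normc l)%:C * l = x%:C / (normc l)%:C * (l * l^*) by ring.
  rewrite mulc_conj expr2 realcM; have := real_neq0 nl; move: (x%:C) (_%:C) => A B B0.
  by field.
have := hn t t0; rewrite tn addr0 m0 => /(_ xn').
have := ge1 t; rewrite tn => /(_ xn) g1 h1.
have E : mu t = (1 - x * normc l)%:C - (l - (mu t - 1) / t) * t.
  rewrite mulrBl divfK // [l * t]mulrC tl rmorphB rmorph1 /=; ring.
have : normc (mu t) <= (1 - x * normc l) + normc l / 2 * x.
  rewrite E; apply: le_trans (le_normcD _ _) _; apply: lerD.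
    rewrite normc_real ger0_norm // subr_ge0 -ler_pdivlMr // mul1r; exact: ltW.
  by rewrite normcN normcM tn ler_wpM2r ?(ltW x0) // ltW.
have : 0 < x * normc l by rewrite mulr_gt0.
by move: g1; move: (normc (mu t)) (normc l) => A B; nra.
Qed.

(** The derivative at the minimum vanishes, so that [|mu t - 1|^2] is negligible
    with respect to [|t|^2], and the lower bound on [|mu t|^2] becomes one of order
    [|t|^2] on the real part of [mu t - 1]. The sum over four points would then be
    of order [|t|^2] as well. *)
Lemma four_point_contradiction mu l (al K n : R) : 0 < al -> 0 < n ->
  is_derive (0 : C) (1 : C) mu l -> mu 0 = 1 ->
  (forall t, normc t < n -> 1 + al * normc t ^+ 2 <= normc (mu t) ^+ 2) ->
  (forall x : R, 0 < x -> x < n ->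
     normc (mu x%:C + mu ('i * x%:C) + mu (- x%:C) + mu (- 'i * x%:C) - 4) <= K * x ^+ 3) ->
  False.
Proof.
move=> al0 n0 hmu m0 ge1 four.
have l0 : l = 0.
  apply: (derivative_at_minimum hmu m0 n0) => t /ge1 h.
  rewrite -(@ler_pXn2r _ 2) ?nnegrE ?normc_ge0 // expr1n; apply: le_trans h.
  by rewrite lerDl mulr_ge0 ?sqr_ge0 // ltW.
pose e := Num.min 1 (al / 2) / 2.
have me : 0 < Num.min 1 (al / 2) by rewrite lt_min ltr01 divr_gt0.
have e0 : 0 < e by rewrite /e; lra.
have : e < Num.min 1 (al / 2) by rewrite /e; lra.
rewrite lt_min => /andP[e1 eal].
have e2 : e ^+ 2 <= al / 2 by apply: le_trans (ltW eal); rewrite expr2 ler_piMl // ltW.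
have [n' n'0 hn] := (is_derive_epsP _ _ _).1 hmu e e0.
have near0 t : t != 0 -> normc t < n' -> normc (mu t - 1) ^+ 2 <= al / 2 * normc t ^+ 2.
  move=> t0 tn'; have := hn t t0 tn'; rewrite l0 sub0r normcN addr0 m0 normcM normcV => h.
  have tt : 0 < normc t by rewrite normc_gt0.
  have h2 : normc (mu t - 1) <= e * normc t by rewrite -ler_pdivrMr // ltW.
  apply: le_trans (ler_sqr_nneg (normc_ge0 _) h2) _.
  by rewrite exprMn ler_wpM2r ?sqr_ge0.
have inorm : normc ('i : C) = 1 := normc_i R.
pose KK := `|K| + 1; have KK0 : 0 < KK by rewrite ltr_wpDl.
have m0' : 0 < Num.min (Num.min n n') (al / KK) by rewrite !lt_min n0 n'0 divr_gt0.
pose x := Num.min (Num.min n n') (al / KK) / 2.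
have x0 : 0 < x by rewrite /x; lra.
have : x < Num.min (Num.min n n') (al / KK) by rewrite /x; lra.
rewrite !lt_min => /andP[/andP[xn xn'] xK]; clearbody x.
have sq t : normc (mu t) ^+ 2 = 1 + 2 * complex.Re (mu t - 1) + normc (mu t - 1) ^+ 2.
  by rewrite !normc_sqr; case: (mu t) => A B /=; ring.
have bound t : normc t = x -> al / 2 * x ^+ 2 <= 2 * complex.Re (mu t - 1).
  move=> tx; have t0 : t != 0 by rewrite -normc_gt0 tx.
  have := ge1 t; rewrite tx => /(_ xn); rewrite sq.
  have := near0 t t0; rewrite tx => /(_ xn').
  by move: (normc _ ^+ 2) (complex.Re _) (x ^+ 2) => A B D; lra.
have b1 := bound x%:C; have b2 := bound ('i * x%:C).
have b3 := bound (- x%:C); have b4 := bound (- 'i * x%:C).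
move: b1 b2 b3 b4; rewrite !normcM !normcN inorm mul1r normc_real gtr0_norm //.
move=> /(_ erefl) b1 /(_ erefl) b2 /(_ erefl) b3 /(_ erefl) b4.
have := four x x0 xn.
set S := _ - 4.
have SE : S = (mu x%:C - 1) + (mu ('i * x%:C) - 1) + (mu (- x%:C) - 1) + (mu (- 'i * x%:C) - 1).
  by rewrite /S; ring.
have ReS : complex.Re S = complex.Re (mu x%:C - 1) + complex.Re (mu ('i * x%:C) - 1) +
    complex.Re (mu (- x%:C) - 1) + complex.Re (mu (- 'i * x%:C) - 1).
  have ReD (A B : C) : complex.Re (A + B) = complex.Re A + complex.Re B.
    by case: A => ? ?; case: B.
  by rewrite SE (ReD _ (mu (- 'i * x%:C) - 1)) (ReD _ (mu (- x%:C) - 1)) (ReD (mu x%:C - 1)).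
have nS : complex.Re S <= normc S.
  apply: le_trans (ler_norm _) _.
  by rewrite -lecR -normCE normc_ge_Re.
have x3 : K * x ^+ 3 < al * x ^+ 2.
  have -> : K * x ^+ 3 = K * x * x ^+ 2 by ring.
  rewrite ltr_pM2r ?exprn_gt0 //; apply: le_lt_trans (_ : KK * x < _).
    by rewrite ler_pM2r // /KK; have := ler_norm K; lra.
  by move: xK; rewrite ltr_pdivlMr // mulrC.
move: b1 b2 b3 b4 nS x3; rewrite ReS.
move: (complex.Re _) (complex.Re _) (complex.Re _) (complex.Re _) (normc S) (K * _).
by move=> A B D E F G; lra.
Qed.

(** The linear and the quadratic terms cancel in the sum over the fourth roots of
    unity. *)
Lemma PS_four_points (c : nat -> C) (r : R) : 0 < r -> has_radius c r ->
  exists2 K : R, 0 <= K & forall y, normc y < r / 2 ->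
   normc (PS c y + PS c ('i * y) + PS c (- y) + PS c (- 'i * y) - 4 * c 0%N) <= K * normc y ^+ 3.
Proof.
move=> r0 hc; have [] : 0 < r / 4 * 3 /\ r / 4 * 3 < r by lra.
set s := r / 4 * 3 => s0 sr; have hs := hc s s0 sr.
have h3 := coef_bounded_shift s0 3 hs.
have [M hM] := h3.
have M0 : 0 <= M by apply: le_trans (hM 0%N); rewrite expr0 mulr1 normc_ge0.
exists (4 * (M * 3)); first by rewrite !mulr_ge0.
move=> y yr.
have inorm : normc ('i : C) = 1 := normc_i R.
have tail z : normc z = normc y ->
    normc (z ^+ 3 * PS (fun k => c (3 + k)%N) z) <= (M * 3) * normc y ^+ 3.
  move=> zy; rewrite normcM normcX zy mulrC ler_wpM2r ?exprn_ge0 ?normc_ge0 //.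
  have zs : normc z < s by rewrite zy /s; lra.
  have [_ h] := PS_dominated s0 hM zs; apply: le_trans h _.
  rewrite ler_wpM2l // invf_ple ?posrE; last by lra.
    rewrite lerBrDr -lerBrDl zy ler_pdivrMr // /s; lra.
  by rewrite subr_gt0 ltr_pdivrMr // mul1r.
have E z : normc z = normc y ->
    PS c z = c 0%N + c 1%N * z + c 2%N * z ^+ 2 + z ^+ 3 * PS (fun k => c (3 + k)%N) z.
  move=> zy; have zs : normc z < s by rewrite zy /s; lra.
  rewrite (PS_split 3 s0 hs zs); congr (_ + _).
  by rewrite !big_nat_recr //= big_geq // add0r expr0 mulr1 expr1.
have n2 : normc ('i * y) = normc y by rewrite normcM inorm mul1r.
have n3 : normc (- y) = normc y by rewrite normcN.
have n4 : normc (- 'i * y) = normc y by rewrite normcM normcN inorm mul1r.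
have t1 := tail y erefl; have t2 := tail _ n2; have t3 := tail _ n3; have t4 := tail _ n4.
rewrite (E y) // (E _ n2) (E _ n3) (E _ n4).
move: t1 t2 t3 t4.
set A := y ^+ 3 * _; set B := ('i * y) ^+ 3 * _.
set D := (- y) ^+ 3 * _; set F := (- 'i * y) ^+ 3 * _.
move=> t1 t2 t3 t4.
have -> : c 0%N + c 1%N * y + c 2%N * y ^+ 2 + A +
   (c 0%N + c 1%N * ('i * y) + c 2%N * ('i * y) ^+ 2 + B) +
   (c 0%N + c 1%N * - y + c 2%N * (- y) ^+ 2 + D) +
   (c 0%N + c 1%N * (- 'i * y) + c 2%N * (- 'i * y) ^+ 2 + F)
   - 4 * c 0%N = A + B + D + F.
  have -> : ('i * y) ^+ 2 = - y ^+ 2 by rewrite exprMn sqr_i mulN1r.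
  have -> : (- 'i * y) ^+ 2 = - y ^+ 2 by rewrite exprMn sqrrN sqr_i mulN1r.
  ring.
have d1 := le_normcD (A + B + D) F; have d2 := le_normcD (A + B) D; have d3 := le_normcD A B.
rewrite -[4 * (M * 3) * _]mulrA; move: t1 t2 t3 t4 d1 d2 d3 {E h3}; clearbody A B D F.
by move: (M * 3 * _) => Z; lra.
Qed.

End FourPoints.

(** * Weighted Hardy spaces *)

Section Domains.
Variables (R : realType) (d : nat).
Local Notation C := R[i].
Implicit Types (a : nat -> R) (r : R) (z : 'rV[C]_d).

Lemma conv_radius_has_radius a r : (r%:E <= conv_radius a)%E ->
  has_radius (fun n => (a n)%:C) r.
Proof.
move=> ra s s0 sr.
have : (s%:E < conv_radius a)%E by apply: lt_le_trans ra; rewrite lte_fin.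
move=> /ereal_sup_gt[_ [t /= ct <-]]; rewrite lte_fin => st.
have t0 : 0 < `|t| := lt_trans s0 st.
have [M hM] : exists M, forall n, `|a n * t ^+ n| <= M.
  have /cvg_seq_bounded := cvgP _ (cvg_series_cvg_0 ct).
  case=> M [_ hM]; exists (M + 1) => n; apply: (hM (M + 1)) => //; by rewrite ltrDl.
apply: (coef_bounded_le s0 (ltW st)); exists M => n.
by rewrite normc_real -normrX -normrM.
Qed.

Lemma conv_radius_gt0 a : (0 < conv_radius a)%E ->
  exists2 r : R, 0 < r & (r%:E <= conv_radius a)%E.
Proof.
case: (conv_radius a) => [x| |//]; last by exists 1; rewrite ?leey.
by rewrite lte_fin => x0; exists x.
Qed.

Lemma natural_domain_small a z : ((sqnorm z)%:E < conv_radius a)%E -> natural_domain d a z.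
Proof.
move=> za; rewrite /natural_domain; case: ifP => // _; case: ifP => _ //.
exact: ltW.
Qed.

Lemma natural_domain_le a z : natural_domain d a z -> ((sqnorm z)%:E <= conv_radius a)%E.
Proof.
rewrite /natural_domain; case: ifP => [/eqP ->|_]; first by rewrite leey.
by case: ifP => _ //; apply: ltW.
Qed.

End Domains.

Section WeightedHardyTheory.
Variables (R : realType) (d : nat) (a : nat -> R).
Local Notation C := R[i].
Local Notation X := (natural_domain d a).
Variable H : hilbert_function_space R X.
Hypothesis hH : weighted_hardy H.
Let A n := (a n)%:C.

Lemma kernel_vectors : exists k : X -> H,
  [/\ forall f w, hfs_fun H f w = hfs_dot H f (k w),
      forall z w, hfs_dot H (k w) (k z) = PS A (cdot (val z) (val w))
    & forall z w : X, series (fun n => A n * cdot (val z) (val w) ^+ n) @ \oo -->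
        PS A (cdot (val z) (val w))].
Proof.
have [K rK lK] := wh_kernel hH.
pose k w := projT1 (cid (rK w)).
have kE w : (forall z, hfs_fun H (k w) z = K z w) /\
    (forall f : H, hfs_fun H f w = hfs_dot H f (k w)) := projT2 (cid (rK w)).
have PSK z w : PS A (cdot (val z) (val w)) = K z w by apply: PS_eq; exact: lK.
exists k; split=> [f w|z w|z w]; first by have [_ ->] := kE w.
  by have [_ <-] := kE z; have [-> _] := kE w; rewrite PSK.
by rewrite PSK; exact: lK.
Qed.

Lemma constant_function : exists f : H, forall z, hfs_fun H f z = 1.
Proof.
have [e [he _ _ _ _]] := wh_monomials hH.
by exists (e [ffun=> 0%N]) => z; rewrite he /monomial big1 // => i _; rewrite ffunE.
Qed.

Lemma coordinate_function i : exists f : H, forall z, hfs_fun H f z = val z 0 i.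
Proof.
have [e [he _ _ _ _]] := wh_monomials hH.
exists (e [ffun j => (j == i : nat)]) => z; rewrite he /monomial (bigD1 i) //=.
rewrite ffunE eqxx expr1 big1 ?mulr1 // => j /negPf ji.
by rewrite ffunE ji.
Qed.

Lemma extension_derivable (f : H) : exists F : 'rV[C]_d -> C,
  (forall x : X, F (val x) = hfs_fun H f x) /\
  (forall z, ((sqnorm z)%:E < conv_radius a)%E -> differentiable F z).
Proof. by have [F [FE FD _]] := wh_holomorphic hH f; exists F; split. Qed.

End WeightedHardyTheory.

Section Lines.
Variables (R : realType) (d : nat).
Local Notation C := R[i].

Lemma cvg_ord_sum (U : Type) (F : set_system U) {FF : Filter F} n
    (f : 'I_n -> U -> R) (l : 'I_n -> R) : (forall k, f k t @[t --> F] --> l k) ->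
  \sum_(k < n) f k t @[t --> F] --> \sum_(k < n) l k.
Proof. by move=> fl; apply: cvg_big => //; exact: add_continuous. Qed.

Lemma is_derive_line (F : 'rV[C]_d -> C) (v : 'rV[C]_d) (t : C) :
  differentiable F (t *: v) ->
  exists l : C, is_derive t (1 : C) (fun t : C => F (t *: v)) l.
Proof.
move=> dF; pose g (t : C) := t *: v.
have [dg _] : is_diff t g ( *:%R^~ v) := is_diff_scalel t v.
have dFg : differentiable (F \o g) t := differentiable_comp dg dF.
exists ('D_(1 : C) (F \o g) t).
exact: (DeriveDef ((derivable1_diffP (F \o g) t).2 dFg) erefl).
Qed.

End Lines.

(** * From coisometries to dilations *)

Section Coisometry.
Variables (R : realType) (d : nat) (hd : (0 < d)%N) (a b : nat -> R).
Local Notation C := R[i].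
Local Notation X1 := (natural_domain d a).
Local Notation X2 := (natural_domain d b).
Local Notation V := 'rV[C]_d.
Variables (H1 : hilbert_function_space R X1) (H2 : hilbert_function_space R X2).
Hypotheses (hH1 : weighted_hardy H1) (hH2 : weighted_hardy H2).
Variables (lambda : X1 -> C) (phi : X1 -> X2) (W : {linear H2 -> H1}) (T : H1 -> H2).
Hypothesis WE : forall (f : H2) (x : X1), hfs_fun H1 (W f) x = lambda x * hfs_fun H2 f (phi x).
Hypothesis WT : is_adjoint W T.
Hypothesis Tiso : isometry (hfs_dot H2) (hfs_dot H1) T.
Let A n := (a n)%:C.
Let B n := (b n)%:C.

Lemma dot_ext (X : Type) (H : hilbert_function_space R X) (f g : H) :
  (forall h, hfs_dot H h f = hfs_dot H h g) -> f = g.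
Proof.
move=> h; apply/eqP; rewrite -subr_eq0; apply/eqP/hnorm_eq0.
have : hfs_dot H (f - g) (f - g) = 0 by rewrite dotBr h subrr.
rewrite dot_hnorm => /(@complexI R)/eqP; rewrite expf_eq0 /= => /eqP; exact.
Qed.

(** The adjoint sends the kernel vector at [x] to [(lambda x)^*] times the kernel
    vector at [phi x], and it preserves inner products. *)
Lemma kernel_identity z w : PS A (cdot (val z) (val w)) =
  lambda z * (lambda w)^* * PS B (cdot (val (phi z)) (val (phi w))).
Proof.
have [k1 [k1E k1K _]] := kernel_vectors hH1; have [k2 [k2E k2K _]] := kernel_vectors hH2.
have Tk x : T (k1 x) = (lambda x)^* *: k2 (phi x).
  by apply: dot_ext => f; rewrite -WT dotZr conjcK -k1E WE k2E.
have E : hfs_dot H2 (T (k1 w)) (T (k1 z)) = hfs_dot H1 (k1 w) (k1 z) := Tiso _ _.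
rewrite -k1K -E !Tk dotZl dotZr conjcK k2K; ring.
Qed.

Let weight_image : exists f : H2, forall x, hfs_fun H1 (W f) x = lambda x.
Proof.
have [f1 f1E] := constant_function hH2; exists f1 => x.
have E := congr1 (fun u => lambda x * u) (f1E (phi x)).
exact: (etrans (WE f1 x) (etrans E (mulr1 _))).
Qed.

Let a0 : a 0%N = 1. Proof. by have [] := wh_generating hH1. Qed.
Let a_gt0 n : 0 < a n. Proof. by have [] := wh_generating hH1. Qed.
Let b0 : b 0%N = 1. Proof. by have [] := wh_generating hH2. Qed.
Let b_gt0 n : 0 < b n. Proof. by have [] := wh_generating hH2. Qed.

Section Ball.
Variable r1 : R.
Hypotheses (r1_gt0 : 0 < r1) (r1a : (r1%:E <= conv_radius a)%E).
Let hA : has_radius A r1 := conv_radius_has_radius r1a.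

Let small_conv (z : V) : sqnorm z < r1 -> ((sqnorm z)%:E < conv_radius a)%E.
Proof. by move=> zr; apply: lt_le_trans r1a; rewrite lte_fin. Qed.

Let point (z : V) (zr : sqnorm z < r1) : X1 :=
  exist _ z (mem_set (natural_domain_small (small_conv zr))).

Variable o : X1.
Hypothesis o0 : val o = 0.

Let PSA0 : PS A 0 = 1.
Proof. by rewrite (PS0_radius r1_gt0 hA) /A a0. Qed.

Let cdot_o (z : X1) : cdot (val z) (val o) = 0.
Proof. exact: (etrans (congr1 (cdot (val z)) o0) (cdot0r (val z))). Qed.

Let kernel_o z :
  lambda z * (lambda o)^* * PS B (cdot (val (phi z)) (val (phi o))) = 1.
Proof.
exact: (etrans (esym (kernel_identity z o)) (etrans (congr1 (PS A) (cdot_o z)) PSA0)).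
Qed.

Lemma lambda_neq0 z : lambda z != 0.
Proof.
by apply/eqP => E; have := kernel_o z; rewrite E !mul0r => /eqP; rewrite eq_sym oner_eq0.
Qed.

Lemma PS_affine_le (t : R) : 0 <= t -> t < r1 ->
  exists2 v : R, 1 + a 1%N * t <= v & PS A t%:C = v%:C.
Proof.
move=> t0 tr; have tn : normc t%:C < r1 by rewrite normc_real ger0_norm.
have hS : has_radius (fun n => (a n.+1)%:C) r1.
  by move=> s s0 sr; exact: (@coef_boundedS R s s0 A (hA s0 sr)).
have [v av vE] := PS_pos hS (fun n => ltW (a_gt0 n.+1)) (a_gt0 1%N) t0 tr.
exists (1 + t * v); first by rewrite lerD2l mulrC ler_wpM2l.
by rewrite (PS_recl_radius hA tn) /A a0 vE realcD realcM.
Qed.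

(** Otherwise [k2 (phi z)] is never longer than [k2 (phi o)], and the kernel
    identity on the diagonal yields
      [|lambda z / lambda o|^2 >= PS A |z|^2 >= 1 + a 1 * |z|^2].
    On the other hand [lambda] belongs to the space, so that its values are inner
    products with kernel vectors, and the sum of the kernel vectors at four points
    of modulus [x], minus four times the one at the origin, has norm of order
    [x ^+ 3]; this contradicts [four_point_contradiction]. *)
Lemma image_of_origin_not_maximal :
  ~ (forall z, sqnorm (val (phi z)) <= sqnorm (val (phi o))).
Proof.
move=> hmax.
have [k1 [k1E k1K _]] := kernel_vectors hH1; have [k2 [k2E k2K k2L]] := kernel_vectors hH2.
have [f1 WfE] := weight_image.
have [F [FE FD]] := extension_derivable hH1 (W f1).
pose i0 : 'I_d := Ordinal hd; pose e : V := delta_mx 0 i0.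
have lo := lambda_neq0 o.
have k2_le z : hnorm (k2 (phi z)) ^+ 2 <= hnorm (k2 (phi o)) ^+ 2.
  have L x : complex.Re (series (fun n => B n * cdot (val x) (val x) ^+ n) n) @[n --> \oo] -->
      hnorm (k2 x) ^+ 2.
    have := @cvg_Re _ _ _ eventually_filter _ _ (k2L x x).
    by rewrite -k2K dot_hnorm.
  have Lz := L (phi z); have Lo := L (phi o).
  have Ez := cvg_lim (@Rhausdorff R) Lz; have Eo := cvg_lim (@Rhausdorff R) Lo.
  have h := @ler_lim _ _ _ _ _ _ (cvgP _ Lz) (cvgP _ Lo).
  rewrite Ez Eo in h; apply: h.
  have SE x n : complex.Re (series (fun n => B n * cdot (val x) (val x) ^+ n) n) =
      \sum_(0 <= i < n) b i * sqnorm (val x) ^+ i.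
    rewrite -[RHS]/(complex.Re (\sum_(0 <= i < n) b i * sqnorm (val x) ^+ i)%:C) rmorph_sum /=.
    by congr complex.Re; apply: eq_bigr => i _; rewrite cdot_sqnorm rmorphM rmorphXn.
  apply: nearW => n; rewrite !SE; apply: ler_sum => i _.
  by rewrite ler_wpM2l ?(ltW (b_gt0 _)) // lerXn2r ?nnegrE ?sqnorm_ge0.
have norm_o : normc (lambda o) ^+ 2 * hnorm (k2 (phi o)) ^+ 2 = 1.
  apply: (@complexI R); rewrite realcM -(dot_hnorm (k2 (phi o))) k2K -mulc_conj.
  exact: kernel_o.
have norm_k z : hnorm (k1 z) ^+ 2 = normc (lambda z) ^+ 2 * hnorm (k2 (phi z)) ^+ 2.
  apply: (@complexI R); rewrite [RHS]realcM.
  rewrite -(dot_hnorm (k2 (phi z))) -(dot_hnorm (k1 z)) k1K k2K -mulc_conj.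
  exact: kernel_identity.
pose n := Num.min 1 (r1 / 2).
have n0 : 0 < n by rewrite lt_min ltr01 divr_gt0.
have sqt (t : C) : normc t < n -> normc t ^+ 2 < r1 / 2.
  rewrite lt_min => /andP[t1 tr]; apply: le_lt_trans tr.
  by rewrite expr2 ler_piMl ?normc_ge0 // ltW.
have te (t : C) : normc t < n -> sqnorm (t *: e) < r1.
  move=> /sqt h; rewrite sqnormZ sqnorm_delta mulr1; apply: lt_trans h _.
  by rewrite ltr_pdivrMr // ltr_pMr // ltr1n.
pose mu (t : C) : C := (lambda o)^-1 * F (t *: e).
have pE (t : C) (tn : normc t < n) : mu t = (lambda o)^-1 * lambda (point (te t tn)).
  by rewrite /mu -(WfE (point (te t tn))) -FE.
have z0n : normc (0 : C) < n by rewrite normc0.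
have [l hl] : exists l : C, is_derive (0 : C) (1 : C) mu l.
  have d0 : differentiable F ((0 : C) *: e).
    by apply: FD; apply: small_conv; rewrite scale0r sqnorm0.
  have [l hl] := is_derive_line d0; eexists; exact: (is_derive_scale (lambda o)^-1 hl).
have mu0 : mu 0 = 1.
  have Fo : F 0 = lambda o by rewrite -o0; exact: (etrans (FE o) (WfE o)).
  by rewrite /mu scale0r Fo mulVf.
have mu_ge (t : C) : normc t < n -> 1 + a 1%N * normc t ^+ 2 <= normc (mu t) ^+ 2.
  move=> tn; rewrite (pE t tn).
  have ss : sqnorm (t *: e) = normc t ^+ 2 by rewrite sqnormZ sqnorm_delta mulr1.
  have tr : normc t ^+ 2 < r1 by rewrite -ss (te t tn).
  have [v v_ge vE] := PS_affine_le (sqr_ge0 (normc t)) tr.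
  apply: le_trans v_ge _; have kv : hnorm (k1 (point (te t tn))) ^+ 2 = v.
    by apply: (@complexI R); rewrite -dot_hnorm k1K -vE -ss -cdot_sqnorm.
  rewrite -kv norm_k normcM exprMn mulrC normcV exprVn.
  rewrite ler_wpM2r ?sqr_ge0 //; apply: le_trans (k2_le _) _.
  have l2 : normc (lambda o) ^+ 2 != 0 by rewrite expf_neq0 // gt_eqF // normc_gt0.
  by rewrite -(mulKf l2 (hnorm (k2 (phi o)) ^+ 2)) norm_o mulr1.
have [K K0 hK] := PS_four_points r1_gt0 hA.
pose K' := hnorm (W f1) * Num.sqrt (4 * K) / normc (lambda o).
apply: (@four_point_contradiction R mu l (a 1%N) K' n) => //.
move=> x x0 xn.
have inorm : normc ('i : C) = 1 := normc_i R.
have nx1 : normc x%:C < n by rewrite normc_real gtr0_norm.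
have nx2 : normc ('i * x%:C) < n by rewrite normcM inorm mul1r.
have nx3 : normc (- x%:C) < n by rewrite normcN.
have nx4 : normc (- 'i * x%:C) < n by rewrite normcM normcN inorm mul1r.
pose p1 := point (te _ nx1); pose p2 := point (te _ nx2).
pose p3 := point (te _ nx3); pose p4 := point (te _ nx4).
pose u := k1 p1 + k1 p2 + k1 p3 + k1 p4 - 4%:R *: k1 o.
have c4 : ((4%:R : C))^* = 4%:R by rewrite rmorph_nat.
have fu : hfs_dot H1 (W f1) u =
    lambda o * (mu x%:C + mu ('i * x%:C) + mu (- x%:C) + mu (- 'i * x%:C) - 4).
  rewrite /u dotBr !dotDr dotZr c4 -!k1E !WfE (pE _ nx1) (pE _ nx2) (pE _ nx3) (pE _ nx4).
  rewrite -/p1 -/p2 -/p3 -/p4; move: lo.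
  move: (lambda _) (lambda _) (lambda _) (lambda _) (lambda _).
  by move=> A1 A2 A3 A4 A5 A0; field.
pose y := x%:C ^+ 2.
pose M := PS A y + PS A ('i * y) + PS A (- y) + PS A (- 'i * y) - 4 * A 0%N.
have ci : ('i : C)^* = - 'i.
  by rewrite /= -[LHS]/(0 -i* 1); apply/eqP; rewrite eq_complex /= oppr0 !eqxx.
have i2 : ('i : C) * 'i = -1 by rewrite -expr2 sqr_i.
have cx (s t : C) : cdot (s *: e) (t *: e) = s * t^*.
  by rewrite cdotZl cdotZr cdot_sqnorm sqnorm_delta mulr1.
have A01 : A 0%N = 1 by rewrite /A a0.
have cj1 : x%:C^* = x%:C by exact: conjc_real.
have cjN (s : C) : (- s)^* = - s^* by exact: rmorphN.
have cj2 : ('i * x%:C)^* = - 'i * x%:C by rewrite conjcM ci cj1.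
have cj3 : (- x%:C)^* = - x%:C by rewrite cjN cj1.
have cj4 : (- 'i * x%:C)^* = 'i * x%:C by rewrite conjcM cjN ci opprK cj1.
have cdot_o' (s : C) : cdot (s *: e) (val o) = 0.
  exact: (etrans (congr1 (cdot (s *: e)) o0) (cdot0r _)).
have du (s : C) (sn : normc s < n) : hfs_dot H1 u (k1 (point (te s sn))) =
    PS A (s * x%:C) + PS A (- 'i * (s * x%:C)) + PS A (- (s * x%:C)) +
    PS A ('i * (s * x%:C)) - 4 * A 0%N.
  rewrite /u dotBl !dotDl dotZl !k1K !cx.
  rewrite cdot_o' PSA0 A01 cj1 cj2 cj3 cj4.
  by rewrite [s * (- 'i * _)]mulrCA mulrN [s * ('i * _)]mulrCA.
have xx : x%:C * x%:C = y by rewrite /y expr2.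
have y2 : 'i * x%:C * x%:C = 'i * y by rewrite -mulrA xx.
have y3 : - x%:C * x%:C = - y by rewrite mulNr xx.
have y4 : - 'i * x%:C * x%:C = - 'i * y by rewrite -mulrA xx.
have i_i : 'i * ('i * y) = - y by rewrite mulrA i2 mulN1r.
have ni_i : - 'i * ('i * y) = y by rewrite mulNr i_i opprK.
have i_ni : 'i * (- 'i * y) = y by rewrite mulNr mulrN i_i opprK.
have ni_ni : - 'i * (- 'i * y) = - y by rewrite [X in _ * X]mulNr mulrNN i_i.
have ni_y : - ('i * y) = - 'i * y by rewrite mulNr.
have nni_y : - (- 'i * y) = 'i * y by rewrite mulNr opprK.
have i_ny : 'i * - y = - 'i * y by rewrite mulrN mulNr.
have ni_ny : - 'i * - y = 'i * y by rewrite mulrNN.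
have du1 : hfs_dot H1 u (k1 p1) = M.
  apply: (etrans (du _ nx1)); rewrite xx /M.
  by move: (PS A y) (PS A ('i * y)) (PS A (- y)) (PS A (- 'i * y)) => g1 g2 g3 g4; ring.
have du2 : hfs_dot H1 u (k1 p2) = M.
  apply: (etrans (du _ nx2)); rewrite y2 ni_i ni_y i_i /M.
  by move: (PS A y) (PS A ('i * y)) (PS A (- y)) (PS A (- 'i * y)) => g1 g2 g3 g4; ring.
have du3 : hfs_dot H1 u (k1 p3) = M.
  apply: (etrans (du _ nx3)); rewrite y3 ni_ny opprK i_ny /M.
  by move: (PS A y) (PS A ('i * y)) (PS A (- y)) (PS A (- 'i * y)) => g1 g2 g3 g4; ring.
have du4 : hfs_dot H1 u (k1 p4) = M.
  apply: (etrans (du _ nx4)); rewrite y4 ni_ni nni_y i_ni /M.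
  by move: (PS A y) (PS A ('i * y)) (PS A (- y)) (PS A (- 'i * y)) => g1 g2 g3 g4; ring.
have du0 : hfs_dot H1 u (k1 o) = 0.
  have := du 0 z0n; rewrite mul0r !mulr0 oppr0 PSA0 A01.
  have -> : k1 (point (te 0 z0n)) = k1 o.
    by congr k1; apply: val_inj; rewrite /= scale0r o0.
  by move=> ->; ring.
have uu : hnorm u ^+ 2 <= 4 * K * (x ^+ 3) ^+ 2.
  have E : (hnorm u ^+ 2)%:C = 4 * M.
    by rewrite -dot_hnorm {2}/u dotBr !dotDr dotZr du1 du2 du3 du4 du0; ring.
  have -> : hnorm u ^+ 2 = 4 * normc M.
    have := congr1 (@normc R) E; rewrite normc_real ger0_norm ?sqr_ge0 // => ->.
    by rewrite normcM -[4](rmorph_nat (real_complex R)) normc_real ger0_norm.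
  have ny : normc y = x ^+ 2 by rewrite normcX normc_real gtr0_norm.
  have yr : normc y < r1 / 2 by rewrite ny; have := sqt _ nx1; rewrite normc_real gtr0_norm.
  rewrite -mulrA ler_wpM2l // -exprM mulnC exprM -ny; exact: hK.
have nu : hnorm u <= Num.sqrt (4 * K) * x ^+ 3.
  have K40 : 0 <= 4 * K by rewrite mulr_ge0.
  have x30 : 0 <= x ^+ 3 by rewrite exprn_ge0 // ltW.
  apply: ler_of_sqr; first by rewrite mulr_ge0 // sqrtr_ge0.
  by rewrite exprMn sqr_sqrtr.
have := dot_CauchySchwarz_norm (W f1) u; rewrite fu normcM => h.
have lon : 0 < normc (lambda o) by rewrite normc_gt0.
rewrite -(ler_pM2l lon); apply: le_trans h _.
have -> : normc (lambda o) * (K' * x ^+ 3) = hnorm (W f1) * (Num.sqrt (4 * K) * x ^+ 3).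
  by rewrite /K'; field; rewrite gt_eqF.
by rewrite ler_wpM2l ?hnorm_ge0.
Qed.

End Ball.

(** The images of the constant and of the coordinate functions are [lambda] and the
    products of [lambda] with the coordinates of [phi]. Their extensions [F] and
    [G k] are differentiable, hence so is [phi], whose coordinates are the
    quotients [G k / F]. *)
Lemma dilation_of_coisometry : exists g, 0 < g /\ forall n, a n = b n * g ^+ n.
Proof.
have [_ _ /conv_radius_gt0[r1 r1_gt0 r1a]] := wh_generating hH1.
have hA := conv_radius_has_radius r1a.
have small_conv (z : V) : sqnorm z < r1 -> ((sqnorm z)%:E < conv_radius a)%E.
  by move=> zr; apply: lt_le_trans r1a; rewrite lte_fin.
pose point (z : V) (zr : sqnorm z < r1) : X1 :=
  exist _ z (mem_set (natural_domain_small (small_conv z zr))).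
have small0 : sqnorm (0 : V) < r1 by rewrite sqnorm0.
pose o := point _ small0.
have [z1 hz1] : exists z1, sqnorm (val (phi o)) < sqnorm (val (phi z1)).
  apply: contrapT => no.
  apply: (@image_of_origin_not_maximal r1 r1_gt0 r1a o erefl) => z.
  rewrite leNgt; apply/negP => h; apply: no; exists z; exact: h.
pose r := sqnorm (val (phi z1)).
have rb : (r%:E <= conv_radius b)%E.
  by apply: natural_domain_le; exact: (set_mem (valP (phi z1))).
have hB := conv_radius_has_radius rb.
pose e0 := (sqnorm (val (phi o)) + r) / 2.
have po_ge0 := sqnorm_ge0 (val (phi o)).
have [e0_gt0 e0r pe0] : [/\ 0 < e0, e0 < r & sqnorm (val (phi o)) < e0].
  by move: hz1 po_ge0; rewrite /e0 /r; move: (sqnorm _) (sqnorm _) => s t; split; lra.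
have l_ne z : lambda z != 0 by exact: (@lambda_neq0 r1 r1_gt0 r1a o erefl).
have [f1 WfE] := weight_image.
have [F [FE FD]] := extension_derivable hH1 (W f1).
have coord k : exists G : V -> C,
    (forall x : X1, G (val x) = lambda x * val (phi x) 0 k) /\
    (forall z, ((sqnorm z)%:E < conv_radius a)%E -> differentiable G z).
  have [f fE] := coordinate_function hH2 k.
  have [G [GE GD]] := extension_derivable hH1 (W f).
  exists G; split; last exact: GD.
  move=> x; have E1 := WE f x.
  have E2 := congr1 (fun u => lambda x * u) (fE (phi x)).
  exact: (etrans (GE x) (etrans E1 E2)).
pose G k := projT1 (cid (coord k)).
have GE k x : G k (val x) = lambda x * val (phi x) 0 k.
  by have [h _] := projT2 (cid (coord k)); exact: h.
have GD k z : ((sqnorm z)%:E < conv_radius a)%E -> differentiable (G k) z.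
  by have [_ h] := projT2 (cid (coord k)); exact: h.
pose ph (z : V) : V := \row_k (G k z / F z).
have F_pt z (zr : sqnorm z < r1) : F z = lambda (point z zr).
  exact: (etrans (FE (point z zr)) (WfE (point z zr))).
have ph_pt z (zr : sqnorm z < r1) : ph z = val (phi (point z zr)).
  apply/rowP => k; rewrite mxE (F_pt z zr).
  have -> : G k z = lambda (point z zr) * val (phi (point z zr)) 0 k by exact: (GE k (point z zr)).
  by rewrite mulrC mulKf.
have F_ne z : sqnorm z < r1 -> F z != 0 by move=> zr; rewrite (F_pt z zr).
(* a neighbourhood of the origin mapped into a ball inside the disc of
   convergence *)
have [e1 e1_gt0 he1] : exists2 e1 : R, 0 < e1 &
    forall z, sqnorm z < e1 -> sqnorm z < r1 -> sqnorm (ph z) <= e0.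
  have cF : F z @[z --> (0 : V)] --> F 0.
    by apply: differentiable_continuous; apply: FD; apply: (small_conv _ small0).
  have cG k : G k z @[z --> (0 : V)] --> G k 0.
    by apply: differentiable_continuous; apply: GD; apply: (small_conv _ small0).
  have cS : sqnorm (ph z) @[z --> (0 : V)] --> sqnorm (ph 0).
    rewrite sqnorm_sumE (_ : (fun z => sqnorm (ph z)) =
        fun z => \sum_(k < d) normc (G k z / F z) ^+ 2); last first.
      by apply/funext => z; rewrite sqnorm_sumE; apply: eq_bigr => k _; rewrite mxE.
    apply: (@cvg_ord_sum _ _ (nbhs (0 : V)) _) => k.
    rewrite mxE expr2; under eq_fun do rewrite expr2.
    have cN : normc (G k z / F z) @[z --> (0 : V)] --> normc (G k 0 / F 0).
      have cV : (F z)^-1 @[z --> (0 : V)] --> (F 0)^-1.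
        by apply: cvgV cF; apply: F_ne.
      have cM : G k z / F z @[z --> (0 : V)] --> G k 0 / F 0 by apply: cvgM (cG k) cV.
      exact: (@cvg_normc R V (nbhs (0 : V)) (nbhs_filter (0 : V)) _ _ cM).
    have cNN := @cvgM R V (nbhs (0 : V)) (nbhs_filter (0 : V)) _ _ _ _ cN cN; exact: cNN.
  have : \forall z \near (0 : V), sqnorm (ph z) < e0.
    apply: (cvgr_lt _ cS); by rewrite (ph_pt 0 small0).
  move=> /nbhs_ballP[e /= e_gt0 he].
  have er : e = (complex.Re e)%:C by rewrite RRe_real // gtr0_real.
  have e'_gt0 : 0 < complex.Re e by rewrite -(ltcR 0) -er.
  exists (complex.Re e ^+ 2); first by rewrite exprn_gt0.
  move=> z ze zr; apply: ltW; apply: he; split=> // i j; rewrite /ball /= mxE sub0r normrN.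
  rewrite normCE er ltcR ord1 ltNge; apply/negP => h.
  move: ze; rewrite ltNge => /negP; apply; rewrite sqnorm_sumE (bigD1 j) //=.
  apply: (@le_trans _ _ (normc (z 0 j) ^+ 2)); first exact: ler_sqr_nneg (ltW e'_gt0) h.
  by rewrite lerDl sumr_ge0 // => k _; rewrite sqr_ge0.
have [e2 e2_gt0 he2] : exists2 e2 : R, 0 < e2 & forall x, normc x < e2 -> PS A x != 0.
  have [t t0 [_ tr]] : exists2 t : R, 0 < t & normc (0 : C) < t /\ t < r1.
    by apply: between; rewrite normc0.
  have tn0 : normc (0 : C) < t by rewrite normc0.
  have cont := PS_continuous t0 (hA t t0 tr) tn0.
  have A00 : PS A 0 = 1 by rewrite (PS0_radius r1_gt0 hA) /A a0.
  move/cvg_normcP: cont => /(_ 1 ltr01) /nbhs_ballP[e /= e_gt0 he].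
  have er : e = (complex.Re e)%:C by rewrite RRe_real // gtr0_real.
  exists (complex.Re e); first by rewrite -(ltcR 0) -er.
  move=> x xe; have := he x; rewrite /ball /= sub0r normrN normCE er ltcR => /(_ xe) h.
  by apply/eqP => E; move: h; rewrite A00 E subr0 normc1 ltxx.
pose del := Num.min (Num.min r1 e1) e2.
have del_gt0 : 0 < del by rewrite !lt_min r1_gt0 e1_gt0.
have dr1 (z : V) : sqnorm z < del -> sqnorm z < r1 by rewrite !lt_min => /andP[/andP[]].
have lineF (v : V) (t : C) : sqnorm (t *: v) < del ->
    exists l : C, is_derive t (1 : C) (fun t : C => F (t *: v)) l.
  by move=> /dr1 h; apply: is_derive_line; apply: FD; apply: (small_conv _ h).
apply: (@dilation_of_local_kernel_identity R d a b r1 r e0 del F ph) => //.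
- by rewrite !ge_min lexx.
- by move=> x; rewrite !lt_min => /andP[_ xe]; exact: he2.
- move=> z zd; apply: he1; last exact: dr1.
  by move: zd; rewrite !lt_min => /andP[/andP[]].
- move=> z w /dr1 zr /dr1 wr.
  rewrite (F_pt z zr) (F_pt w wr) (ph_pt z zr) (ph_pt w wr).
  exact: (kernel_identity (point z zr) (point w wr)).
move=> v k t td; have tr := dr1 _ td.
have [l1 h1] : exists l : C, is_derive t (1 : C) (fun t : C => G k (t *: v)) l.
  by apply: is_derive_line; apply: GD; apply: (small_conv _ tr).
have [l2 h2] := lineF v t td.
have [l3 h3] := @is_derive_inv R (fun t : C => F (t *: v)) t l2 (F_ne _ tr) h2.
eexists; rewrite (_ : (fun t0 : C => ph (t0 *: v) 0 k) =
    fun t0 : C => G k (t0 *: v) * (F (t0 *: v))^-1).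
  exact: is_derive_mul h1 h3.
by apply/funext => x; rewrite mxE.
Qed.

End Coisometry.

(** * From dilations to unitary operators *)

Section Transport.
Variables (R : realType) (X1 X2 : Type).
Local Notation C := R[i].
Variables (H1 : hilbert_function_space R X1) (H2 : hilbert_function_space R X2).
Variables (k1 : X1 -> H1) (k2 : X2 -> H2) (phi : X1 -> X2).
Hypothesis k1E : forall f w, hfs_fun H1 f w = hfs_dot H1 f (k1 w).
Hypothesis k2E : forall f w, hfs_fun H2 f w = hfs_dot H2 f (k2 w).
Hypothesis kernelE : forall z w,
  hfs_dot H1 (k1 w) (k1 z) = hfs_dot H2 (k2 (phi w)) (k2 (phi z)).

(** The correspondence [k2 (phi x) |-> k1 x], extended linearly. It is a relation
    because the kernel vectors may be linearly dependent; it is single-valued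
    since it preserves inner products. *)
Inductive transported : H2 -> H1 -> Prop :=
| Transported0 : transported 0 0
| TransportedD u v u' v' : transported u v -> transported u' v' ->
    transported (u + u') (v + v')
| TransportedZ (c : C) u v : transported u v -> transported (c *: u) (c *: v)
| TransportedK x : transported (k2 (phi x)) (k1 x).

Lemma transportedB u v u' v' : transported u v -> transported u' v' ->
  transported (u - u') (v - v').
Proof.
move=> h h'; rewrite -[- u']scaleN1r -[- v']scaleN1r.
by apply: TransportedD => //; apply: TransportedZ.
Qed.

Lemma transported_kernel u v x : transported u v ->
  hfs_dot H1 v (k1 x) = hfs_dot H2 u (k2 (phi x)).
Proof.
elim=> [|u1 v1 u2 v2 _ E1 _ E2|c u1 v1 _ E1|y]; rewrite ?dot0l ?dotDl ?dotZl //.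
- by rewrite E1 E2.
- by rewrite E1.
Qed.

Lemma transported_dot u v u' v' : transported u v -> transported u' v' ->
  hfs_dot H1 v v' = hfs_dot H2 u u'.
Proof.
move=> h; elim=> [|u1 v1 u2 v2 _ E1 _ E2|c u1 v1 _ E1|y].
- by rewrite !dot0r.
- by rewrite !dotDr E1 E2.
- by rewrite !dotZr E1.
- exact: transported_kernel.
Qed.

Lemma transported_hnorm u v : transported u v -> hnorm v = hnorm u.
Proof.
move=> h; have E := transported_dot h h; rewrite !dot_hnorm in E.
move/(@complexI R): E => E; apply/eqP.
by rewrite -(@eqrXn2 _ 2) ?hnorm_ge0 // E.
Qed.

(** If [u] almost realizes the distance from [f] to the span of the kernel vectors
    [k2 (phi x)], then moving [u] along [w] to the orthogonal projection hardly
    decreases the distance, so that [f - u] is almost orthogonal to [w]. *)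
Lemma almost_projection (f : H2) (e : R) : 0 < e -> exists u v, transported u v /\
  forall w w', transported w w' -> normc (hfs_dot H2 (f - u) w) <= e * hnorm w.
Proof.
move=> e0; pose S := [set x : R | exists u v, transported u v /\ x = hnorm (f - u) ^+ 2].
have S0 : S !=set0 by exists (hnorm (f - 0) ^+ 2), 0, 0; split=> //; exact: Transported0.
have Slb : has_lbound S by exists 0 => _ [u [v [_ ->]]]; rewrite sqr_ge0.
have e2 : 0 < e ^+ 2 by rewrite exprn_gt0.
have [_ [u [v [uv ->]]] hu] := inf_adherent e2 (conj S0 Slb).
exists u, v; split=> // w w' ww'.
have [N0|N0] := eqVneq (hnorm w) 0.
  by rewrite N0 mulr0 (hnorm_eq0 N0) dot0r normc0.
have Ng : 0 < hnorm w by rewrite lt_def N0 hnorm_ge0.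
pose N := hnorm w ^+ 2; have N_gt0 : 0 < N by rewrite exprn_gt0.
have NC : N%:C != 0 :> C by exact: real_neq0.
have E (g : H2) : hnorm (g - (hfs_dot H2 g w / N%:C) *: w) ^+ 2 =
    hnorm g ^+ 2 - normc (hfs_dot H2 g w) ^+ 2 / N.
  apply: (@complexI R); rewrite -[LHS]dot_hnorm !dotBl !dotBr !dotZl !dotZr.
  have -> : (hnorm g ^+ 2 - normc (hfs_dot H2 g w) ^+ 2 / N)%:C =
      (hnorm g ^+ 2)%:C - (normc (hfs_dot H2 g w) ^+ 2)%:C / N%:C.
    rewrite rmorphB; congr (_ - _); rewrite [LHS]realcM; congr (_ * _); exact: fmorphV.
  rewrite -mulc_conj !dot_hnorm -/N -(dot_conj g w) conjcM conjc_inv conjc_real.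
  move: (N%:C) NC (hfs_dot H2 g w) (_ ^*) ((hnorm g ^+ 2)%:C) => M M0 c c' G; field.
  exact: M0.
pose g := f - u; pose c := hfs_dot H2 g w.
have h1 : inf S <= hnorm (g - (c / N%:C) *: w) ^+ 2.
  apply: ge_inf => //; exists (u + (c / N%:C) *: w), (v + (c / N%:C) *: w').
  split; last by rewrite /g opprD addrA.
  by apply: TransportedD => //; apply: TransportedZ.
have : normc c ^+ 2 <= (e * hnorm w) ^+ 2.
  rewrite exprMn -/N -ler_pdivrMr //; move: h1 hu; rewrite (E g) -/c -/g.
  by move: (_ / N) (inf S) (hnorm g ^+ 2) (e ^+ 2) => x1 x2 x3 x4; lra.
by apply: ler_of_sqr; rewrite mulr_ge0 ?hnorm_ge0 // ltW.
Qed.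

(** The composition is isometric on the closed span of the kernel vectors
    [k2 (phi x)], and vanishes on its orthogonal complement. The almost projections
    [u n] of [f] form a Cauchy sequence, which is transported to a Cauchy sequence
    [v n]; the function [f - u n] nearly vanishes at the points [phi x], so that
    the limit of [v n] takes the values of [f] there. *)
Lemma composition_contraction (f : H2) : exists g : H1,
  (forall x, hfs_fun H1 g x = hfs_fun H2 f (phi x)) /\ hnorm g <= hnorm f.
Proof.
have hpos n : 0 < harmonic n :> R by rewrite /harmonic /= invr_gt0.
have proj n := almost_projection f (hpos n).
pose u n := projT1 (cid (proj n)).
have uP n := projT2 (cid (proj n)).
pose v n := projT1 (cid (uP n)).
have vP n := projT2 (cid (uP n)).
have uv n : transported (u n) (v n) by have [] := vP n.
have small n w w' : transported w w' ->
    normc (hfs_dot H2 (f - u n) w) <= harmonic n * hnorm w.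
  by have [_ h] := vP n; exact: h.
have cauchy n m : hnorm (v n - v m) <= harmonic n + harmonic m.
  have tw := transportedB (uv n) (uv m).
  rewrite (transported_hnorm tw); set w := u n - u m in tw *.
  have [->|w0] := eqVneq (hnorm w) 0; first by rewrite addr_ge0 // ltW.
  have wg : 0 < hnorm w by rewrite lt_def w0 hnorm_ge0.
  rewrite -(ler_pM2r wg) -expr2 mulrDl.
  have -> : hnorm w ^+ 2 = normc (hfs_dot H2 (f - u m) w - hfs_dot H2 (f - u n) w).
    rewrite -dotBl (_ : f - u m - (f - u n) = w) ?dot_hnorm ?normc_real ?ger0_norm ?sqr_ge0 //.
    by rewrite /w opprB addrC addrA subrK.
  apply: le_trans (le_normcD _ _) _; rewrite normcN addrC.
  by apply: lerD; apply: small tw.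
have hcv : harmonic n @[n --> \oo] --> (0 : R) by exact: cvg_harmonic.
have harm (e : R) : 0 < e -> \forall n \near \oo, harmonic n < e.
  move=> e0; move/cvgrPdist_lt: hcv => /(_ e e0); apply: filterS => n.
  by rewrite sub0r normrN gtr0_norm.
have cv : cvg (v @ \oo).
  apply: cauchy_cvg; apply: cauchy_exP => e e0.
  have er : e = (complex.Re e)%:C by rewrite RRe_real // gtr0_real.
  have e0' : 0 < complex.Re e by rewrite -(ltcR 0) -er.
  have e2 : 0 < complex.Re e / 2 by rewrite divr_gt0.
  have [N _ hN] := harm _ e2.
  exists (v N); exists N => // n Nn /=.
  rewrite -ball_normE /= hnormE er ltcR; apply: le_lt_trans (cauchy N n) _.
  have hh1 : harmonic N < complex.Re e / 2 := hN N (leqnn N).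
  have hh2 : harmonic n < complex.Re e / 2 := hN n Nn.
  by move: (harmonic N) (harmonic n) (complex.Re e) hh1 hh2 => x y z; lra.
pose g : H1 := lim (v @ \oo).
have vg (e : R) : 0 < e -> \forall n \near \oo, hnorm (g - v n) < e.
  move=> e0; have /cvgrPdist_lt/(_ e%:C) : v @ \oo --> g by exact: cv.
  rewrite (ltcR 0) => /(_ e0); apply: filterS => n.
  by rewrite hnormE ltcR.
exists g; split=> [x|].
  apply/eqP; rewrite -subr_eq0; apply/eqP/eq0_normc/eqP.
  rewrite eq_le normc_ge0 andbT; apply/ler_addgt0Pr => e e0; rewrite add0r.
  pose M := hnorm (k1 x) + hnorm (k2 (phi x)) + 1.
  have M0 : 0 < M by rewrite ltr_wpDl // addr_ge0 ?hnorm_ge0.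
  have eM : 0 < e / M by rewrite divr_gt0.
  near \oo => n.
  have h1 : hnorm (g - v n) < e / M by near: n; exact: vg.
  have h2 : harmonic n < e / M by near: n; exact: harm.
  have E : hfs_fun H1 g x - hfs_fun H2 f (phi x) =
      hfs_dot H1 (g - v n) (k1 x) - hfs_dot H2 (f - u n) (k2 (phi x)).
    by rewrite k1E k2E dotBl dotBl (transported_kernel x (uv n)); ring.
  rewrite E; apply: le_trans (le_normcD _ _) _; rewrite normcN.
  have h3 := dot_CauchySchwarz_norm (g - v n) (k1 x).
  have h4 := small n _ _ (TransportedK x).
  have eE : e = e / M * M by rewrite divfK // gt_eqF.
  have h5 : hnorm (g - v n) * hnorm (k1 x) <= e / M * hnorm (k1 x).
    by rewrite ler_wpM2r ?hnorm_ge0 // ltW.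
  have h6 : harmonic n * hnorm (k2 (phi x)) <= e / M * hnorm (k2 (phi x)).
    by rewrite ler_wpM2r ?hnorm_ge0 // ltW.
  rewrite eE /M !mulrDr mulr1.
  apply: le_trans (_ : e / M * hnorm (k1 x) + e / M * hnorm (k2 (phi x)) <= _).
    by apply: lerD; [exact: le_trans h3 h5 | exact: le_trans h4 h6].
  by rewrite lerDl ltW.
apply/ler_addgt0Pr => e e0; have e2 : 0 < e / 2 by rewrite divr_gt0.
near \oo => n.
have h1 : hnorm (g - v n) < e / 2 by near: n; exact: vg.
have h2 : harmonic n < e / 2 by near: n; exact: harm.
have h3 : hnorm (v n) <= hnorm f + harmonic n.
  rewrite (transported_hnorm (uv n)).
  have [->|w0] := eqVneq (hnorm (u n)) 0; first by rewrite addr_ge0 ?hnorm_ge0 // ltW.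
  have wg : 0 < hnorm (u n) by rewrite lt_def w0 hnorm_ge0.
  rewrite -(ler_pM2r wg) -expr2 mulrDl.
  have -> : hnorm (u n) ^+ 2 = normc (hfs_dot H2 f (u n) - hfs_dot H2 (f - u n) (u n)).
    rewrite -dotBl (_ : f - (f - u n) = u n) ?dot_hnorm ?normc_real ?ger0_norm ?sqr_ge0 //.
    by rewrite opprB addrC subrK.
  apply: le_trans (le_normcD _ _) _; rewrite normcN.
  by apply: lerD; [exact: dot_CauchySchwarz_norm | exact: small (uv n)].
have := hnormD_le (g - v n) (v n); rewrite subrK.
by move: (hnorm g) (hnorm (g - v n)) (hnorm (v n)) (harmonic n) h1 h2 h3 => x1 x2 x3 x4; lra.
Unshelve. all: by end_near. Qed.

End Transport.

Section Polarization.
Variables (R : realType) (X1 X2 : Type).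
Variables (H1 : hilbert_function_space R X1) (H2 : hilbert_function_space R X2).
Variable W : {linear H2 -> H1}.
Hypothesis Wnorm : forall f, hnorm (W f) = hnorm f.

Lemma Re_dot (X : Type) (H : hilbert_function_space R X) (f g : H) :
  complex.Re (hfs_dot H f g) = (hnorm (f + g) ^+ 2 - hnorm f ^+ 2 - hnorm g ^+ 2) / 2.
Proof.
have : (hnorm (f + g) ^+ 2)%:C = (hnorm f ^+ 2)%:C + (hnorm g ^+ 2)%:C +
    (hfs_dot H f g + (hfs_dot H f g)^*).
  by rewrite -[LHS]dot_hnorm dotDl !dotDr !dot_hnorm dot_conj; ring.
rewrite addcJ => /(congr1 (@complex.Re R)) /= ->.
by case: (hfs_dot H f g) => x y /=; field.
Qed.

Lemma isometry_dot f g : hfs_dot H1 (W f) (W g) = hfs_dot H2 f g.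
Proof.
have Re_eq f' g' : complex.Re (hfs_dot H1 (W f') (W g')) = complex.Re (hfs_dot H2 f' g').
  by rewrite !Re_dot -linearD !Wnorm.
have := Re_eq f ('i%C *: g); rewrite linearZ /= !dotZr.
have := Re_eq f g.
case: (hfs_dot H1 _ _) => x y; case: (hfs_dot H2 _ _) => x' y' /= -> E.
congr (_ +i* _); lra.
Qed.

End Polarization.

Section UnitaryComposition.
Variables (R : realType) (X1 X2 : Type).
Local Notation C := R[i].
Variables (H1 : hilbert_function_space R X1) (H2 : hilbert_function_space R X2).
Variables (k1 : X1 -> H1) (k2 : X2 -> H2) (phi : X1 -> X2) (psi : X2 -> X1).
Hypothesis k1E : forall f w, hfs_fun H1 f w = hfs_dot H1 f (k1 w).
Hypothesis k2E : forall f w, hfs_fun H2 f w = hfs_dot H2 f (k2 w).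
Hypothesis kernelE : forall z w,
  hfs_dot H1 (k1 w) (k1 z) = hfs_dot H2 (k2 (phi w)) (k2 (phi z)).
Hypotheses (phiK : cancel phi psi) (psiK : cancel psi phi).

(** Composition with [phi] and with [psi] are contractions that are inverse to each
    other, so that both are isometric. *)
Lemma unitary_composition : exists W : {linear H2 -> H1},
  weighted_composition (fun=> 1) phi W /\ unitary_op W.
Proof.
have kernelE' z w : hfs_dot H2 (k2 w) (k2 z) = hfs_dot H1 (k1 (psi w)) (k1 (psi z)).
  by rewrite kernelE !psiK.
have cW := composition_contraction k1E k2E kernelE.
have cV := composition_contraction k2E k1E kernelE'.
pose W0 f : H1 := projT1 (cid (cW f)).
have W0E f x : hfs_fun H1 (W0 f) x = hfs_fun H2 f (phi x).
  by have [h _] := projT2 (cid (cW f)); exact: h.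
have W0n f : hnorm (W0 f) <= hnorm f by have [_ h] := projT2 (cid (cW f)).
pose V f : H2 := projT1 (cid (cV f)).
have VE f y : hfs_fun H2 (V f) y = hfs_fun H1 f (psi y).
  by have [h _] := projT2 (cid (cV f)); exact: h.
have Vn f : hnorm (V f) <= hnorm f by have [_ h] := projT2 (cid (cV f)).
have W0lin : linear W0.
  move=> c f g; apply: hfs_fun_inj; apply/funext => x.
  rewrite W0E linearP linearP /= /GRing.scale /=.
  by rewrite -[RHS]/(c * hfs_fun H1 (W0 f) x + hfs_fun H1 (W0 g) x) !W0E.
pose W : {linear H2 -> H1} := HB.pack W0 (GRing.isLinear.Build _ _ _ _ W0 W0lin).
have WV : cancel V W.
  by move=> g; apply: hfs_fun_inj; apply/funext => x; rewrite W0E VE phiK.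
have VW : cancel W V.
  by move=> f; apply: hfs_fun_inj; apply/funext => y; rewrite VE W0E psiK.
have Wn f : hnorm (W f) = hnorm f.
  apply/eqP; rewrite eq_le W0n /=.
  by rewrite -{1}(VW f); exact: Vn.
exists W; split.
  split; first by exists 1 => f; rewrite mul1r !hnormE Wn lexx.
  by move=> f x; rewrite mul1r; exact: W0E.
exists V; split => // f g; rewrite -{1}(WV g); exact: isometry_dot.
Qed.

End UnitaryComposition.

Section Dilation.
Variables (R : realType) (d : nat).
Local Notation C := R[i].
Implicit Types (a b : nat -> R) (g : R).

Lemma pseries_dilation a b g (t : R) : (forall n, a n = b n * g ^+ n) ->
  pseries b (g * t) = pseries a t.
Proof.
move=> ab; apply/funext => n; rewrite /pseries /series /=.
by apply: eq_bigr => i _; rewrite ab exprMn mulrA.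
Qed.

Lemma conv_radius_dilation_le a b g : 0 < g -> (forall n, a n = b n * g ^+ n) ->
  (g%:E * conv_radius a <= conv_radius b)%E.
Proof.
move=> g0 ab; rewrite -lee_pdivlMl //; apply: ge_ereal_sup => _ [t /= ct <-].
rewrite lee_pdivlMl // -EFinM; apply: ereal_sup_ubound; exists (g * t) => /=.
  by rewrite (pseries_dilation _ ab).
by rewrite normrM gtr0_norm.
Qed.

Lemma dilation_sym a b g : 0 < g -> (forall n, a n = b n * g ^+ n) ->
  forall n, b n = a n * g^-1 ^+ n.
Proof.
by move=> g0 ab n; rewrite ab -mulrA -exprMn divff ?expr1n ?mulr1 // gt_eqF.
Qed.

Lemma conv_radius_dilation a b g : 0 < g -> (forall n, a n = b n * g ^+ n) ->
  conv_radius b = (g%:E * conv_radius a)%E.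
Proof.
move=> g0 ab; apply/eqP; rewrite eq_le (conv_radius_dilation_le g0 ab) andbT.
have g1 : 0 < g^-1 by rewrite invr_gt0.
have := conv_radius_dilation_le g1 (dilation_sym g0 ab).
by rewrite lee_pdivrMl.
Qed.

Lemma natural_domain_dilation a b g (z : 'rV[C]_d) : 0 < g ->
  (forall n, a n = b n * g ^+ n) -> (0 < conv_radius a)%E ->
  natural_domain d a z -> natural_domain d b ((Num.sqrt g)%:C *: z).
Proof.
move=> g0 ab a0.
have sg : sqnorm ((Num.sqrt g)%:C *: z) = g * sqnorm z.
  by rewrite sqnormZ normc_real ger0_norm ?sqrtr_ge0 // sqr_sqrtr // ltW.
rewrite /natural_domain (conv_radius_dilation g0 ab).
case: (conv_radius a) a0 => [x| |//] a0; last by rewrite gt0_muley // lte_fin.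
rewrite -EFinM /= (pseries_dilation _ ab).
case: ifP => _; first by rewrite /closed_ball2 /= sg !lee_fin ler_pM2l.
by rewrite /open_ball2 /= sg !lte_fin ltr_pM2l.
Qed.

End Dilation.

Section DilationUnitary.
Variables (R : realType) (d : nat) (a b : nat -> R).
Local Notation C := R[i].
Local Notation X1 := (natural_domain d a).
Local Notation X2 := (natural_domain d b).
Variables (H1 : hilbert_function_space R X1) (H2 : hilbert_function_space R X2).
Hypotheses (hH1 : weighted_hardy H1) (hH2 : weighted_hardy H2).

Lemma unitary_of_dilation g : 0 < g -> (forall n, a n = b n * g ^+ n) ->
  exists (lambda : X1 -> C) (phi : X1 -> X2) (W : {linear H2 -> H1}),
    weighted_composition lambda phi W /\ unitary_op W.
Proof.
move=> g0 ab; have [_ _ ra] := wh_generating hH1; have [_ _ rb] := wh_generating hH2.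
have g1 : 0 < g^-1 by rewrite invr_gt0.
have ba := dilation_sym g0 ab.
pose phi (x : X1) : X2 := exist _ ((Num.sqrt g)%:C *: val x)
  (mem_set (natural_domain_dilation g0 ab ra (set_mem (valP x)))).
pose psi (y : X2) : X1 := exist _ ((Num.sqrt g^-1)%:C *: val y)
  (mem_set (natural_domain_dilation g1 ba rb (set_mem (valP y)))).
have sg : (Num.sqrt g^-1)%:C * (Num.sqrt g)%:C = 1 :> C.
  by rewrite -realcM -sqrtrM ?(ltW g1) // mulVf ?sqrtr1 // gt_eqF.
have phiK : cancel phi psi.
  by move=> x; apply: val_inj; rewrite /= scalerA sg scale1r.
have psiK : cancel psi phi.
  by move=> x; apply: val_inj; rewrite /= scalerA mulrC sg scale1r.
have [k1 [k1E k1K _]] := kernel_vectors hH1; have [k2 [k2E k2K _]] := kernel_vectors hH2.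
have kernelE z w : hfs_dot H1 (k1 w) (k1 z) = hfs_dot H2 (k2 (phi w)) (k2 (phi z)).
  rewrite k1K k2K /= cdotZl cdotZr conjc_real mulrA -realcM -expr2 sqr_sqrtr ?(ltW g0) //.
  rewrite /PS; congr (limn (series _)); apply/funext => n.
  by rewrite ab realcM exprMn [(g ^+ n)%:C]rmorphXn mulrA.
exists (fun=> 1), phi; exact: unitary_composition k1E k2E kernelE phiK psiK.
Qed.

End DilationUnitary.

Lemma coisometric_of_unitary (R : realType) (X1 X2 : Type)
    (H1 : hilbert_function_space R X1) (H2 : hilbert_function_space R X2) (W : H2 -> H1) :
  unitary_op W -> coisometric_op W.
Proof.
move=> [T [WT _ TK]]; exists T; split => // f g.
by apply: (etrans (esym (WT _ _))); rewrite TK.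
Qed.

Theorem theorem7p10 (R : realType) (d : nat) (hd : (0 < d)%N)
    (a b : nat -> R)
    (H1 : hilbert_function_space R (natural_domain d a))
    (H2 : hilbert_function_space R (natural_domain d b))
    (hH1 : weighted_hardy H1) (hH2 : weighted_hardy H2) :
  [<-> exists (lambda : natural_domain d a -> R[i])
         (phi : natural_domain d a -> natural_domain d b)
         (W : {linear H2 -> H1}),
         weighted_composition lambda phi W /\ unitary_op W;
       exists (lambda : natural_domain d a -> R[i])
         (phi : natural_domain d a -> natural_domain d b)
         (W : {linear H2 -> H1}),
         weighted_composition lambda phi W /\ coisometric_op W;
       exists gamma : R, 0 < gamma /\ forall n, a n = b n * gamma ^+ n ].
Proof.
tfae.
- move=> [lambda [phi [W [hW uW]]]]; exists lambda, phi, W.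
  by split; [exact: hW | exact: coisometric_of_unitary].
- move=> [lambda [phi [W [[_ WE] [T [WT Tiso]]]]]].
  exact: (dilation_of_coisometry hd hH1 hH2 WE WT Tiso).
- by move=> [gamma [g0 ab]]; exact: (unitary_of_dilation hH1 hH2 g0 ab).
Qed.
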